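(* Let $\mathcal{C}$ be a sequence in the open unit disk $\mathbb{D}$ and let $F:\mathbb{D}\to\mathbb{D}$ be a maximal function with critical set $\mathcal{C}$. Then $F$ is an indestructible Blaschke product.
   Context: $\mathbb{D}=\{z\in\mathbb{C}:|z|<1\}$. A conformal pseudometric $\lambda(z)\,|dz|$ on a domain $G\subseteq\mathbb{C}$ is given by a continuous function $\lambda:G\to[0,+\infty)$, $\lambda\not\equiv0$ (its density); it is regular if $\lambda$ is of class $C^2$ on $\{z\in G:\lambda(z)>0\}$. For a continuous function $u$ the generalized lower Laplacian is $\Delta u(z)=\liminf_{r\to0}\frac{4}{r^2}\left(\frac1{2\pi}\int_0^{2\pi}u(z+re^{it})\,dt-u(z)\right)$, which is the usual Laplacian if $u$ is $C^2$. The (Gauss) curvature is $\kappa_\lambda(z)=-\Delta(\log\lambda)(z)/\lambda(z)^2$ at points with $\lambda(z)>0$. An SK-metric on $G$ is a conformal pseudometric with $\kappa_\lambda(z)\le-4$ for all $z\in G$ with $\lambda(z)>0$. Constant curvature $-4$ means regular with $\kappa_\lambda(z)=-4$ wherever $\lambda(z)>0$. A sequence $\mathcal{C}$ of points in $G$ (empty, finite or infinite, repetitions allowed), in which the distinct points $z_j$ occur with multiplicity $m_j\in\mathbb{N}$, is the zero set of $\lambda(z)\,|dz|$ if $\lambda>0$ off $\mathcal{C}$ and for every $j$ the limit $\lim_{z\to z_j}\lambda(z)/|z-z_j|^{m_j}$ exists and is $\neq0$. Let $\Phi_{\mathcal{C}}$ be the family of all densities $\lambda$ of SK-metrics on $\mathbb{D}$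 with $\limsup_{z\to z_j}\lambda(z)/|z-z_j|^{m_j}<+\infty$ for all $j$. If $\Phi_{\mathcal{C}}\neq\emptyset$, then $\lambda_{max}(z):=\sup_{\lambda\in\Phi_{\mathcal{C}}}\lambda(z)$, $z\in\mathbb{D}$, induces a regular conformal pseudometric of constant curvature $-4$ on $\mathbb{D}$ with zero set $\mathcal{C}$, called the maximal conformal pseudometric on $\mathbb{D}$ with constant curvature $-4$ and zero set $\mathcal{C}$. A maximal function with critical set $\mathcal{C}$ is an analytic function $F:\mathbb{D}\to\mathbb{D}$ with $\lambda_{max}(z)=\frac{|F'(z)|}{1-|F(z)|^2}$ for all $z\in\mathbb{D}$. A Blaschke product is a function $B(z)=\eta\prod_{j}\frac{\overline{a_j}}{|a_j|}\frac{a_j-z}{1-\overline{a_j}z}$ with $|\eta|=1$ and $(a_j)$ a finite or infinite sequence in $\mathbb{D}$ with $\sum_j(1-|a_j|)<\infty$ (the factor is $z$ when $a_j=0$). It is indestructible if $T\circ B$ is a Blaschke product for every unit disk automorphism $T$. *)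

(* Defs.v *)
From Stdlib Require Import Reals List.
From Coquelicot Require Import Coquelicot.

Open Scope R_scope.

(* Functions on a set G are total functions; only their values on G matter. *)

Definition unit_disk (z : C) : Prop := Cmod z < 1.

(* Extended-real lower and upper limits of f along a filter; Coquelicot only
   has them for sequences. *)
Definition image_on {T : Type} (f : T -> R) (P : T -> Prop) (x : R) : Prop :=
  exists t, P t /\ x = f t.

Definition liminf_along {T : Type} (F : (T -> Prop) -> Prop) (f : T -> R) : Rbar :=
  Rbar_lub (fun y => exists P, F P /\ y = Glb_Rbar (image_on f P)).

Definition limsup_along {T : Type} (F : (T -> Prop) -> Prop) (f : T -> R) : Rbar :=
  Rbar_glb (fun y => exists P, F P /\ y = Lub_Rbar (image_on f P)).

Definition conformal_pseudometric (G : C -> Prop) (lam : C -> R) : Prop :=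
  (forall z, G z -> continuous lam z) /\
  (forall z, G z -> 0 <= lam z) /\
  (exists z, G z /\ lam z <> 0).

Definition circle_point (z : C) (r t : R) : C :=
  (z + (r * cos t, r * sin t)%R)%C.

(* Only r near 0 matters, so u need only be continuous near z. *)
Definition lower_laplacian (u : C -> R) (z : C) : Rbar :=
  liminf_along (at_right 0) (fun r =>
    4 / r ^ 2 *
    (1 / (2 * PI) * RInt (fun t => u (circle_point z r t)) 0 (2 * PI) - u z)).

Definition curvature (lam : C -> R) (z : C) : Rbar :=
  Rbar_div (Rbar_opp (lower_laplacian (fun w => ln (lam w)) z)) (lam z ^ 2).

Definition SK_metric (G : C -> Prop) (lam : C -> R) : Prop :=
  conformal_pseudometric G lam /\
  forall z, G z -> 0 < lam z -> Rbar_le (curvature lam z) (-4).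

(* A finite or infinite (possibly empty) sequence of points is a function
   c : nat -> option C; an index n with c n = None carries no term. *)

Definition multiplicity (c : nat -> option C) (z : C) (m : nat) : Prop :=
  exists l : list nat,
    NoDup l /\ length l = m /\ forall n, In n l <-> c n = Some z.

(* Each point must occur only finitely often, since the multiplicities are
   natural numbers; discreteness is not required. *)
Definition sequence_in (G : C -> Prop) (c : nat -> option C) : Prop :=
  (forall n z, c n = Some z -> G z) /\
  (forall z, exists m, multiplicity c z m).

Definition Phi (c : nat -> option C) (lam : C -> R) : Prop :=
  SK_metric unit_disk lam /\
  forall (z0 : C) (m : nat), (0 < m)%nat -> multiplicity c z0 m ->
    Rbar_lt
      (limsup_along (locally' z0) (fun z => lam z / Cmod (z - z0)%C ^ m))
      p_infty.

Definition lambda_max (c : nat -> option C) (z : C) : Rbar :=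
  Lub_Rbar (fun x => exists lam, Phi c lam /\ x = lam z).

Definition analytic_on (G : C -> Prop) (f : C -> C) : Prop :=
  forall z, G z -> @ex_derive C_AbsRing C_NormedModule f z.

Definition analytic_self_map (f : C -> C) : Prop :=
  analytic_on unit_disk f /\ forall z, unit_disk z -> unit_disk (f z).

Definition maximal_function (c : nat -> option C) (F : C -> C) : Prop :=
  (exists lam, Phi c lam) /\
  analytic_self_map F /\
  forall z, unit_disk z ->
    lambda_max c z = Finite (Cmod (C_derive F z) / (1 - Cmod (F z) ^ 2)).

Definition blaschke_factor (a z : C) : C :=
  if Ceq_dec a 0 then z
  else (Cconj a / Cmod a * ((a - z) / (1 - Cconj a * z)))%C.

Fixpoint blaschke_partial (a : nat -> option C) (z : C) (n : nat) : C :=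
  match n with
  | O => RtoC 1
  | S k => (blaschke_partial a z k *
            match a k with
            | Some w => blaschke_factor w z
            | None => RtoC 1
            end)%C
  end.

(* The empty product, a unimodular constant, is not excluded, but it is never
   a self-map of the open disk. *)
Definition blaschke_product (B : C -> C) : Prop :=
  exists (eta : C) (a : nat -> option C),
    Cmod eta = 1 /\
    (forall n w, a n = Some w -> unit_disk w) /\
    ex_series (fun n => match a n with Some w => 1 - Cmod w | None => 0 end) /\
    forall z, unit_disk z ->
      filterlim (fun n => (eta * blaschke_partial a z n)%C)
        eventually (locally (B z)).

Definition disk_automorphism (T : C -> C) : Prop :=
  analytic_self_map T /\
  exists S : C -> C, analytic_self_map S /\
    forall z, unit_disk z -> S (T z) = z /\ T (S z) = z.

Definition indestructible_blaschke_product (B : C -> C) : Prop :=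
  blaschke_product B /\
  forall T, disk_automorphism T -> blaschke_product (fun z => T (B z)).

(* Main.v *)
Require Import Defs.
From Stdlib Require Import Reals Lra Lia Psatz Classical ClassicalEpsilon.
From Coquelicot Require Import Coquelicot.

Open Scope R_scope.

(* Write F = B g with B the Blaschke product of the zeros of F and g zero-free, |F| <= |g| <= 1;
   the point is to show |g| = 1.  With u = - ln |g|, q = |F|, p = - ln q + sqrt (1 - q), one has
   u <= p.  If u <= th (129/128) p for some 0 < th <= 1, then the density
   exp (u - th p) |F'| / (1 - q^2), extended by 0 at the zeros of F, has curvature <= -4: indeed
   ln |F'|, ln |F| and u are harmonic, and the concave term - th sqrt (1 - q) contributes enough
   to the Laplacian to absorb exp (2 (u - th p)).  By maximality it is at most |F'| / (1 - q^2),
   so u <= th p.  Iterating gives u <= (128/129)^n p, hence u <= 0 at some point, and g is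
   constant by the maximum principle.  Finally T o F is again maximal for every disk
   automorphism T, because T preserves the hyperbolic metric. *)

(** A density of curvature $-4$ multiplied by [exp v] with [v] harmonic has curvature
    [-4 exp (-2 v)], so it is admissible only where [v <= 0]. For [u] this is exactly what is not
    known; the root in [p] is there to pay for a small positive excess of [u - th p]. In the
    variable [ln q], the price of the excess and the gain, namely the second derivative of
    [- th sqrt (1 - q)], are both of order [th (1 - q)^(-3/2)] as [q] tends to [1]; with [1 - q] in
    place of its root the gain would stay bounded and lose. As [q] tends to [0] the gain is of order
    [th q] and the price is of smaller order. Both sides scale with [th], which is why one fixed
    ratio serves every stage and the iteration does not stall. The term [- ln q] is harmonic off the
    zeros of [F]: it costs nothing, starts the iteration through [|F| <= |g|], and makes the density
    vanish at the zeros of [F], where the root is not smooth. No boundary values of [F] or [g]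
    enter. *)

(** * The modulus and neighbourhoods in the plane *)

Lemma exp_le_compat (x y : R) : x <= y -> exp x <= exp y.
Proof. intros [H|H]; [left; apply exp_increasing, H|right; f_equal; exact H]. Qed.

Lemma half_pos (e : R) : 0 < e -> 0 < e / 2.
Proof. lra. Qed.

Lemma Cmod_triangle_sub (a b : C) : Cmod (a - b) <= Cmod a + Cmod b.
Proof.
  unfold Cminus. eapply Rle_trans; [apply Cmod_triangle|]. rewrite Cmod_opp. lra.
Qed.

Lemma Cmod_sub_sym (a b : C) : Cmod (a - b) = Cmod (b - a).
Proof. rewrite <- Cmod_opp. f_equal. ring. Qed.

Lemma Cmod_triangle_rev (a b : C) : Cmod a - Cmod b <= Cmod (a - b).
Proof.
  replace a with ((a - b) + b)%C at 1 by ring.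
  pose proof (Cmod_triangle (a - b) b). lra.
Qed.

Lemma Cmod_dist_rev (a b : C) : Rabs (Cmod a - Cmod b) <= Cmod (a - b).
Proof.
  apply Rabs_le. pose proof (Cmod_triangle_rev a b).
  pose proof (Cmod_triangle_rev b a). rewrite Cmod_sub_sym in H0. lra.
Qed.

Lemma Csub_eq0 (a b : C) : (a - b)%C = 0 -> a = b.
Proof. intros H. replace a with ((a - b) + b)%C by ring. rewrite H. ring. Qed.

Lemma Csub_neq0 (a b : C) : a <> b -> (a - b)%C <> 0.
Proof. intros H K. apply H, Csub_eq0, K. Qed.

Lemma Cmod_sub_pos (a b : C) : a <> b -> 0 < Cmod (a - b).
Proof. intros H. apply Cmod_gt_0, Csub_neq0, H. Qed.

Lemma Cmod_sub_diag (z : C) : Cmod (z - z) = 0.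
Proof. replace (z - z)%C with (RtoC 0) by ring. apply Cmod_0. Qed.

(** Balls of the product structure on [C] are squares; comparing them with Euclidean discs costs a
    factor [sqrt 2]. Later neighbourhood arguments go through this equivalence. *)
Lemma locally_Cmod (z : C) (P : C -> Prop) :
  locally z P <-> exists d, 0 < d /\ forall w, Cmod (w - z) < d -> P w.
Proof.
  split.
  - intros [d Hd]. exists d. split; [apply cond_pos|].
    intros w Hw. apply Hd. apply C_NormedModule_mixin_compat1. exact Hw.
  - intros [d [Hd H]].
    assert (Hs : 0 < sqrt 2) by (apply sqrt_lt_R0; lra).
    exists (mkposreal (d / sqrt 2) (Rdiv_lt_0_compat _ _ Hd Hs)).
    intros w Hw. apply H.
    pose proof (C_NormedModule_mixin_compat2 z w _ Hw) as HH. simpl in HH.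
    replace (sqrt 2 * (d / sqrt 2)) with d in HH by (field; lra). exact HH.
Qed.

Lemma locally_CmodI (z : C) (d : R) : 0 < d -> locally z (fun w => Cmod (w - z) < d).
Proof. intros H. apply locally_Cmod. exists d. auto. Qed.

Lemma unit_disk_locally (z : C) : unit_disk z -> locally z unit_disk.
Proof.
  intros H. apply locally_Cmod. exists (1 - Cmod z). unfold unit_disk in *. split; [lra|].
  intros w Hw. pose proof (Cmod_triangle_rev w z). lra.
Qed.

(** * Limits, continuity and derivatives of complex-valued functions *)

(* Stated with [Cmod] rather than with Coquelicot's [filterlim], because the
   latter sees [C] under two different uniform structures. *)
Definition Ctends {T} (Fl : (T -> Prop) -> Prop) (f : T -> C) (l : C) : Prop :=
  forall e, 0 < e -> Fl (fun t => Cmod (f t - l) < e).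

Section Tends.
Context {T : Type} (Fl : (T -> Prop) -> Prop) {FF : Filter Fl}.

Lemma Ctends_const (l : C) : Ctends Fl (fun _ => l) l.
Proof.
  intros e He. apply filter_forall. intros _.
  rewrite Cmod_sub_diag. exact He.
Qed.

Lemma Ctends_ext_loc (f g : T -> C) l :
  Fl (fun t => f t = g t) -> Ctends Fl f l -> Ctends Fl g l.
Proof.
  intros H Hf e He. generalize (filter_and _ _ H (Hf e He)).
  apply filter_imp. intros x [E K]. rewrite <- E. exact K.
Qed.

Lemma Ctends_plus (f g : T -> C) l m :
  Ctends Fl f l -> Ctends Fl g m -> Ctends Fl (fun t => f t + g t)%C (l + m)%C.
Proof.
  intros Hf Hg e He.
  generalize (filter_and _ _ (Hf (e/2) (half_pos e He)) (Hg (e/2) (half_pos e He))).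
  apply filter_imp. intros x [A B].
  replace (f x + g x - (l + m))%C with ((f x - l) + (g x - m))%C by ring.
  eapply Rle_lt_trans; [apply Cmod_triangle|]. lra.
Qed.

Lemma Ctends_mult (f g : T -> C) l m :
  Ctends Fl f l -> Ctends Fl g m -> Ctends Fl (fun t => f t * g t)%C (l * m)%C.
Proof.
  intros Hf Hg e He.
  pose proof (Cmod_ge_0 l) as Hl. pose proof (Cmod_ge_0 m) as Hm.
  set (d := Rmin 1 (e / (Cmod l + Cmod m + 1))).
  assert (Hd : 0 < d). { unfold d. apply Rmin_pos; [lra|]. apply Rdiv_lt_0_compat; lra. }
  assert (Hd1 : d <= 1) by apply Rmin_l.
  assert (Hd2 : d * (Cmod l + Cmod m + 1) <= e).
  { apply Rle_trans with ((e / (Cmod l + Cmod m + 1)) * (Cmod l + Cmod m + 1)).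
    - apply Rmult_le_compat_r; [lra|apply Rmin_r].
    - right; field; lra. }
  generalize (filter_and _ _ (Hf d Hd) (Hg d Hd)).
  apply filter_imp. intros x [A B].
  replace (f x * g x - l * m)%C
    with ((f x - l) * (g x - m) + (f x - l) * m + l * (g x - m))%C by ring.
  eapply Rle_lt_trans; [apply Cmod_triangle|].
  eapply Rle_lt_trans; [apply Rplus_le_compat_r; apply Cmod_triangle|].
  rewrite !Cmod_mult.
  pose proof (Cmod_ge_0 (f x - l)). pose proof (Cmod_ge_0 (g x - m)).
  nra.
Qed.

Lemma Ctends_opp (f : T -> C) l : Ctends Fl f l -> Ctends Fl (fun t => - f t)%C (- l)%C.
Proof.
  intros H e He. generalize (H e He). apply filter_imp. intros x K.
  replace (- f x - - l)%C with (- (f x - l))%C by ring. rewrite Cmod_opp. exact K.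
Qed.

Lemma Ctends_minus (f g : T -> C) l m :
  Ctends Fl f l -> Ctends Fl g m -> Ctends Fl (fun t => f t - g t)%C (l - m)%C.
Proof. intros Hf Hg. apply Ctends_plus; [exact Hf|apply Ctends_opp; exact Hg]. Qed.

Lemma Ctends_inv (f : T -> C) (l : C) :
  l <> 0 -> Ctends Fl f l -> Ctends Fl (fun t => / f t)%C (/ l)%C.
Proof.
  intros Hl Hf e He.
  pose proof (proj1 (Cmod_gt_0 l) Hl) as L.
  set (d := Rmin (Cmod l / 2) (e * (Cmod l) ^ 2 / 2)).
  assert (Hd : 0 < d).
  { unfold d. apply Rmin_pos; [lra|]. assert (0 < Cmod l ^ 2) by nra. nra. }
  assert (H1 : d <= Cmod l / 2) by apply Rmin_l.
  assert (H2 : d <= e * (Cmod l) ^ 2 / 2) by apply Rmin_r.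
  generalize (Hf d Hd). apply filter_imp. intros x A.
  pose proof (Cmod_triangle_rev l (f x)). rewrite Cmod_sub_sym in H.
  assert (B : Cmod l / 2 < Cmod (f x)) by lra.
  assert (N : f x <> 0) by (apply Cmod_gt_0; lra).
  replace (/ f x - / l)%C with (- ((f x - l) / (f x * l)))%C by (field; auto).
  rewrite Cmod_opp, Cmod_div by (apply Cmult_neq_0; auto). rewrite Cmod_mult.
  apply Rlt_div_l; [nra|].
  apply Rlt_le_trans with (e * (Cmod l ^ 2 / 2)); [lra|]. nra.
Qed.

Lemma Ctends_Re (f : T -> C) l : Ctends Fl f l -> filterlim (fun t => Re (f t)) Fl (locally (Re l)).
Proof.
  intros H P [e He]. generalize (H e (cond_pos e)). unfold filtermap. apply filter_imp.
  intros x Hx. apply He. unfold ball; simpl. unfold AbsRing_ball, abs, minus, plus, opp; simpl.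
  eapply Rle_lt_trans; [|exact Hx]. apply (re_le_Cmod (f x - l)%C).
Qed.

Lemma Cmod_Im_le (c : C) : Rabs (Im c) <= Cmod c.
Proof. eapply Rle_trans; [|apply Rmax_Cmod]. apply Rmax_r. Qed.

Lemma Ctends_Im (f : T -> C) l : Ctends Fl f l -> filterlim (fun t => Im (f t)) Fl (locally (Im l)).
Proof.
  intros H P [e He]. generalize (H e (cond_pos e)). unfold filtermap. apply filter_imp.
  intros x Hx. apply He. unfold ball; simpl. unfold AbsRing_ball, abs, minus, plus, opp; simpl.
  eapply Rle_lt_trans; [|exact Hx]. apply (Cmod_Im_le (f x - l)%C).
Qed.

Lemma Ctends_Cmod (f : T -> C) l :
  Ctends Fl f l -> filterlim (fun t => Cmod (f t)) Fl (locally (Cmod l)).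
Proof.
  intros H P [e He]. generalize (H e (cond_pos e)). unfold filtermap. apply filter_imp.
  intros x Hx. apply He. unfold ball; simpl. unfold AbsRing_ball, abs, minus, plus, opp; simpl.
  eapply Rle_lt_trans; [|exact Hx]. apply Cmod_dist_rev.
Qed.

Lemma Ctends_filterlim (f : T -> C) l :
  Ctends Fl f l -> filterlim f Fl (locally l).
Proof.
  intros H P HP. apply locally_Cmod in HP. destruct HP as [d [Hd K]].
  generalize (H d Hd). unfold filtermap. apply filter_imp. intros x Hx. apply K, Hx.
Qed.

End Tends.

Definition Ccont (f : C -> C) (z : C) : Prop := Ctends (locally z) f (f z).

Lemma Ccont_id z : Ccont (fun w => w) z.
Proof. intros e He. apply locally_CmodI, He. Qed.

Lemma Ctends_comp {T} (Fl : (T -> Prop) -> Prop) {FF : Filter Fl} (f : C -> C) (g : T -> C) l :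
  Ctends Fl g l -> Ccont f l -> Ctends Fl (fun t => f (g t)) (f l).
Proof.
  intros Hg Hf e He. apply Hf in He. apply (Ctends_filterlim _ _ _ Hg) in He. exact He.
Qed.

(** The increment form, free of division, so that [w = z] needs no exclusion. *)
Definition Cderiv (f : C -> C) (z l : C) : Prop :=
  forall e, 0 < e ->
    locally z (fun w => Cmod (f w - f z - l * (w - z)) <= e * Cmod (w - z)).

Lemma Cderiv_cont f z l : Cderiv f z l -> Ccont f z.
Proof.
  intros H e He. pose proof (Cmod_ge_0 l) as Hl.
  assert (Hd : 0 < e / (Cmod l + 1)) by (apply Rdiv_lt_0_compat; lra).
  generalize (filter_and _ _ (H 1 Rlt_0_1) (locally_CmodI z _ Hd)).
  apply filter_imp. intros w [A B].
  replace (f w - f z)%C with ((f w - f z - l * (w - z)) + l * (w - z))%C by ring.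
  eapply Rle_lt_trans; [apply Cmod_triangle|]. rewrite Cmod_mult.
  assert (Cmod (w - z) * (Cmod l + 1) < e).
  { apply Rlt_div_r in B; lra. }
  nra.
Qed.

Lemma Cderiv_ext_loc f g z l :
  locally z (fun w => f w = g w) -> Cderiv f z l -> Cderiv g z l.
Proof.
  intros H Hf e He. pose proof (locally_singleton _ _ H) as E.
  generalize (filter_and _ _ H (Hf e He)). apply filter_imp.
  intros w [A B]. rewrite <- A, <- E. exact B.
Qed.

Lemma Cderiv_eq f z l m : l = m -> Cderiv f z l -> Cderiv f z m.
Proof. intros ->. auto. Qed.

Lemma Cderiv_const k z : Cderiv (fun _ => k) z 0.
Proof.
  intros e He. apply filter_forall. intros w.
  replace (k - k - 0 * (w - z))%C with (RtoC 0) by ring. rewrite Cmod_0.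
  pose proof (Cmod_ge_0 (w - z)). nra.
Qed.

Lemma Cderiv_id z : Cderiv (fun w => w) z 1.
Proof.
  intros e He. apply filter_forall. intros w.
  replace (w - z - 1 * (w - z))%C with (RtoC 0) by ring. rewrite Cmod_0.
  pose proof (Cmod_ge_0 (w - z)). nra.
Qed.

Lemma Cderiv_plus f g z l m :
  Cderiv f z l -> Cderiv g z m -> Cderiv (fun w => f w + g w)%C z (l + m)%C.
Proof.
  intros Hf Hg e He.
  generalize (filter_and _ _ (Hf (e/2) (half_pos e He)) (Hg (e/2) (half_pos e He))).
  apply filter_imp. intros w [A B].
  replace (f w + g w - (f z + g z) - (l + m) * (w - z))%C
    with ((f w - f z - l * (w - z)) + (g w - g z - m * (w - z)))%C by ring.
  eapply Rle_trans; [apply Cmod_triangle|]. lra.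
Qed.

(** Carathéodory's form of differentiability. It reduces the product, inverse and chain rules to the
    algebra of limits, and its [q] is the difference quotient that reappears in the division of
    analytic functions by [w - a]. *)
Lemma Cderiv_iff_quot f z l :
  Cderiv f z l <->
  exists q : C -> C, Ctends (locally z) q l /\ q z = l /\ forall w, f w = (f z + q w * (w - z))%C.
Proof.
  split.
  - intros H. exists (fun w => if Ceq_dec w z then l else ((f w - f z) / (w - z))%C).
    split; [|split].
    + intros e He. generalize (H (e/2) (half_pos e He)). apply filter_imp. intros w A.
      destruct (Ceq_dec w z) as [E|E].
      * rewrite Cmod_sub_diag. exact He.
      * assert (N : (w - z)%C <> 0) by (apply Csub_neq0, E).
        replace ((f w - f z) / (w - z) - l)%C
          with ((f w - f z - l * (w - z)) / (w - z))%C by (field; exact N).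
        rewrite Cmod_div by exact N.
        pose proof (proj1 (Cmod_gt_0 _) N).
        apply Rlt_div_l; [lra|]. nra.
    + destruct (Ceq_dec z z); congruence.
    + intros w. destruct (Ceq_dec w z) as [E|E].
      * subst. ring.
      * field. intros K; apply E; apply Csub_eq0; exact K.
  - intros [q [Hq [E Hf]]] e He.
    generalize (Hq e He). apply filter_imp. intros w A. rewrite (Hf w).
    replace (f z + q w * (w - z) - f z - l * (w - z))%C with ((q w - l) * (w - z))%C by ring.
    rewrite Cmod_mult. apply Rmult_le_compat_r; [apply Cmod_ge_0|lra].
Qed.

Lemma Cderiv_mult f g z l m :
  Cderiv f z l -> Cderiv g z m -> Cderiv (fun w => f w * g w)%C z (l * g z + f z * m)%C.
Proof.
  intros Hf Hg. pose proof (Cderiv_cont _ _ _ Hf) as Cf.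
  apply Cderiv_iff_quot in Hf. destruct Hf as [p [Hp [Ep Ef]]].
  apply Cderiv_iff_quot in Hg. destruct Hg as [q [Hq [Eqz Eg]]].
  apply Cderiv_iff_quot. exists (fun w => p w * g z + f w * q w)%C.
  split; [|split].
  - apply Ctends_plus; try apply locally_filter.
    + apply Ctends_mult; try apply locally_filter; auto. apply Ctends_const, locally_filter.
    + apply Ctends_mult; try apply locally_filter; auto.
  - rewrite Ep, Eqz. reflexivity.
  - intros w. rewrite (Eg w), (Ef w) at 1. rewrite (Ef w). ring.
Qed.

Lemma Cderiv_scal k f z l : Cderiv f z l -> Cderiv (fun w => k * f w)%C z (k * l)%C.
Proof.
  intros H. apply (Cderiv_eq _ _ (0 * f z + k * l)%C); [ring|].
  apply (Cderiv_mult (fun _ => k)); [apply Cderiv_const|exact H].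
Qed.

Lemma Cderiv_opp f z l : Cderiv f z l -> Cderiv (fun w => - f w)%C z (- l)%C.
Proof.
  intros H. apply (Cderiv_eq _ _ (- (1) * l)%C); [ring|].
  apply Cderiv_ext_loc with (fun w => - (1) * f w)%C; [|apply Cderiv_scal, H].
  apply filter_forall. intros; ring.
Qed.

Lemma Cderiv_minus f g z l m :
  Cderiv f z l -> Cderiv g z m -> Cderiv (fun w => f w - g w)%C z (l - m)%C.
Proof. intros Hf Hg. apply Cderiv_plus; [exact Hf|apply Cderiv_opp, Hg]. Qed.

Lemma Cderiv_inv (f : C -> C) (z l : C) :
  f z <> 0 -> Cderiv f z l -> Cderiv (fun w => / f w)%C z (- l / (f z * f z))%C.
Proof.
  intros N Hf. pose proof (Cderiv_cont _ _ _ Hf) as Cf.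
  apply Cderiv_iff_quot in Hf. destruct Hf as [p [Hp [Ep Ef]]].
  assert (L : locally z (fun w => f w <> 0)).
  { generalize (Cf _ (proj1 (Cmod_gt_0 _) N)). apply filter_imp. intros w A E.
    rewrite E in A. replace (0 - f z)%C with (- f z)%C in A by ring.
    rewrite Cmod_opp in A. lra. }
  apply Cderiv_ext_loc with (fun w => / f z + (- (p w * (/ f w * / f z))) * (w - z))%C.
  - generalize L. apply filter_imp. intros w A. rewrite (Ef w) in *. field. auto.
  - apply Cderiv_iff_quot. exists (fun w => - (p w * (/ f w * / f z)))%C.
    split; [|split].
    + replace (- l / (f z * f z))%C with (- (l * (/ f z * / f z)))%C by (field; auto).
      apply Ctends_opp; [apply locally_filter|].
      apply Ctends_mult; [apply locally_filter|exact Hp|].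
      apply Ctends_mult; [apply locally_filter| |apply Ctends_const, locally_filter].
      apply Ctends_inv; [apply locally_filter|exact N|exact Cf].
    + rewrite Ep. field; auto.
    + intros w. ring.
Qed.

Lemma Cderiv_comp f g z l m :
  Cderiv g z m -> Cderiv f (g z) l -> Cderiv (fun w => f (g w)) z (l * m)%C.
Proof.
  intros Hg Hf. pose proof (Cderiv_cont _ _ _ Hg) as Cg.
  apply Cderiv_iff_quot in Hf. destruct Hf as [p [Hp [Ep Ef]]].
  apply Cderiv_iff_quot in Hg. destruct Hg as [q [Hq [Eqz Eg]]].
  apply Cderiv_iff_quot. exists (fun w => p (g w) * q w)%C.
  split; [|split].
  - apply Ctends_mult; [apply locally_filter| |exact Hq].
    rewrite <- Ep. apply (Ctends_comp _ p g); [exact Cg|].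
    unfold Ccont. rewrite Ep. exact Hp.
  - rewrite Ep, Eqz. reflexivity.
  - intros w. cbv beta. rewrite (Ef (g w)). rewrite (Eg w). ring.
Qed.

Lemma locally_punctured_C (z : C) (d : R) :
  0 < d -> exists w : C, w <> z /\ Cmod (w - z) < d.
Proof.
  intros Hd. exists (z + RtoC (d / 2))%C.
  replace (z + RtoC (d/2) - z)%C with (RtoC (d/2)) by ring.
  rewrite Cmod_R, Rabs_right by lra. split; [|lra].
  intros E. assert (K : RtoC (d/2) = 0).
  { replace (RtoC (d/2)) with (z + RtoC (d/2) - z)%C by ring. rewrite E. ring. }
  apply RtoC_inj in K. lra.
Qed.

Lemma Cderiv_unique f z l m : Cderiv f z l -> Cderiv f z m -> l = m.
Proof.
  intros Hl Hm. destruct (Ceq_dec l m) as [E|E]; [exact E|exfalso].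
  assert (N : (l - m)%C <> 0) by (apply Csub_neq0, E).
  pose proof (proj1 (Cmod_gt_0 _) N) as P.
  set (e := Cmod (l - m) / 4).
  assert (He : 0 < e) by (unfold e; lra).
  pose proof (filter_and _ _ (Hl e He) (Hm e He)) as K.
  apply locally_Cmod in K. destruct K as [d [Hd K]].
  destruct (locally_punctured_C z d Hd) as [w [W1 W2]].
  destruct (K w W2) as [A B].
  assert (Nw : (w - z)%C <> 0) by (apply Csub_neq0, W1).
  pose proof (proj1 (Cmod_gt_0 _) Nw) as Pw.
  assert (Cmod ((l - m) * (w - z)) <= 2 * e * Cmod (w - z)).
  { replace ((l - m) * (w - z))%C
      with ((f w - f z - m * (w - z)) - (f w - f z - l * (w - z)))%C by ring.
    eapply Rle_trans; [apply Cmod_triangle_sub|]. lra. }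
  rewrite Cmod_mult in H. unfold e in H. nra.
Qed.

Lemma is_derive_Cderiv (f : C -> C) (z l : C) :
  @is_derive C_AbsRing C_NormedModule f z l <-> Cderiv f z l.
Proof.
  split.
  - intros [_ H] e He.
    specialize (H z (fun P HP => HP) (mkposreal e He)). simpl in H.
    destruct H as [d Hd]. apply locally_Cmod. exists d. split; [apply cond_pos|].
    intros w Hw. specialize (Hd w Hw).
    change (Cmod (f w - f z - (w - z) * l) <= e * Cmod (w - z)) in Hd.
    rewrite (Cmult_comm l). exact Hd.
  - intros H. split; [apply is_linear_scal_l|].
    intros x Hx [e He].
    assert (Ex : z = x).
    { apply (is_filter_lim_locally_unique (K:=C_AbsRing) (V:=AbsRing_NormedModule C_AbsRing)). exact Hx. }
    subst x. pose proof (H e He) as K0. apply locally_Cmod in K0. destruct K0 as [d [Hd K]].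
    exists (mkposreal d Hd). intros w Hw.
    specialize (K w Hw).
    change (Cmod (f w - f z - (w - z) * l) <= e * Cmod (w - z)).
    rewrite (Cmult_comm _ l). exact K.
Qed.

Definition holo (f : C -> C) : Prop := forall z, unit_disk z -> exists l, Cderiv f z l.

Lemma analytic_on_holo f : analytic_on unit_disk f <-> holo f.
Proof.
  split; intros H z Hz; destruct (H z Hz) as [l Hl]; exists l; apply is_derive_Cderiv; exact Hl.
Qed.

Lemma Cderiv_C_derive f z l : Cderiv f z l -> C_derive f z = l.
Proof. intros H. apply is_C_derive_unique. apply is_derive_Cderiv in H. exact H. Qed.

Lemma holo_C_derive f z : holo f -> unit_disk z -> Cderiv f z (C_derive f z).
Proof.
  intros H Hz. destruct (H z Hz) as [l Hl]. rewrite (Cderiv_C_derive _ _ _ Hl). exact Hl.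
Qed.

Lemma holo_cont f z : holo f -> unit_disk z -> Ccont f z.
Proof. intros H Hz. destruct (H z Hz) as [l Hl]. exact (Cderiv_cont _ _ _ Hl). Qed.

Lemma holo_const k : holo (fun _ => k).
Proof. intros z _. exists 0. apply Cderiv_const. Qed.
Lemma holo_id : holo (fun w => w).
Proof. intros z _. exists 1. apply Cderiv_id. Qed.
Lemma holo_minus f g : holo f -> holo g -> holo (fun w => f w - g w)%C.
Proof. intros A B z Hz. destruct (A z Hz), (B z Hz). eexists. apply Cderiv_minus; eauto. Qed.
Lemma holo_mult f g : holo f -> holo g -> holo (fun w => f w * g w)%C.
Proof. intros A B z Hz. destruct (A z Hz), (B z Hz). eexists. apply Cderiv_mult; eauto. Qed.
Lemma holo_inv (f : C -> C) : (forall z, unit_disk z -> f z <> 0) -> holo f -> holo (fun w => / f w)%C.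
Proof. intros N A z Hz. destruct (A z Hz). eexists. apply Cderiv_inv; eauto. Qed.
Lemma holo_comp f g :
  (forall z, unit_disk z -> unit_disk (g z)) -> holo f -> holo g -> holo (fun w => f (g w)).
Proof. intros M A B z Hz. destruct (B z Hz). destruct (A _ (M z Hz)). eexists. eapply Cderiv_comp; eauto. Qed.
Lemma holo_pow f n : holo f -> holo (fun w => f w ^ n)%C.
Proof.
  intros H. induction n.
  - apply (holo_const 1).
  - apply (holo_mult f (fun w => f w ^ n)%C); auto.
Qed.

(** * Subdivision of rectangles and Goursat's theorem *)

Section Bisection.
Variables (al be : R) (Hal : 0 < al) (Hbe : 0 < be).
Variable P : R -> R -> R -> Prop.

Let quarter (x y w : R) (p : R * R) : Prop :=
  (fst p = x \/ fst p = x + w / 2 * al) /\ (snd p = y \/ snd p = y + w / 2 * be) /\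
  ~ P (fst p) (snd p) (w / 2).

Let next (w : R) (p : R * R) : R * R :=
  epsilon (inhabits p) (quarter (fst p) (snd p) w).

Let corner (x0 y0 w0 : R) (n : nat) : R * R :=
  nat_rect (fun _ => (R * R)%type) (x0, y0) (fun k p => next (w0 / 2 ^ k) p) n.

(* [P x y w] is a property of the rectangle [x, x + w al] * [y, y + w be];
   the proof is a Cousin-type bisection. *)
Lemma rectangle_bisection (x0 y0 w0 : R) :
  0 < w0 ->
  (forall x y w, 0 < w ->
     P x y (w / 2) -> P (x + w / 2 * al) y (w / 2) ->
     P x (y + w / 2 * be) (w / 2) -> P (x + w / 2 * al) (y + w / 2 * be) (w / 2) ->
     P x y w) ->
  (forall p q, x0 <= p <= x0 + w0 * al -> y0 <= q <= y0 + w0 * be ->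
     exists d, 0 < d /\ forall x y w, 0 < w < d ->
       x <= p <= x + w * al -> y <= q <= y + w * be -> P x y w) ->
  P x0 y0 w0.
Proof.
  intros Hw0 Hsub Hloc. apply NNPP. intros HN.
  set (c := corner x0 y0 w0).
  assert (Hw : forall n, 0 < w0 / 2 ^ n).
  { intros n. apply Rdiv_lt_0_compat; [lra|apply pow_lt; lra]. }
  assert (HwS : forall n, w0 / 2 ^ S n = w0 / 2 ^ n / 2).
  { intros n. simpl. field. apply pow_nonzero; lra. }
  assert (Hstep : forall n, ~ P (fst (c n)) (snd (c n)) (w0 / 2 ^ n) ->
            quarter (fst (c n)) (snd (c n)) (w0 / 2 ^ n) (c (S n))).
  { intros n Hn.
    change (c (S n)) with (next (w0 / 2 ^ n) (c n)). unfold next. apply epsilon_spec.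
    apply NNPP. intros K. apply Hn.
    apply Hsub; [apply Hw| | | |]; apply NNPP; intros L; apply K.
    - exists (fst (c n), snd (c n)). repeat split; auto.
    - exists (fst (c n) + w0 / 2 ^ n / 2 * al, snd (c n)). repeat split; auto.
    - exists (fst (c n), snd (c n) + w0 / 2 ^ n / 2 * be). repeat split; auto.
    - exists (fst (c n) + w0 / 2 ^ n / 2 * al, snd (c n) + w0 / 2 ^ n / 2 * be).
      repeat split; auto. }
  assert (HNn : forall n, ~ P (fst (c n)) (snd (c n)) (w0 / 2 ^ n)).
  { induction n as [|n IH].
    - simpl. replace (w0 / 1) with w0 by field. exact HN.
    - rewrite HwS. exact (proj2 (proj2 (Hstep n IH))). }
  assert (Hq : forall n, fst (c n) <= fst (c (S n)) /\
     fst (c (S n)) + w0 / 2 ^ S n * al <= fst (c n) + w0 / 2 ^ n * al /\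
     snd (c n) <= snd (c (S n)) /\
     snd (c (S n)) + w0 / 2 ^ S n * be <= snd (c n) + w0 / 2 ^ n * be).
  { intros n. destruct (Hstep n (HNn n)) as [A [B _]]. rewrite HwS.
    pose proof (Hw n).
    assert (0 < w0 / 2 ^ n * al) by (apply Rmult_lt_0_compat; auto).
    assert (0 < w0 / 2 ^ n * be) by (apply Rmult_lt_0_compat; auto).
    destruct A as [A|A], B as [B|B]; rewrite A, B; repeat split; lra. }
  assert (Hm : forall n k, fst (c n) <= fst (c (n + k)%nat) /\
     fst (c (n + k)%nat) + w0 / 2 ^ (n + k) * al <= fst (c n) + w0 / 2 ^ n * al /\
     snd (c n) <= snd (c (n + k)%nat) /\
     snd (c (n + k)%nat) + w0 / 2 ^ (n + k) * be <= snd (c n) + w0 / 2 ^ n * be).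
  { intros n k. induction k as [|k IH].
    - rewrite Nat.add_0_r. lra.
    - rewrite Nat.add_succ_r. specialize (Hq (n + k)%nat). lra. }
  assert (Hnm : forall n m, fst (c n) <= fst (c m) + w0 / 2 ^ m * al /\
                            snd (c n) <= snd (c m) + w0 / 2 ^ m * be).
  { intros n m.
    assert (Pa : forall k, 0 < w0 / 2 ^ k * al) by (intros; apply Rmult_lt_0_compat; auto).
    assert (Pb : forall k, 0 < w0 / 2 ^ k * be) by (intros; apply Rmult_lt_0_compat; auto).
    destruct (Nat.le_ge_cases n m) as [L|L].
    - specialize (Hm n (m - n)%nat). replace (n + (m - n))%nat with m in Hm by lia.
      specialize (Pa m). specialize (Pb m). lra.
    - specialize (Hm m (n - m)%nat). replace (m + (n - m))%nat with n in Hm by lia.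
      specialize (Pa n). specialize (Pb n). lra. }
  destruct (completeness (fun v => exists n, v = fst (c n))) as [p [Hp1 Hp2]].
  { exists (fst (c 0%nat) + w0 / 2 ^ 0 * al). intros v [n ->]. apply Hnm. }
  { exists (fst (c 0%nat)). exists 0%nat. reflexivity. }
  destruct (completeness (fun v => exists n, v = snd (c n))) as [q [Hq1 Hq2]].
  { exists (snd (c 0%nat) + w0 / 2 ^ 0 * be). intros v [n ->]. apply Hnm. }
  { exists (snd (c 0%nat)). exists 0%nat. reflexivity. }
  assert (Bp : forall n, fst (c n) <= p <= fst (c n) + w0 / 2 ^ n * al).
  { intros n. split; [apply Hp1; exists n; reflexivity|].
    apply Hp2. intros v [k ->]. apply Hnm. }
  assert (Bq : forall n, snd (c n) <= q <= snd (c n) + w0 / 2 ^ n * be).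
  { intros n. split; [apply Hq1; exists n; reflexivity|].
    apply Hq2. intros v [k ->]. apply Hnm. }
  destruct (Hloc p q) as [d [Hd K]].
  { specialize (Bp 0%nat). simpl in Bp. replace (w0 / 1) with w0 in Bp by field. exact Bp. }
  { specialize (Bq 0%nat). simpl in Bq. replace (w0 / 1) with w0 in Bq by field. exact Bq. }
  destruct (pow_lt_1_zero (1/2) ltac:(rewrite Rabs_right; lra) (d / w0)
     ltac:(apply Rdiv_lt_0_compat; lra)) as [N HNN].
  specialize (HNN N (Nat.le_refl _)).
  apply (HNn N). apply K; [|apply Bp|apply Bq].
  split; [apply Hw|].
  rewrite Rabs_right in HNN.
  2:{ apply Rle_ge, pow_le; lra. }
  unfold Rdiv in HNN at 1. rewrite Rmult_1_l, pow_inv in HNN.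
  apply Rlt_div_r in HNN; [|lra]. unfold Rdiv. rewrite Rmult_comm. exact HNN.
Qed.
End Bisection.

(** * Integrals of complex-valued functions *)

Definition is_Cint (f : R -> C) (a b : R) (l : C) : Prop :=
  is_RInt (fun t => Re (f t)) a b (Re l) /\ is_RInt (fun t => Im (f t)) a b (Im l).

Lemma C_ext (a b : C) : Re a = Re b -> Im a = Im b -> a = b.
Proof. destruct a, b; simpl; intros -> ->; reflexivity. Qed.

Lemma is_RInt_zero a b : is_RInt (fun _ : R => 0) a b 0.
Proof.
  pose proof (is_RInt_const a b 0) as K. unfold scal in K; simpl in K.
  unfold mult in K; simpl in K. rewrite Rmult_0_r in K. exact K.
Qed.

Lemma is_Cint_unique f a b l m : is_Cint f a b l -> is_Cint f a b m -> l = m.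
Proof.
  intros [A B] [A' B']. apply C_ext.
  - rewrite <- (is_RInt_unique _ _ _ _ A). apply is_RInt_unique, A'.
  - rewrite <- (is_RInt_unique _ _ _ _ B). apply is_RInt_unique, B'.
Qed.

Lemma is_Cint_ext f g a b l :
  (forall t, Rmin a b < t < Rmax a b -> f t = g t) -> is_Cint f a b l -> is_Cint g a b l.
Proof.
  intros E [A B]. split; [eapply is_RInt_ext, A|eapply is_RInt_ext, B];
  intros t Ht; cbv beta; rewrite (E t Ht); reflexivity.
Qed.

Lemma is_Cint_plus f g a b l m :
  is_Cint f a b l -> is_Cint g a b m -> is_Cint (fun t => f t + g t)%C a b (l + m)%C.
Proof.
  intros [A B] [A' B']. split.
  - apply (is_RInt_plus _ _ _ _ _ _ A A').
  - apply (is_RInt_plus _ _ _ _ _ _ B B').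
Qed.

Lemma is_Cint_cmult k f a b l :
  is_Cint f a b l -> is_Cint (fun t => k * f t)%C a b (k * l)%C.
Proof.
  intros [A B]. split.
  - apply (is_RInt_minus _ _ _ _ _ _ (is_RInt_scal _ _ _ (Re k) _ A) (is_RInt_scal _ _ _ (Im k) _ B)).
  - apply (is_RInt_plus _ _ _ _ _ _ (is_RInt_scal _ _ _ (Re k) _ B) (is_RInt_scal _ _ _ (Im k) _ A)).
Qed.

Lemma is_Cint_opp f a b l : is_Cint f a b l -> is_Cint (fun t => - f t)%C a b (- l)%C.
Proof.
  intros [A B]. split; [apply (is_RInt_opp _ _ _ _ A)|apply (is_RInt_opp _ _ _ _ B)].
Qed.

Lemma is_Cint_minus f g a b l m :
  is_Cint f a b l -> is_Cint g a b m -> is_Cint (fun t => f t - g t)%C a b (l - m)%C.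
Proof. intros A B. apply is_Cint_plus; [exact A|apply is_Cint_opp, B]. Qed.

Lemma is_Cint_conj f a b l : is_Cint f a b l -> is_Cint (fun t => Cconj (f t)) a b (Cconj l).
Proof.
  intros [A B]. split; [exact A|]. apply (is_RInt_opp _ _ _ _ B).
Qed.

Lemma is_Cint_Chasles f a b c l m :
  is_Cint f a b l -> is_Cint f b c m -> is_Cint f a c (l + m)%C.
Proof.
  intros [A B] [A' B']. split.
  - apply (is_RInt_Chasles _ _ _ _ _ _ A A').
  - apply (is_RInt_Chasles _ _ _ _ _ _ B B').
Qed.

Lemma is_Cint_const k a b : is_Cint (fun _ => k) a b (RtoC (b - a) * k)%C.
Proof.
  destruct k as [u v]. split.
  - replace (Re (RtoC (b - a) * (u, v))) with ((b - a) * u) by (simpl; ring).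
    apply (is_RInt_const a b u).
  - replace (Im (RtoC (b - a) * (u, v))) with ((b - a) * v) by (simpl; ring).
    apply (is_RInt_const a b v).
Qed.

Lemma is_Cint_id a b : is_Cint (fun t => RtoC t) a b (RtoC ((b ^ 2 - a ^ 2) / 2)).
Proof.
  split; simpl.
  - replace ((b * (b * 1) - a * (a * 1)) / 2) with (minus (b ^ 2 / 2) (a ^ 2 / 2))
      by (unfold minus, plus, opp; simpl; field).
    apply (is_RInt_derive (fun x => x ^ 2 / 2)).
    + intros x _. auto_derive; [trivial|field].
    + intros x _. apply continuous_id.
  - apply is_RInt_zero.
Qed.

Lemma is_Cint_cont f a b :
  (forall t, Rmin a b <= t <= Rmax a b -> Ctends (locally t) f (f t)) -> exists l, is_Cint f a b l.
Proof.
  intros H.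
  destruct (ex_RInt_continuous (fun t => Re (f t)) a b) as [x Hx].
  { intros t Ht. apply (Ctends_Re (locally t) f (f t)). auto. }
  destruct (ex_RInt_continuous (fun t => Im (f t)) a b) as [y Hy].
  { intros t Ht. apply (Ctends_Im (locally t) f (f t)). auto. }
  exists (x, y). split; assumption.
Qed.

(** Multiplying the integrand by [Cconj l] makes the integral the real number [Cmod l ^ 2], so that
    only the real part of the integrand has to be compared with [Cmod l * g]. *)
Lemma is_Cint_bound_fun f (g : R -> R) a b l M :
  a <= b -> (forall t, a <= t <= b -> Cmod (f t) <= g t) ->
  is_RInt g a b M -> is_Cint f a b l -> Cmod l <= M.
Proof.
  intros Hab Hb Hg Hl.
  destruct (Req_dec (Cmod l) 0) as [E|E].
  { rewrite E. apply (is_RInt_le (fun _ => 0) g a b).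
    - exact Hab.
    - apply is_RInt_zero.
    - exact Hg.
    - intros t Ht. eapply Rle_trans; [apply Cmod_ge_0|]. apply Hb. lra. }
  pose proof (Cmod_ge_0 l).
  assert (K : is_RInt (fun t => Re (Cconj l * f t)%C) a b (Re (Cconj l * l)%C)).
  { apply (is_Cint_cmult (Cconj l)) in Hl. apply Hl. }
  assert (K2 : Re (Cconj l * l)%C <= Cmod l * M).
  { apply (is_RInt_le _ (fun t => Cmod l * g t) a b _ _ Hab K).
    - apply (is_RInt_scal _ _ _ (Cmod l) _ Hg).
    - intros t Ht. eapply Rle_trans; [apply Rle_abs|].
      eapply Rle_trans; [apply re_le_Cmod|]. rewrite Cmod_mult, Cmod_conj.
      apply Rmult_le_compat_l; [assumption|apply Hb; lra]. }
  assert (K3 : Re (Cconj l * l)%C = Cmod l * Cmod l).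
  { pose proof (Cmod2_alt l). destruct l; simpl in *. nra. }
  rewrite K3 in K2. apply Rmult_le_reg_l with (Cmod l); lra.
Qed.

Lemma is_Cint_bound f a b l M :
  a <= b -> (forall t, a <= t <= b -> Cmod (f t) <= M) ->
  is_Cint f a b l -> Cmod l <= (b - a) * M.
Proof.
  intros Hab Hb Hl. apply (is_Cint_bound_fun f (fun _ => M) a b l); auto.
  apply (is_RInt_const a b M).
Qed.

(** * Goursat's theorem for rectangles *)

(** The contour integral of [G dz] counterclockwise around the rectangle, with [b], [t], [r], [s]
    the bottom, top, right and left sides; the factor [Ci] is [dz / dv] on vertical sides. *)
Definition is_boundary_int (G : C -> C) (x x' y y' : R) (l : C) : Prop :=
  exists b t r s,
    is_Cint (fun u => G (u, y)) x x' b /\ is_Cint (fun u => G (u, y')) x x' t /\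
    is_Cint (fun v => G (x', v)) y y' r /\ is_Cint (fun v => G (x, v)) y y' s /\
    l = (b - t + Ci * (r - s))%C.

Lemma is_boundary_int_unique G x x' y y' l m :
  is_boundary_int G x x' y y' l -> is_boundary_int G x x' y y' m -> l = m.
Proof.
  intros (b & t & r & s & A & B & D & E & ->) (b' & t' & r' & s' & A' & B' & D' & E' & ->).
  rewrite (is_Cint_unique _ _ _ _ _ A A'), (is_Cint_unique _ _ _ _ _ B B'),
   (is_Cint_unique _ _ _ _ _ D D'), (is_Cint_unique _ _ _ _ _ E E'). reflexivity.
Qed.

Lemma Ctends_horizontal (G : C -> C) x y : Ccont G (x, y) -> Ctends (locally x) (fun u => G (u, y)) (G (x, y)).
Proof.
  intros H. apply (Ctends_comp (locally x) G (fun u => (u, y))); [|exact H].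
  intros e He. exists (mkposreal e He). intros u Hu.
  replace ((u, y) - (x, y))%C with (RtoC (u - x)) by (unfold Cminus, Cplus, Copp, RtoC; simpl; f_equal; ring).
  rewrite Cmod_R. exact Hu.
Qed.

Lemma Ctends_vertical (G : C -> C) x y : Ccont G (x, y) -> Ctends (locally y) (fun v => G (x, v)) (G (x, y)).
Proof.
  intros H. apply (Ctends_comp (locally y) G (fun v => (x, v))); [|exact H].
  intros e He. exists (mkposreal e He). intros v Hv.
  replace ((x, v) - (x, y))%C with (Ci * RtoC (v - y))%C
    by (unfold Cminus, Cplus, Cmult, Ci, Copp, RtoC; simpl; f_equal; ring).
  rewrite Cmod_mult, Cmod_Ci, Rmult_1_l, Cmod_R. exact Hv.
Qed.

Lemma boundary_int_cont G x x' y y' :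
  x <= x' -> y <= y' ->
  (forall u v, x <= u <= x' -> y <= v <= y' -> Ccont G (u, v)) ->
  exists l, is_boundary_int G x x' y y' l.
Proof.
  intros Hx Hy H.
  assert (E : Rmin x x' = x) by (apply Rmin_left; lra).
  assert (E' : Rmax x x' = x') by (apply Rmax_right; lra).
  assert (F : Rmin y y' = y) by (apply Rmin_left; lra).
  assert (F' : Rmax y y' = y') by (apply Rmax_right; lra).
  destruct (is_Cint_cont (fun u => G (u, y)) x x') as [b Hb].
  { intros t Ht. apply Ctends_horizontal, H; lra. }
  destruct (is_Cint_cont (fun u => G (u, y')) x x') as [t Ht].
  { intros u Hu. apply Ctends_horizontal, H; lra. }
  destruct (is_Cint_cont (fun v => G (x', v)) y y') as [r Hr].
  { intros u Hu. apply Ctends_vertical, H; lra. }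
  destruct (is_Cint_cont (fun v => G (x, v)) y y') as [s Hs].
  { intros u Hu. apply Ctends_vertical, H; lra. }
  exists (b - t + Ci * (r - s))%C. exists b, t, r, s. auto.
Qed.

Lemma is_boundary_int_bound G x x' y y' l M :
  x <= x' -> y <= y' ->
  (forall u v, x <= u <= x' -> y <= v <= y' -> Cmod (G (u, v)) <= M) ->
  is_boundary_int G x x' y y' l -> Cmod l <= 2 * ((x' - x) + (y' - y)) * M.
Proof.
  intros Hx Hy HM (b & t & r & s & A & B & D & E & ->).
  apply is_Cint_bound with (M := M) in A; [|lra|intros; apply HM; lra].
  apply is_Cint_bound with (M := M) in B; [|lra|intros; apply HM; lra].
  apply is_Cint_bound with (M := M) in D; [|lra|intros; apply HM; lra].
  apply is_Cint_bound with (M := M) in E; [|lra|intros; apply HM; lra].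
  eapply Rle_trans; [apply Cmod_triangle|]. rewrite Cmod_mult, Cmod_Ci.
  pose proof (Cmod_triangle_sub b t). pose proof (Cmod_triangle_sub r s). lra.
Qed.

Lemma is_Cint_affine (A B : C) a b :
  is_Cint (fun u => A + B * RtoC u)%C a b
    (RtoC (b - a) * A + B * RtoC ((b ^ 2 - a ^ 2) / 2))%C.
Proof.
  apply is_Cint_plus; [apply is_Cint_const|]. apply is_Cint_cmult, is_Cint_id.
Qed.

Lemma C_pair (u v : R) : ((u, v) : C) = (RtoC u + Ci * RtoC v)%C.
Proof. unfold RtoC, Ci, Cplus, Cmult; simpl. f_equal; ring. Qed.

(** In Goursat's argument the affine part of [G] at a point is subtracted at no cost, which leaves
    only the remainder of its differentiability there. *)
Lemma is_boundary_int_affine (A B : C) x x' y y' :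
  is_boundary_int (fun w => A + B * w)%C x x' y y' 0.
Proof.
  exists (RtoC (x' - x) * (A + B * Ci * RtoC y) + B * RtoC ((x' ^ 2 - x ^ 2) / 2))%C,
    (RtoC (x' - x) * (A + B * Ci * RtoC y') + B * RtoC ((x' ^ 2 - x ^ 2) / 2))%C,
    (RtoC (y' - y) * (A + B * RtoC x') + B * Ci * RtoC ((y' ^ 2 - y ^ 2) / 2))%C,
    (RtoC (y' - y) * (A + B * RtoC x) + B * Ci * RtoC ((y' ^ 2 - y ^ 2) / 2))%C.
  assert (K : forall (H : R -> C) A' B' a b, (forall u, H u = A' + B' * RtoC u)%C ->
    is_Cint H a b (RtoC (b - a) * A' + B' * RtoC ((b ^ 2 - a ^ 2) / 2))%C).
  { intros H A' B' a b E. eapply is_Cint_ext; [|apply is_Cint_affine]. intros u _. symmetry. apply E. }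
  split; [apply K; intros u; rewrite C_pair; ring|].
  split; [apply K; intros u; rewrite C_pair; ring|].
  split; [apply K; intros u; rewrite C_pair; ring|].
  split; [apply K; intros u; rewrite C_pair; ring|].
  rewrite !RtoC_minus. ring.
Qed.

Lemma is_boundary_int_minus G H x x' y y' l m :
  is_boundary_int G x x' y y' l -> is_boundary_int H x x' y y' m ->
  is_boundary_int (fun w => G w - H w)%C x x' y y' (l - m)%C.
Proof.
  intros (b & t & r & s & A & B & D & E & ->) (b' & t' & r' & s' & A' & B' & D' & E' & ->).
  exists (b - b')%C, (t - t')%C, (r - r')%C, (s - s')%C.
  split; [exact (is_Cint_minus _ _ _ _ _ _ A A')|].
  split; [exact (is_Cint_minus _ _ _ _ _ _ B B')|].
  split; [exact (is_Cint_minus _ _ _ _ _ _ D D')|].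
  split; [exact (is_Cint_minus _ _ _ _ _ _ E E')|]. ring.
Qed.

Lemma is_boundary_int_hsplit G x x' x'' y y' l m :
  is_boundary_int G x x' y y' l -> is_boundary_int G x' x'' y y' m ->
  is_boundary_int G x x'' y y' (l + m)%C.
Proof.
  intros (b & t & r & s & A & B & D & E & ->) (b' & t' & r' & s' & A' & B' & D' & E' & ->).
  rewrite (is_Cint_unique _ _ _ _ _ D E').
  exists (b + b')%C, (t + t')%C, r', s.
  split; [exact (is_Cint_Chasles _ _ _ _ _ _ A A')|].
  split; [exact (is_Cint_Chasles _ _ _ _ _ _ B B')|].
  split; [exact D'|]. split; [exact E|]. ring.
Qed.

Lemma is_boundary_int_vsplit G x x' y y' y'' l m :
  is_boundary_int G x x' y y' l -> is_boundary_int G x x' y' y'' m ->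
  is_boundary_int G x x' y y'' (l + m)%C.
Proof.
  intros (b & t & r & s & A & B & D & E & ->) (b' & t' & r' & s' & A' & B' & D' & E' & ->).
  rewrite (is_Cint_unique _ _ _ _ _ B A').
  exists b, t', (r + r')%C, (s + s')%C.
  split; [exact A|]. split; [exact B'|].
  split; [exact (is_Cint_Chasles _ _ _ _ _ _ D D')|].
  split; [exact (is_Cint_Chasles _ _ _ _ _ _ E E')|]. ring.
Qed.

Lemma Cmod_pair_le (u v : R) : Cmod (u, v) <= Rabs u + Rabs v.
Proof.
  rewrite C_pair. eapply Rle_trans; [apply Cmod_triangle|].
  rewrite Cmod_mult, Cmod_Ci, !Cmod_R. lra.
Qed.

Lemma Cmod_le_eps (l : C) : (forall e, 0 < e -> Cmod l <= e) -> l = 0.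
Proof.
  intros H. apply Cmod_eq_0. pose proof (Cmod_ge_0 l).
  destruct (Req_dec (Cmod l) 0) as [E|E]; [exact E|].
  specialize (H (Cmod l / 2) ltac:(lra)). lra.
Qed.

(** The bound [e * w ^ 2] on the integral is proportional to the area, so it passes from the four
    quarters to the whole rectangle. On small rectangles around a point it follows from
    differentiability there, after subtraction of the affine part. Bisection gives it for the full
    rectangle, and [e] is arbitrary. *)
Lemma goursat (G : C -> C) x0 x1 y0 y1 :
  x0 < x1 -> y0 < y1 ->
  (forall u v, x0 <= u <= x1 -> y0 <= v <= y1 -> exists l, Cderiv G (u, v) l) ->
  is_boundary_int G x0 x1 y0 y1 0.
Proof.
  intros Hx Hy HG.
  assert (HC : forall u v, x0 <= u <= x1 -> y0 <= v <= y1 -> Ccont G (u, v)).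
  { intros u v Hu Hv. destruct (HG u v Hu Hv) as [l Hl]. exact (Cderiv_cont _ _ _ Hl). }
  destruct (boundary_int_cont G x0 x1 y0 y1) as [l Hl]; [lra|lra|exact HC|].
  enough (E : l = 0) by (rewrite <- E; exact Hl).
  apply Cmod_le_eps. intros e He.
  set (al := x1 - x0). set (be := y1 - y0).
  assert (Hal : 0 < al) by (unfold al; lra). assert (Hbe : 0 < be) by (unfold be; lra).
  pose (P := fun x y w => x0 <= x -> x + w * al <= x1 -> y0 <= y -> y + w * be <= y1 ->
     forall l, is_boundary_int G x (x + w * al) y (y + w * be) l -> Cmod l <= e * w ^ 2).
  assert (HP : P x0 y0 1).
  2:{ replace e with (e * 1 ^ 2) by ring. apply HP; unfold al, be; try lra.
      replace (x0 + 1 * (x1 - x0)) with x1 by ring.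
      replace (y0 + 1 * (y1 - y0)) with y1 by ring. exact Hl. }
  apply (rectangle_bisection al be Hal Hbe P); [lra| |].
  - intros x y w Hw P1 P2 P3 P4 X0 X1 Y0 Y1 m Hm.
    assert (Wa : 0 < w * al) by (apply Rmult_lt_0_compat; lra).
    assert (Wb : 0 < w * be) by (apply Rmult_lt_0_compat; lra).
    assert (Q : forall x' y', x <= x' -> x' + w / 2 * al <= x + w * al ->
       y <= y' -> y' + w / 2 * be <= y + w * be ->
       exists k, is_boundary_int G x' (x' + w / 2 * al) y' (y' + w / 2 * be) k).
    { intros x' y' A1 A2 A3 A4. apply boundary_int_cont; try lra.
      intros u v Hu Hv. apply HC; lra. }
    destruct (Q x y) as [k1 K1]; try lra.
    destruct (Q (x + w / 2 * al) y) as [k2 K2]; try lra.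
    destruct (Q x (y + w / 2 * be)) as [k3 K3]; try lra.
    destruct (Q (x + w / 2 * al) (y + w / 2 * be)) as [k4 K4]; try lra.
    pose proof (P1 ltac:(lra) ltac:(lra) ltac:(lra) ltac:(lra) _ K1) as B1.
    pose proof (P2 ltac:(lra) ltac:(lra) ltac:(lra) ltac:(lra) _ K2) as B2.
    pose proof (P3 ltac:(lra) ltac:(lra) ltac:(lra) ltac:(lra) _ K3) as B3.
    pose proof (P4 ltac:(lra) ltac:(lra) ltac:(lra) ltac:(lra) _ K4) as B4.
    pose proof (is_boundary_int_vsplit _ _ _ _ _ _ _ _
      (is_boundary_int_hsplit _ _ _ _ _ _ _ _ K1 K2)
      (is_boundary_int_hsplit _ _ _ _ _ _ _ _ K3 K4)) as K.
    replace (x + w / 2 * al + w / 2 * al) with (x + w * al) in K by field.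
    replace (y + w / 2 * be + w / 2 * be) with (y + w * be) in K by field.
    rewrite (is_boundary_int_unique _ _ _ _ _ _ _ Hm K).
    eapply Rle_trans; [apply Cmod_triangle|].
    pose proof (Cmod_triangle k1 k2). pose proof (Cmod_triangle k3 k4).
    replace ((w / 2) ^ 2) with (w ^ 2 / 4) in * by field. lra.
  - intros p q Hp Hq.
    destruct (HG p q) as [d Hd]; [unfold al in Hp; lra|unfold be in Hq; lra|].
    (* The remainder is at most [e' * (w * (al + be))] on the rectangle and the perimeter is
       [2 * (w * (al + be))]; the product is [e * w ^ 2]. *)
    set (e' := e / (2 * (al + be) ^ 2)).
    assert (S2 : 0 < (al + be) ^ 2) by (apply pow_lt; lra).
    assert (He' : 0 < e') by (unfold e'; apply Rdiv_lt_0_compat; lra).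
    destruct (proj1 (locally_Cmod _ _) (Hd e' He')) as [r [Hr K]].
    exists (r / (al + be)). split; [apply Rdiv_lt_0_compat; lra|].
    intros x y w Hw Hxp Hyq X0 X1 Y0 Y1 m Hm.
    assert (Wr : w * (al + be) < r) by (apply Rlt_div_r; lra).
    pose proof (is_boundary_int_affine (G (p, q) - d * (p, q))%C d x (x + w * al) y (y + w * be)) as A.
    pose proof (is_boundary_int_minus _ _ _ _ _ _ _ _ Hm A) as B.
    replace (m - 0)%C with m in B by ring.
    assert (Wa : 0 < w * al) by (apply Rmult_lt_0_compat; lra).
    assert (Wb : 0 < w * be) by (apply Rmult_lt_0_compat; lra).
    apply is_boundary_int_bound with (M := e' * (w * (al + be))) in B; [|lra|lra|].
    + eapply Rle_trans; [exact B|]. right. unfold e'. field. lra.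
    + intros u v Hu Hv.
      assert (D : Cmod ((u, v) - (p, q)) <= w * (al + be)).
      { change ((u, v) - (p, q))%C with ((u - p, v - q) : C).
        eapply Rle_trans; [apply Cmod_pair_le|].
        assert (Rabs (u - p) <= w * al) by (apply Rabs_le; lra).
        assert (Rabs (v - q) <= w * be) by (apply Rabs_le; lra). lra. }
      replace (G (u, v) - (G (p, q) - d * (p, q) + d * (u, v)))%C
        with (G (u, v) - G (p, q) - d * ((u, v) - (p, q)))%C by ring.
      eapply Rle_trans; [apply K; lra|]. apply Rmult_le_compat_l; lra.
Qed.

(** * The mean value property and Cauchy's formula *)

Definition Cexp (w : C) : C := (exp (Re w) * cos (Im w), exp (Re w) * sin (Im w)).

Definition circ (r t : R) : C := (r * cos t, r * sin t).

Lemma is_derive_small (f : R -> R) (x l : R) :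
  is_derive f x l -> forall e, 0 < e ->
  exists d, 0 < d /\ forall h, Rabs h < d -> Rabs (f (x + h) - f x - l * h) <= e * Rabs h.
Proof.
  intros [_ H] e He. specialize (H x (fun P HP => HP) (mkposreal e He)).
  destruct H as [d Hd]. exists d. split; [apply cond_pos|].
  intros h Hh. specialize (Hd (x + h)).
  assert (B : ball x d (x + h)).
  { unfold ball; simpl. unfold AbsRing_ball, abs, minus, plus, opp; simpl.
    replace (x + h + - x) with h by ring. exact Hh. }
  specialize (Hd B). unfold norm, minus, plus, opp, scal in Hd; simpl in Hd.
  unfold mult, abs in Hd; simpl in Hd.
  replace (x + h + - x) with h in Hd by ring.
  replace (f (x + h) - f x - l * h) with (f (x + h) + - f x + - (h * l)) by ring. exact Hd.
Qed.

Lemma exp_sub_one_small (h : R) : Rabs h <= 1/2 -> Rabs (exp h - 1) <= 2 * Rabs h.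
Proof.
  intros H. assert (-(1/2) <= h <= 1/2) by (apply Rabs_le_between; exact H).
  pose proof (exp_ineq1_le h). pose proof (exp_ineq1_le (- h)).
  assert (E : exp h * exp (- h) = 1) by (rewrite <- exp_plus, Rplus_opp_r; apply exp_0).
  pose proof (exp_pos h).
  assert (exp h * (1 - h) <= 1) by (rewrite <- E; apply Rmult_le_compat_l; lra).
  destruct (Rle_dec 0 h).
  - rewrite (Rabs_right h) by lra. rewrite Rabs_right by lra. nra.
  - rewrite (Rabs_left h) by lra. apply Rabs_le. nra.
Qed.

Lemma Cderiv_Cexp_0 : Cderiv Cexp 0 1.
Proof.
  intros e He. set (k := Rmin (e / 16) (1/8)).
  assert (Hk : 0 < k) by (unfold k; apply Rmin_pos; lra).
  assert (Hk1 : k <= e / 16) by apply Rmin_l. assert (Hk2 : k <= 1/8) by apply Rmin_r.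
  clearbody k.
  destruct (is_derive_small exp 0 (exp 0) (is_derive_exp 0) k Hk) as [d1 [P1 D1]].
  destruct (is_derive_small cos 0 (- sin 0) (is_derive_cos 0) k Hk) as [d2 [P2 D2]].
  destruct (is_derive_small sin 0 (cos 0) (is_derive_sin 0) k Hk) as [d3 [P3 D3]].
  rewrite exp_0 in D1. rewrite sin_0, cos_0 in D2. rewrite sin_0, cos_0 in D3.
  apply locally_Cmod. exists (Rmin k (Rmin d1 (Rmin d2 d3))).
  split; [repeat apply Rmin_pos; auto|].
  intros [s t] Hw. replace ((s, t) - 0)%C with ((s, t) : C) in *
    by (unfold Cminus, Cplus, Copp, RtoC; simpl; f_equal; ring).
  assert (Hs : Rabs s <= Cmod (s, t)) by (apply (re_le_Cmod (s, t))).
  assert (Ht : Rabs t <= Cmod (s, t)) by (apply (Cmod_Im_le (s, t))).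
  pose proof (Rmin_l k (Rmin d1 (Rmin d2 d3))).
  pose proof (Rmin_r k (Rmin d1 (Rmin d2 d3))).
  pose proof (Rmin_l d1 (Rmin d2 d3)). pose proof (Rmin_r d1 (Rmin d2 d3)).
  pose proof (Rmin_l d2 d3). pose proof (Rmin_r d2 d3).
  specialize (D1 s ltac:(lra)). specialize (D2 t ltac:(lra)). specialize (D3 t ltac:(lra)).
  rewrite Rplus_0_l in D1, D2, D3.
  pose proof (exp_sub_one_small s ltac:(lra)) as X.
  replace (Cexp (s, t) - Cexp 0 - 1 * (s, t))%C
    with ((exp s * cos t - 1 - s, exp s * sin t - t) : C).
  2:{ unfold Cexp; simpl. rewrite exp_0, cos_0, sin_0.
      unfold Cminus, Cplus, Copp, Cmult; simpl. f_equal; ring. }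
  eapply Rle_trans; [apply Cmod_pair_le|].
  set (m := Cmod (s, t)) in *.
  assert (Hm : 0 <= m) by apply Cmod_ge_0.
  assert (A1 : Rabs (exp s * cos t - 1 - s) <= 3 * k * m).
  { replace (exp s * cos t - 1 - s)
      with ((exp s - 1 - 1 * s) * cos t + (1 + s) * (cos t - 1 - - 0 * t)) by ring.
    eapply Rle_trans; [apply Rabs_triang|]. rewrite !Rabs_mult.
    assert (Rabs (cos t) <= 1) by (apply Rabs_le, COS_bound).
    assert (Rabs (1 + s) <= 2).
    { eapply Rle_trans; [apply Rabs_triang|]. rewrite Rabs_R1. lra. }
    assert (Rabs (exp s - 1 - 1 * s) * Rabs (cos t) <= (k * m) * 1).
    { apply Rmult_le_compat; try apply Rabs_pos; auto. eapply Rle_trans; [exact D1|].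
      apply Rmult_le_compat_l; lra. }
    assert (Rabs (1 + s) * Rabs (cos t - 1 - - 0 * t) <= 2 * (k * m)).
    { apply Rmult_le_compat; try apply Rabs_pos; auto. eapply Rle_trans; [exact D2|].
      apply Rmult_le_compat_l; lra. }
    lra. }
  assert (A2 : Rabs (exp s * sin t - t) <= 4 * k * m).
  { replace (exp s * sin t - t)
      with (exp s * (sin t - 0 - 1 * t) + (exp s - 1) * t) by ring.
    eapply Rle_trans; [apply Rabs_triang|]. rewrite !Rabs_mult.
    assert (Rabs (exp s) <= 2).
    { replace (exp s) with (1 + (exp s - 1)) by ring.
      eapply Rle_trans; [apply Rabs_triang|]. rewrite Rabs_R1. lra. }
    assert (Rabs (exp s) * Rabs (sin t - 0 - 1 * t) <= 2 * (k * m)).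
    { apply Rmult_le_compat; try apply Rabs_pos; auto. eapply Rle_trans; [exact D3|].
      apply Rmult_le_compat_l; lra. }
    assert (Rabs (exp s - 1) * Rabs t <= (2 * k) * m).
    { apply Rmult_le_compat; try apply Rabs_pos; auto. eapply Rle_trans; [exact X|]. lra. }
    lra. }
  nra.
Qed.

Lemma Cexp_plus (z w : C) : Cexp (z + w) = (Cexp z * Cexp w)%C.
Proof.
  destruct z as [a b], w as [s t]. unfold Cexp, Cplus, Cmult; simpl.
  rewrite exp_plus, cos_plus, sin_plus. f_equal; ring.
Qed.

Lemma Cderiv_Cexp z : Cderiv Cexp z (Cexp z).
Proof.
  apply Cderiv_ext_loc with (fun w => Cexp z * Cexp (w - z))%C.
  - apply filter_forall. intros w. rewrite <- Cexp_plus. f_equal. ring.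
  - apply (Cderiv_eq _ _ (0 * Cexp (z - z) + Cexp z * (1 * (1 - 0)))%C); [ring|].
    apply (Cderiv_mult (fun _ => Cexp z) (fun w => Cexp (w - z))); [apply Cderiv_const|].
    apply (Cderiv_comp Cexp (fun w => w - z)%C).
    + apply (Cderiv_minus (fun w => w) (fun _ => z)); [apply Cderiv_id|apply Cderiv_const].
    + replace (z - z)%C with (RtoC 0) by ring. apply Cderiv_Cexp_0.
Qed.

Lemma Cexp_circ s t : Cexp (s, t) = circ (exp s) t.
Proof. reflexivity. Qed.

Lemma Cmod_circ r t : 0 <= r -> Cmod (circ r t) = r.
Proof.
  intros H. unfold Cmod, circ; simpl.
  replace (r * cos t * (r * cos t * 1) + r * sin t * (r * sin t * 1)) with (r * r * (Rsqr (sin t) + Rsqr (cos t)))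
    by (unfold Rsqr; ring).
  rewrite sin2_cos2, Rmult_1_r. apply sqrt_square, H.
Qed.

(** The exponential maps the rectangle [[ln r1, ln r2] * [0, 2 PI]] onto the annulus. Goursat's
    theorem for [f (Cexp w)] has equal bottom and top sides by periodicity, and its left and right
    sides are the two circle integrals. *)
Lemma circle_integral_const (f : C -> C) (r1 r2 : R) (l : C) :
  0 < r1 < r2 -> (forall z, r1 <= Cmod z <= r2 -> exists d, Cderiv f z d) ->
  is_Cint (fun t => f (circ r1 t)) 0 (2 * PI) l -> is_Cint (fun t => f (circ r2 t)) 0 (2 * PI) l.
Proof.
  intros Hr Hf Hl. pose proof PI_RGT_0.
  assert (L1 : exp (ln r1) = r1) by (apply exp_ln; lra).
  assert (L2 : exp (ln r2) = r2) by (apply exp_ln; lra).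
  destruct (goursat (fun w => f (Cexp w)) (ln r1) (ln r2) 0 (2 * PI)) as (b & t & r & s & A & B & D & E & Q).
  - apply ln_increasing; lra.
  - lra.
  - intros u v Hu Hv. destruct (Hf (Cexp (u, v))) as [d Hd].
    + rewrite Cexp_circ, Cmod_circ by (left; apply exp_pos).
      rewrite <- L1, <- L2. split; destruct Hu as [[U1|U1] [U2|U2]];
      try (left; apply exp_increasing; assumption); try (right; congruence).
    + eexists. apply (Cderiv_comp f Cexp); [apply Cderiv_Cexp|exact Hd].
  - assert (b = t).
    { apply (is_Cint_unique _ _ _ _ _ A). eapply is_Cint_ext; [|exact B].
      intros u _. cbv beta. f_equal. unfold Cexp; simpl.
      rewrite cos_2PI, sin_2PI, cos_0, sin_0. reflexivity. }
    assert (E1 : s = l).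
    { apply (is_Cint_unique _ _ _ _ _ E). eapply is_Cint_ext; [|exact Hl].
      intros u _. cbv beta. rewrite Cexp_circ, L1. reflexivity. }
    assert (E2 : r = l).
    { assert (Ci <> 0) by (intros K; injection K; lra).
      rewrite H0 in Q. replace r with ((Ci * (r - s)) / Ci + s)%C by (field; auto).
      replace (Ci * (r - s))%C with (t - t + Ci * (r - s))%C by ring. rewrite <- Q, E1. field. auto. }
    rewrite E2 in D. eapply is_Cint_ext; [|exact D].
    intros u _. cbv beta. rewrite Cexp_circ, L2. reflexivity.
Qed.

Lemma Ctends_pair {T} (Fl : (T -> Prop) -> Prop) {FF : Filter Fl} (u v : T -> R) a b :
  filterlim u Fl (locally a) -> filterlim v Fl (locally b) ->
  Ctends Fl (fun t => (u t, v t)) (a, b).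
Proof.
  intros Hu Hv e He.
  assert (He2 : 0 < e / 2) by lra.
  pose proof (Hu _ (locally_ball a (mkposreal _ He2))) as A.
  pose proof (Hv _ (locally_ball b (mkposreal _ He2))) as B.
  unfold filtermap in A, B. generalize (filter_and _ _ A B). apply filter_imp.
  intros x [X Y].
  change ((u x, v x) - (a, b))%C with ((u x - a, v x - b) : C).
  eapply Rle_lt_trans; [apply Cmod_pair_le|].
  change (Rabs (u x - a) < e / 2) in X. change (Rabs (v x - b) < e / 2) in Y. lra.
Qed.

Lemma Ctends_circ r t : Ctends (locally t) (circ r) (circ r t).
Proof.
  apply Ctends_pair; [apply locally_filter| |].
  - apply (continuous_mult (fun _ => r) cos); [apply continuous_const|apply continuous_cos].
  - apply (continuous_mult (fun _ => r) sin); [apply continuous_const|apply continuous_sin].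
Qed.

Lemma Ctends_circ2 r t : Ctends (locally (t, r)) (fun p : R * R => circ (snd p) (fst p)) (circ r t).
Proof.
  apply Ctends_pair; [apply locally_filter| |].
  - apply (continuous_mult (fun p : R * R => snd p) (fun p : R * R => cos (fst p)) (t, r)).
    + apply continuous_snd.
    + apply (continuous_comp fst cos); [apply continuous_fst|apply continuous_cos].
  - apply (continuous_mult (fun p : R * R => snd p) (fun p : R * R => sin (fst p)) (t, r)).
    + apply continuous_snd.
    + apply (continuous_comp fst sin); [apply continuous_fst|apply continuous_sin].
Qed.

Lemma circle_uniform_cont (f : C -> C) (r0 : R) :
  0 <= r0 -> (forall z, Cmod z = r0 -> Ccont f z) ->
  forall e, 0 < e -> exists d, 0 < d /\ forall r t, Rabs (r - r0) < d -> 0 <= t <= 2 * PI ->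
    Cmod (f (circ r t) - f (circ r0 t)) <= e.
Proof.
  intros Hr Hf e He.
  assert (CF : forall t, Ctends (locally (t, r0)) (fun p : R * R => f (circ (snd p) (fst p))) (f (circ r0 t))).
  { intros t. apply (Ctends_comp _ f (fun p : R * R => circ (snd p) (fst p))).
    - apply Ctends_circ2.
    - apply Hf, Cmod_circ, Hr. }
  assert (He2 : 0 < e / 2) by lra.
  destruct (uniform_continuity_2d_1d (fun t r => Re (f (circ r t))) 0 (2 * PI) r0) with (eps := mkposreal _ He2) as [d1 D1].
  { intros t _. apply continuity_2d_pt_filterlim.
    apply (Ctends_Re _ _ _ (CF t)). }
  destruct (uniform_continuity_2d_1d (fun t r => Im (f (circ r t))) 0 (2 * PI) r0) with (eps := mkposreal _ He2) as [d2 D2].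
  { intros t _. apply continuity_2d_pt_filterlim.
    apply (Ctends_Im _ _ _ (CF t)). }
  exists (Rmin d1 d2). split; [apply Rmin_pos; apply cond_pos|].
  intros r t Hrr Ht. pose proof (Rmin_l d1 d2). pose proof (Rmin_r d1 d2).
  apply Rabs_lt_between in Hrr.
  assert (Z : Rabs (t - t) = 0) by (rewrite Rminus_diag, Rabs_R0; reflexivity).
  pose proof (cond_pos d1). pose proof (cond_pos d2).
  specialize (D1 t r0 t r ltac:(lra) ltac:(lra) ltac:(lra) ltac:(lra) ltac:(lra)).
  specialize (D2 t r0 t r ltac:(lra) ltac:(lra) ltac:(lra) ltac:(lra) ltac:(lra)).
  simpl in D1, D2.
  change (f (circ r t) - f (circ r0 t))%C with
    ((Re (f (circ r t)) - Re (f (circ r0 t)), Im (f (circ r t)) - Im (f (circ r0 t))) : C).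
  eapply Rle_trans; [apply Cmod_pair_le|]. lra.
Qed.

Definition Cint (f : R -> C) (a b : R) : C :=
  (RInt (fun t => Re (f t)) a b, RInt (fun t => Im (f t)) a b).

Lemma Cint_correct f a b l : is_Cint f a b l -> Cint f a b = l.
Proof.
  intros [A B]. apply C_ext; [apply is_RInt_unique, A|apply is_RInt_unique, B].
Qed.

Lemma is_Cint_Cint f a b l : is_Cint f a b l -> is_Cint f a b (Cint f a b).
Proof. intros H. rewrite (Cint_correct _ _ _ _ H). exact H. Qed.

Lemma Ctends_on_circle (f : C -> C) r t : 0 <= r -> (forall z, Cmod z = r -> Ccont f z) ->
  Ctends (locally t) (fun t => f (circ r t)) (f (circ r t)).
Proof.
  intros Hr Hf. apply (Ctends_comp _ f (circ r)); [apply Ctends_circ|].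
  apply Hf, Cmod_circ, Hr.
Qed.

Lemma is_Cint_circle (f : C -> C) r : 0 <= r -> (forall z, Cmod z = r -> Ccont f z) ->
  is_Cint (fun t => f (circ r t)) 0 (2 * PI) (Cint (fun t => f (circ r t)) 0 (2 * PI)).
Proof.
  intros Hr Hf.
  destruct (is_Cint_cont (fun t => f (circ r t)) 0 (2 * PI)) as [l Hl].
  { intros t _. apply (Ctends_on_circle f r t Hr Hf). }
  apply is_Cint_Cint in Hl. exact Hl.
Qed.

(* The exceptional point is harmless because the circle integral is a continuous
   function of the radius, and is constant on each side of the radius [Cmod a]. *)
Lemma mean_value_except (f : C -> C) (a : C) (r : R) :
  (forall z, unit_disk z -> Ccont f z) ->
  (forall z, unit_disk z -> z <> a -> exists l, Cderiv f z l) ->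
  0 < r < 1 -> is_Cint (fun t => f (circ r t)) 0 (2 * PI) (RtoC (2 * PI) * f 0)%C.
Proof.
  intros HC HD Hr.
  pose (I := fun r => Cint (fun t => f (circ r t)) 0 (2 * PI)).
  assert (HI : forall r, 0 <= r < 1 -> is_Cint (fun t => f (circ r t)) 0 (2 * PI) (I r)).
  { intros s Hs. apply is_Cint_circle; [lra|]. intros z Hz. apply HC. unfold unit_disk; lra. }
  assert (I0 : I 0 = (RtoC (2 * PI) * f 0)%C).
  { apply (is_Cint_unique (fun t => f (circ 0 t)) 0 (2 * PI)); [apply HI; lra|].
    replace (2 * PI) with (2 * PI - 0) at 2 by ring.
    eapply is_Cint_ext; [|apply is_Cint_const]. intros t _. cbv beta. f_equal.
    unfold circ. apply C_ext; simpl; ring. }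
  rewrite <- I0.
  enough (K : I r = I 0) by (rewrite <- K; apply HI; lra).
  assert (Iconst : forall r1 r2, 0 < r1 < r2 -> r2 < 1 -> (Cmod a < r1 \/ r2 < Cmod a) -> I r1 = I r2).
  { intros r1 r2 H1 H2 H3. symmetry. apply Cint_correct.
    apply circle_integral_const with r1; [exact H1| |apply HI; lra].
    intros z Hz. apply HD; [unfold unit_disk; lra|]. intros ->. lra. }
  pose proof PI_RGT_0 as HPI.
  assert (Icont : forall s, 0 <= s < 1 -> forall e, 0 < e ->
     exists d, 0 < d /\ forall r, 0 <= r < 1 -> Rabs (r - s) < d -> Cmod (I r - I s) <= e).
  { intros s Hs e He.
    assert (He2 : 0 < e / (2 * PI)) by (apply Rdiv_lt_0_compat; lra).
    destruct (circle_uniform_cont f s ltac:(lra) (fun z Hz => HC z ltac:(unfold unit_disk; lra)) _ He2)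
      as [d [Hd K]].
    exists d. split; [exact Hd|]. intros r' Hr' Hrs.
    pose proof (is_Cint_minus _ _ _ _ _ _ (HI r' Hr') (HI s Hs)) as M.
    apply is_Cint_bound with (M := e / (2 * PI)) in M; [|lra|intros t Ht; apply K; assumption].
    replace ((2 * PI - 0) * (e / (2 * PI))) with e in M by (field; lra). exact M. }
  assert (Ilim : forall s r1, 0 <= s < 1 -> 0 <= r1 < 1 ->
     (forall d, 0 < d -> exists r', 0 <= r' < 1 /\ Rabs (r' - s) < d /\ I r' = I r1) -> I r1 = I s).
  { intros s r1 Hs Hr1 H. apply Csub_eq0, Cmod_le_eps. intros e He.
    destruct (Icont s Hs e He) as [d [Hd K]]. destruct (H d Hd) as [r' [A [B D]]].
    rewrite <- D. apply K; assumption. }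
  pose proof (Cmod_ge_0 a) as Ha.
  assert (C1 : forall r1, 0 < r1 < 1 -> (Cmod a = 0 \/ r1 < Cmod a) -> I r1 = I 0).
  { intros r1 H1 H2. apply Ilim; [lra|lra|]. intros d Hd.
    exists (Rmin (r1 / 2) (d / 2)).
    assert (0 < Rmin (r1 / 2) (d / 2)) by (apply Rmin_pos; lra).
    pose proof (Rmin_l (r1 / 2) (d / 2)). pose proof (Rmin_r (r1 / 2) (d / 2)).
    split; [lra|]. split; [rewrite Rabs_right; lra|].
    apply Iconst; lra. }
  destruct (Req_dec (Cmod a) 0) as [Z|Z]; [apply C1; auto|].
  destruct (Rlt_dec r (Cmod a)) as [L|L]; [apply C1; auto|].
  assert (C2 : I (Cmod a) = I 0).
  { transitivity (I (Cmod a / 2)).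
    - symmetry. apply Ilim; [lra|lra|]. intros d Hd.
      exists (Rmax (Cmod a / 2) (Cmod a - d / 2)).
      pose proof (Rmax_l (Cmod a / 2) (Cmod a - d / 2)).
      pose proof (Rmax_r (Cmod a / 2) (Cmod a - d / 2)).
      assert (Rmax (Cmod a / 2) (Cmod a - d / 2) < Cmod a) by (apply Rmax_lub_lt; lra).
      split; [lra|]. split; [rewrite Rabs_left; lra|].
      rewrite (C1 (Cmod a / 2)) by lra. apply C1; lra.
    - apply C1; lra. }
  destruct (Req_dec r (Cmod a)) as [E|E]; [rewrite E; exact C2|].
  rewrite <- C2. apply Ilim; [lra|lra|]. intros d Hd.
  exists (Rmin r (Cmod a + d / 2)).
  pose proof (Rmin_l r (Cmod a + d / 2)). pose proof (Rmin_r r (Cmod a + d / 2)).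
  assert (Cmod a < Rmin r (Cmod a + d / 2)) by (apply Rmin_glb_lt; lra).
  split; [lra|]. split; [rewrite Rabs_right; lra|].
  destruct (Req_dec (Rmin r (Cmod a + d / 2)) r) as [->|N]; [reflexivity|].
  apply Iconst; lra.
Qed.

Lemma mean_value (f : C -> C) (r : R) :
  holo f -> 0 < r < 1 -> is_Cint (fun t => f (circ r t)) 0 (2 * PI) (RtoC (2 * PI) * f 0)%C.
Proof.
  intros Hf Hr. apply (mean_value_except f 0); [intros; apply holo_cont; auto|intros; apply Hf; auto|exact Hr].
Qed.

Lemma C_neq_of_Cmod (a b : C) : Cmod a <> Cmod b -> (a - b)%C <> 0.
Proof. intros H K. apply H. f_equal. apply Csub_eq0, K. Qed.

Lemma one_minus_small_neq0 (w : C) : Cmod w < 1 -> (1 - w)%C <> 0.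
Proof. intros H. apply C_neq_of_Cmod. rewrite Cmod_1. lra. Qed.

Lemma circ_neq0 r t : 0 < r -> circ r t <> 0.
Proof. intros H. apply Cmod_gt_0. rewrite Cmod_circ; lra. Qed.

Lemma circ_scal r t : circ r t = (RtoC r * circ 1 t)%C.
Proof. unfold circ. apply C_ext; simpl; ring. Qed.

Lemma circ_inv_conj t : (/ circ 1 t)%C = Cconj (circ 1 t).
Proof.
  assert (N : circ 1 t <> 0) by (apply circ_neq0; lra).
  assert (E : (circ 1 t * Cconj (circ 1 t))%C = 1).
  { rewrite <- Cmod2_conj, Cmod_circ by lra.
    apply C_ext; simpl; ring. }
  replace (Cconj (circ 1 t)) with (/ circ 1 t * (circ 1 t * Cconj (circ 1 t)))%C by (field; exact N).
  rewrite E. ring.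
Qed.

(** On the circle [/ circ 1 t] is [Cconj (circ 1 t)], so the kernel is the conjugate of
    [1 / (1 - b w)] at [w = circ s t] with [b = Cconj a / (r s)]. That function is analytic in the
    disk and equals [1] at [0], so the mean value property evaluates the integral. *)
Lemma cauchy_kernel_integral (a : C) (r : R) :
  Cmod a < r < 1 ->
  is_Cint (fun t => circ r t / (circ r t - a))%C 0 (2 * PI) (RtoC (2 * PI)).
Proof.
  intros Hr. pose proof (Cmod_ge_0 a) as Ha.
  (* Below [1], so that the circle of radius [s] lies in the disk; above [Cmod a / r], so that
     [Cmod b < 1]. *)
  set (s := (1 + Cmod a / r) / 2).
  assert (Har : 0 <= Cmod a / r < 1).
  { split; [apply Rmult_le_pos; [lra|left; apply Rinv_0_lt_compat; lra]|apply Rlt_div_l; lra]. }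
  assert (Hs : Cmod a / r < s < 1) by (unfold s; lra).
  assert (Rrs : RtoC (r * s) <> 0).
  { intros K. apply RtoC_inj in K. assert (0 < r * s) by (apply Rmult_lt_0_compat; lra). lra. }
  assert (Hrs : 0 < r * s) by (apply Rmult_lt_0_compat; lra).
  assert (Hb : Cmod (Cconj a / RtoC (r * s)) < 1).
  { rewrite Cmod_div by exact Rrs. rewrite Cmod_conj, Cmod_R, Rabs_right by lra.
    apply Rlt_div_l; [lra|]. destruct Hs as [Hs _]. apply (proj1 (Rlt_div_l _ _ r ltac:(lra))) in Hs. lra. }
  set (b := (Cconj a / RtoC (r * s))%C) in *.
  assert (Hk : holo (fun w => / (1 - b * w))%C).
  { apply (holo_inv (fun w => 1 - b * w)%C).
    - intros z Hz. apply one_minus_small_neq0. rewrite Cmod_mult. unfold unit_disk in Hz.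
      pose proof (Cmod_ge_0 z). pose proof (Cmod_ge_0 b). nra.
    - apply (holo_minus (fun _ => RtoC 1) (fun w => b * w)%C); [apply holo_const|].
      apply (holo_mult (fun _ => b) (fun w => w)); [apply holo_const|apply holo_id]. }
  apply (mean_value _ s) in Hk; [|lra].
  apply is_Cint_conj in Hk.
  replace (RtoC (2 * PI)) with (Cconj (RtoC (2 * PI) * / (1 - b * 0))).
  2:{ replace (1 - b * 0)%C with (RtoC 1) by ring. apply C_ext; simpl; field. }
  eapply is_Cint_ext; [|exact Hk]. intros t _. cbv beta.
  assert (N1 : circ 1 t <> 0) by (apply circ_neq0; lra).
  assert (Nr : RtoC r <> 0) by (intros K; apply RtoC_inj in K; lra).
  assert (Ns : RtoC s <> 0) by (intros K; apply RtoC_inj in K; lra).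
  assert (ND : (circ r t - a)%C <> 0).
  { apply C_neq_of_Cmod. rewrite Cmod_circ; lra. }
  assert (E : Cconj (1 - b * circ s t) = ((circ r t - a) / circ r t)%C).
  { rewrite Cminus_conj, Cmult_conj. unfold b. rewrite Cdiv_conj, Cconj_conj by exact Rrs.
    rewrite (circ_scal s), (circ_scal r), Cmult_conj, <- circ_inv_conj.
    assert (X : forall x : R, Cconj (RtoC x) = RtoC x) by (intros; apply C_ext; simpl; ring).
    rewrite !X, RtoC_mult. field. auto. }
  rewrite Cinv_conj.
  - rewrite E. rewrite (circ_scal r) in *. field. repeat split; auto.
  - intros K. apply ND. rewrite K in E.
    assert (X : Cconj 0 = RtoC 0) by (apply C_ext; simpl; ring). rewrite X in E.
    replace (circ r t - a)%C with ((circ r t - a) / circ r t * circ r t)%C.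
    + rewrite <- E. ring.
    + field. rewrite (circ_scal r). apply Cmult_neq_0; auto.
Qed.

Lemma circ_sub_neq0 (a : C) (r t : R) : Cmod a < r -> (circ r t - a)%C <> 0.
Proof. intros H. pose proof (Cmod_ge_0 a). apply C_neq_of_Cmod. rewrite Cmod_circ; lra. Qed.

Lemma cauchy_kernel_bound (a : C) (r t : R) : Cmod a < r ->
  Cmod (circ r t / (circ r t - a)) <= r / (r - Cmod a).
Proof.
  intros H. pose proof (Cmod_ge_0 a).
  rewrite Cmod_div by (apply circ_sub_neq0, H). rewrite Cmod_circ by lra.
  apply Rmult_le_compat_l; [lra|]. apply Rinv_le_contravar; [lra|].
  pose proof (Cmod_triangle_rev (circ r t) a) as T. rewrite Cmod_circ in T; lra.
Qed.

Lemma Cderiv_quotient (f q : C -> C) (a z d : C) :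
  (forall w, f w = (f a + q w * (w - a))%C) -> z <> a -> Cderiv f z d -> exists l, Cderiv q z l.
Proof.
  intros Ef N Hd. pose proof (Csub_neq0 _ _ N) as Nz.
  eexists. apply Cderiv_ext_loc with (fun w => (f w - f a) * / (w - a))%C.
  - apply locally_Cmod. exists (Cmod (z - a)). split; [apply Cmod_gt_0, Nz|].
    intros w Hw. rewrite (Ef w). field. intros K. apply Csub_eq0 in K. subst w.
    rewrite Cmod_sub_sym in Hw. lra.
  - apply Cderiv_mult.
    + apply Cderiv_minus; [exact Hd|apply Cderiv_const].
    + apply Cderiv_inv; [exact Nz|]. apply Cderiv_minus; [apply Cderiv_id|apply Cderiv_const].
Qed.

(** Write [f w = f a + q w * (w - a)]. The first term is handled by the kernel integral. The second
    contributes the circle integral of [w * q w], which is continuous, differentiable except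
    possibly at [a], and zero at [0]; its mean therefore vanishes. *)
Lemma cauchy_formula (f : C -> C) (a : C) (r : R) :
  holo f -> Cmod a < r < 1 ->
  is_Cint (fun t => f (circ r t) * (circ r t / (circ r t - a)))%C 0 (2 * PI) (RtoC (2 * PI) * f a)%C.
Proof.
  intros Hf Hr. pose proof (Cmod_ge_0 a) as Ha.
  destruct (Hf a) as [l Hl]; [unfold unit_disk; lra|].
  apply Cderiv_iff_quot in Hl. destruct Hl as [q [Hq [Eq Ef]]].
  assert (HqD : forall z, unit_disk z -> z <> a -> exists d, Cderiv q z d).
  { intros z Hz Hza. destruct (Hf z Hz) as [d Hd]. exact (Cderiv_quotient f q a z d Ef Hza Hd). }
  assert (HqC : forall z, unit_disk z -> Ccont q z).
  { intros z Hz. destruct (Ceq_dec z a) as [->|N].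
    - unfold Ccont. rewrite Eq. exact Hq.
    - destruct (HqD z Hz N) as [d Hd]. apply (Cderiv_cont _ _ _ Hd). }
  assert (K : is_Cint (fun t => circ r t * q (circ r t))%C 0 (2 * PI) (RtoC (2 * PI) * (0 * q 0))%C).
  { apply (mean_value_except (fun w => w * q w)%C a).
    - intros z Hz. apply Ctends_mult; [apply locally_filter|apply Ccont_id|apply HqC, Hz].
    - intros z Hz N. destruct (HqD z Hz N) as [d Hd]. eexists.
      apply (Cderiv_mult (fun w => w)); [apply Cderiv_id|exact Hd].
    - lra. }
  pose proof (is_Cint_plus _ _ _ _ _ _ K
     (is_Cint_cmult (f a) _ _ _ _ (cauchy_kernel_integral a r Hr))) as S.
  replace (RtoC (2 * PI) * f a)%C with (RtoC (2 * PI) * (0 * q 0) + f a * RtoC (2 * PI))%C by ring.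
  eapply is_Cint_ext; [|exact S]. intros t _. cbv beta.
  rewrite (Ef (circ r t)). field. apply C_neq_of_Cmod. rewrite Cmod_circ; lra.
Qed.

(** * Integrals of Cauchy type *)

(** Differentiation under the integral sign: a pointwise remainder that is quadratic in [w - z],
    with the integrable factor [g], integrates to at most [M * Cmod (w - z) ^ 2]. *)
Lemma Cderiv_Cint (k k' : R -> C -> C) (a b : R) (z : C) (d : R) (g : R -> R) (M : R) :
  a <= b -> 0 < d -> is_RInt g a b M ->
  (forall w, Cmod (w - z) < d -> exists l, is_Cint (fun t => k t w) a b l) ->
  (exists l, is_Cint (fun t => k' t z) a b l) ->
  (forall t w, a <= t <= b -> Cmod (w - z) < d ->
     Cmod (k t w - k t z - k' t z * (w - z)) <= g t * Cmod (w - z) ^ 2) ->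
  Cderiv (fun w => Cint (fun t => k t w) a b) z (Cint (fun t => k' t z) a b).
Proof.
  intros Hab Hd Hg Hk Hk' HM e He.
  apply locally_Cmod. exists (Rmin d (e / (Rabs M + 1))).
  pose proof (Rabs_pos M) as PM. pose proof (Rle_abs M) as PM'.
  split; [apply Rmin_pos; [lra|apply Rdiv_lt_0_compat; lra]|].
  intros w Hw. pose proof (Rmin_l d (e / (Rabs M + 1))). pose proof (Rmin_r d (e / (Rabs M + 1))).
  assert (Hwd : Cmod (w - z) < d) by lra.
  assert (Hwe : Cmod (w - z) * (Rabs M + 1) < e) by (apply Rlt_div_r; lra).
  destruct (Hk w Hwd) as [l1 L1]. destruct (Hk z) as [l2 L2].
  { rewrite Cmod_sub_diag. lra. }
  destruct Hk' as [l3 L3].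
  rewrite (Cint_correct _ _ _ _ L1), (Cint_correct _ _ _ _ L2), (Cint_correct _ _ _ _ L3).
  pose proof (is_Cint_minus _ _ _ _ _ _ (is_Cint_minus _ _ _ _ _ _ L1 L2)
     (is_Cint_cmult (w - z) _ _ _ _ L3)) as S.
  pose proof (is_RInt_scal _ _ _ (Cmod (w - z) ^ 2) _ Hg) as Sg.
  pose proof (Cmod_ge_0 (w - z)) as Pw.
  replace (l3 * (w - z))%C with ((w - z) * l3)%C by ring.
  apply Rle_trans with (Cmod (w - z) ^ 2 * M).
  - apply (is_Cint_bound_fun _ _ _ _ _ _ Hab) with (2 := Sg) (3 := S).
    intros t Ht. rewrite (Cmult_comm (w - z)). eapply Rle_trans; [apply HM; assumption|].
    right. unfold scal; simpl. unfold mult; simpl. ring.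
  - nra.
Qed.

(** The density [phi] is arbitrary, not the boundary values of an analytic function. One derivative
    of [K] serves for removable singularities and limits, the second for the analyticity of a
    derivative. *)
Lemma cauchy_type_integral (phi : R -> C) (r : R) :
  0 < r -> (forall t, Ctends (locally t) phi (phi t)) ->
  exists K K' : C -> C, forall z, Cmod z < r ->
    is_Cint (fun t => phi t * / (circ r t - z))%C 0 (2 * PI) (K z) /\
    Cderiv K z (K' z) /\ exists l, Cderiv K' z l.
Proof.
  intros Hr Hphi. pose proof PI_RGT_0 as HPI.
  exists (fun z => Cint (fun t => phi t * / (circ r t - z))%C 0 (2 * PI)),
    (fun z => Cint (fun t => phi t * (/ (circ r t - z) * / (circ r t - z)))%C 0 (2 * PI)).
  assert (HX : forall z t, Cmod z < r -> Ctends (locally t) (fun t => / (circ r t - z))%C (/ (circ r t - z))%C).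
  { intros z t Hz. apply Ctends_inv; [apply locally_filter| |].
    - apply C_neq_of_Cmod. rewrite Cmod_circ; lra.
    - apply Ctends_minus; [apply locally_filter|apply Ctends_circ|apply Ctends_const, locally_filter]. }
  assert (I1 : forall z, Cmod z < r -> exists l, is_Cint (fun t => phi t * / (circ r t - z))%C 0 (2 * PI) l).
  { intros z Hz. apply is_Cint_cont. intros t _.
    apply Ctends_mult; [apply locally_filter|apply Hphi|apply HX, Hz]. }
  assert (I2 : forall z, Cmod z < r -> exists l,
     is_Cint (fun t => phi t * (/ (circ r t - z) * / (circ r t - z)))%C 0 (2 * PI) l).
  { intros z Hz. apply is_Cint_cont. intros t _.
    apply Ctends_mult; [apply locally_filter|apply Hphi|].
    apply Ctends_mult; [apply locally_filter|apply HX, Hz|apply HX, Hz]. }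
  assert (I3 : forall z, Cmod z < r -> exists l,
     is_Cint (fun t => 2 * (phi t * (/ (circ r t - z) * / (circ r t - z) * / (circ r t - z))))%C 0 (2 * PI) l).
  { intros z Hz. apply is_Cint_cont. intros t _.
    apply Ctends_mult; [apply locally_filter|apply Ctends_const, locally_filter|].
    apply Ctends_mult; [apply locally_filter|apply Hphi|].
    apply Ctends_mult; [apply locally_filter| |apply HX, Hz].
    apply Ctends_mult; [apply locally_filter|apply HX, Hz|apply HX, Hz]. }
  destruct (ex_RInt_continuous (fun t => Cmod (phi t)) 0 (2 * PI)) as [M HM].
  { intros t _. apply (Ctends_Cmod (locally t) phi (phi t)), Hphi. }
  intros z Hz. destruct (I1 z Hz) as [l Hl].
  (* Half the distance from [z] to the circle, so that [/ d] bounds the kernel [1 / (circ r t - w)]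
     for all [w] within [d] of [z]. *)
  set (d := (r - Cmod z) / 2). assert (Hd : 0 < d) by (unfold d; lra).
  assert (Hwr : forall w, Cmod (w - z) < d -> Cmod w < r - d).
  { intros w Hw. pose proof (Cmod_triangle_rev w z). unfold d in *; lra. }
  assert (Hdist : forall w t, Cmod (w - z) < d -> Cmod (/ (circ r t - w)) <= / d).
  { intros w t Hw. specialize (Hwr w Hw). rewrite Cmod_inv.
    - apply Rinv_le_contravar; [exact Hd|].
      pose proof (Cmod_triangle_rev (circ r t) w). rewrite Cmod_circ in H; lra.
    - apply C_neq_of_Cmod. rewrite Cmod_circ; lra. }
  assert (Hzz : Cmod (z - z) < d) by (rewrite Cmod_sub_diag; lra).
  assert (Hid : 0 < / d) by (apply Rinv_0_lt_compat, Hd).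
  assert (HN : forall w t, Cmod (w - z) < d -> (circ r t - w)%C <> 0).
  { intros w t Hw. specialize (Hwr w Hw). apply C_neq_of_Cmod. rewrite Cmod_circ; lra. }
  split; [|split].
  - apply is_Cint_Cint in Hl. exact Hl.
  - eapply (Cderiv_Cint (fun t z => phi t * / (circ r t - z))%C
      (fun t z => phi t * (/ (circ r t - z) * / (circ r t - z)))%C
      0 (2 * PI) z d (fun t => (/ d) ^ 3 * Cmod (phi t))).
    + lra.
    + exact Hd.
    + apply (is_RInt_scal _ _ _ ((/ d) ^ 3) _ HM).
    + intros w Hw. apply I1. specialize (Hwr w Hw). lra.
    + apply I2, Hz.
    + intros t w Ht Hw.
      replace (phi t * / (circ r t - w) - phi t * / (circ r t - z) -
          phi t * (/ (circ r t - z) * / (circ r t - z)) * (w - z))%C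
        with (phi t * (/ (circ r t - w) * (/ (circ r t - z) * / (circ r t - z))) * ((w - z) * (w - z)))%C
        by (field; auto).
      rewrite !Cmod_mult.
      pose proof (Hdist w t Hw) as D1. pose proof (Hdist z t Hzz) as D2.
      pose proof (Cmod_ge_0 (/ (circ r t - w))). pose proof (Cmod_ge_0 (/ (circ r t - z))).
      replace (Cmod (w - z) * Cmod (w - z)) with (Cmod (w - z) ^ 2) by ring.
      apply Rmult_le_compat_r; [apply pow2_ge_0|].
      rewrite (Rmult_comm ((/ d) ^ 3)). apply Rmult_le_compat_l; [apply Cmod_ge_0|].
      replace ((/ d) ^ 3) with (/ d * (/ d * / d)) by ring.
      apply Rmult_le_compat; auto; [apply Rmult_le_pos; auto|]. apply Rmult_le_compat; auto.
  - exists (Cint (fun t => 2 * (phi t * (/ (circ r t - z) * / (circ r t - z) * / (circ r t - z))))%C 0 (2 * PI)).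
    eapply (Cderiv_Cint (fun t z => phi t * (/ (circ r t - z) * / (circ r t - z)))%C
      (fun t z => 2 * (phi t * (/ (circ r t - z) * / (circ r t - z) * / (circ r t - z))))%C
      0 (2 * PI) z d (fun t => 3 * (/ d) ^ 4 * Cmod (phi t))).
    + lra.
    + exact Hd.
    + apply (is_RInt_scal _ _ _ (3 * (/ d) ^ 4) _ HM).
    + intros w Hw. apply I2. specialize (Hwr w Hw). lra.
    + apply I3, Hz.
    + intros t w Ht Hw.
      pose proof (Hdist w t Hw) as D1. pose proof (Hdist z t Hzz) as D2.
      pose proof (Cmod_ge_0 (/ (circ r t - w))). pose proof (Cmod_ge_0 (/ (circ r t - z))).
      (* With [X = 1 / (circ r t - w)], [Y = 1 / (circ r t - z)] and [h = w - z], one has [X^2 - Y^2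
         - 2 Y^3 h = (2 X Y^3 + X^2 Y^2) h^2], because [X - Y = X Y h]. The three products of four
         kernels give the constant [3 * (/ d) ^ 4]. *)
      transitivity (Cmod (phi t * ((2 * (/ (circ r t - w)) * ((/ (circ r t - z)) * ((/ (circ r t - z)) * (/ (circ r t - z)))) + (/ (circ r t - w)) * (/ (circ r t - w)) * ((/ (circ r t - z)) * (/ (circ r t - z))))) * ((w - z) * (w - z)))).
      { right. f_equal. field; auto. }
      rewrite Cmod_mult, Cmod_mult, (Cmod_mult (w - z)).
      replace (Cmod (w - z) * Cmod (w - z)) with (Cmod (w - z) ^ 2) by ring.
      apply Rmult_le_compat_r; [apply pow2_ge_0|].
      rewrite (Rmult_comm (3 * (/ d) ^ 4)). apply Rmult_le_compat_l; [apply Cmod_ge_0|].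
      eapply Rle_trans; [apply Cmod_triangle|]. rewrite !Cmod_mult, Cmod_R, Rabs_right by lra.
      set (x := Cmod (/ (circ r t - w))) in *. set (y := Cmod (/ (circ r t - z))) in *.
      assert (Y2 : y * y <= / d * / d) by (apply Rmult_le_compat; auto).
      assert (P2 : 0 <= y * y) by (apply Rmult_le_pos; auto).
      assert (Y3 : y * (y * y) <= / d * (/ d * / d)) by (apply Rmult_le_compat; auto).
      assert (P3 : 0 <= y * (y * y)) by (apply Rmult_le_pos; auto).
      assert (X2 : x * x <= / d * / d) by (apply Rmult_le_compat; auto).
      assert (Q2 : 0 <= x * x) by (apply Rmult_le_pos; auto).
      assert (x * (y * (y * y)) <= / d * (/ d * (/ d * / d))) by (apply Rmult_le_compat; auto).
      assert ((x * x) * (y * y) <= (/ d * / d) * (/ d * / d)) by (apply Rmult_le_compat; auto).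
      replace (3 * (/ d) ^ 4) with (2 * (/ d * (/ d * (/ d * / d))) + (/ d * / d) * (/ d * / d)) by ring.
      lra.
Qed.

Lemma RtoC_2PI_neq0 : RtoC (2 * PI) <> 0.
Proof. intros K. apply RtoC_inj in K. pose proof PI_RGT_0. lra. Qed.

Lemma locally_Cmod_lt (z : C) r : Cmod z < r -> locally z (fun w => Cmod w < r).
Proof.
  intros H. apply locally_Cmod. exists (r - Cmod z). split; [lra|].
  intros w Hw. pose proof (Cmod_triangle_rev w z). lra.
Qed.

Lemma unit_disk_radius z : unit_disk z -> exists r, Cmod z < r < 1.
Proof. unfold unit_disk. intros H. exists ((Cmod z + 1) / 2). lra. Qed.

(** * Consequences of Cauchy's formula: derivatives, removable singularities, limits *)

(** Isolates what an analytic function and a locally uniform limit of such functions have in common: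
    continuity on a circle and reproduction by Cauchy's formula inside. Such a [g] is a Cauchy-type
    integral there. *)
Lemma holo_of_cauchy_formula (g : C -> C) (z : C) (r : R) :
  0 < r -> (forall t, Ctends (locally t) (fun t => g (circ r t)) (g (circ r t))) -> Cmod z < r ->
  (forall a, Cmod a < r ->
     is_Cint (fun t => g (circ r t) * (circ r t / (circ r t - a)))%C 0 (2 * PI) (RtoC (2 * PI) * g a)%C) ->
  exists l g', locally z (fun w => Cderiv g w (g' w)) /\ Cderiv g' z l.
Proof.
  intros Hr Hc Hz Hg.
  destruct (cauchy_type_integral (fun t => g (circ r t) * circ r t)%C r Hr) as (K & K' & HK).
  { intros t. apply Ctends_mult; [apply locally_filter|apply Hc|apply Ctends_circ]. }
  destruct (HK z Hz) as (_ & _ & l & Hl).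
  exists (/ RtoC (2 * PI) * l)%C, (fun w => / RtoC (2 * PI) * K' w)%C.
  assert (E : forall a, Cmod a < r -> g a = (/ RtoC (2 * PI) * K a)%C).
  { intros a Ha. destruct (HK a Ha) as (A & _).
    assert (X : (RtoC (2 * PI) * g a)%C = K a).
    { apply (is_Cint_unique _ _ _ _ _ (Hg a Ha)). eapply is_Cint_ext; [|exact A].
      intros t _. cbv beta. unfold Cdiv. ring. }
    rewrite <- X. field. apply RtoC_2PI_neq0. }
  split.
  - generalize (locally_Cmod_lt z r Hz). apply filter_imp. intros w Hw.
    destruct (HK w Hw) as (_ & B & _).
    apply Cderiv_ext_loc with (fun w => / RtoC (2 * PI) * K w)%C.
    + generalize (locally_Cmod_lt w r Hw). apply filter_imp. intros v Hv. symmetry. apply E, Hv.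
    + apply Cderiv_scal, B.
  - apply Cderiv_scal, Hl.
Qed.

Lemma holo_derivative (f : C -> C) : holo f -> holo (C_derive f).
Proof.
  intros Hf z Hz. destruct (unit_disk_radius z Hz) as [r Hr]. pose proof (Cmod_ge_0 z).
  destruct (holo_of_cauchy_formula f z r) as (l & g' & A & B).
  - lra.
  - intros t. apply (Ctends_on_circle f); [lra|]. intros w Hw. apply holo_cont; [exact Hf|unfold unit_disk; lra].
  - lra.
  - intros a Ha. apply cauchy_formula; [exact Hf|lra].
  - exists l. eapply Cderiv_ext_loc; [|exact B]. revert A. apply filter_imp.
    intros w Hw. symmetry. apply Cderiv_C_derive, Hw.
Qed.

Lemma Ccont_eq_punctured (f g : C -> C) (a : C) :
  Ccont f a -> Ccont g a -> locally a (fun w => w <> a -> f w = g w) -> f a = g a.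
Proof.
  intros Hf Hg H. apply Csub_eq0, Cmod_le_eps. intros e He.
  pose proof (filter_and _ _ (filter_and _ _ (Hf (e/2) (half_pos e He)) (Hg (e/2) (half_pos e He))) H) as K.
  apply locally_Cmod in K. destruct K as [d [Hd K]].
  destruct (locally_punctured_C a d Hd) as [w [W1 W2]].
  destruct (K w W2) as [[A B] D]. rewrite (D W1) in A.
  replace (f a - g a)%C with ((g w - g a) - (g w - f a))%C by ring.
  eapply Rle_trans; [apply Cmod_triangle_sub|]. lra.
Qed.

(** Away from [a] the quotient is differentiable by the quotient rule. Subtracting Cauchy's formulas
    at [w] and [a] shows that near [a], but off [a], it is a Cauchy-type integral, which is
    differentiable at [a] too; continuity of [q] makes the two agree at [a]. *)
Lemma holo_division (f : C -> C) (a : C) :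
  holo f -> unit_disk a ->
  exists q, holo q /\ q a = C_derive f a /\ forall z, f z = (f a + q z * (z - a))%C.
Proof.
  intros Hf Ha. pose proof (holo_C_derive f a Hf Ha) as Hl.
  apply Cderiv_iff_quot in Hl. destruct Hl as [q [Hq [Eq Ef]]].
  exists q. split; [|auto].
  intros z Hz. destruct (Ceq_dec z a) as [E|N].
  2:{ destruct (Hf z Hz) as [d Hd]. exact (Cderiv_quotient f q a z d Ef N Hd). }
  subst z. destruct (unit_disk_radius a Ha) as [r Hr]. pose proof (Cmod_ge_0 a).
  assert (Hr0 : 0 < r) by lra.
  assert (Nc : forall w t, Cmod w < r -> (circ r t - w)%C <> 0).
  { intros w t Hw. apply C_neq_of_Cmod. rewrite Cmod_circ; lra. }
  destruct (cauchy_type_integral (fun t => f (circ r t) * circ r t * / (circ r t - a))%C r Hr0) as (K & K' & HK).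
  { intros t. apply Ctends_mult; [apply locally_filter| |].
    - apply Ctends_mult; [apply locally_filter| |apply Ctends_circ].
      apply (Ctends_on_circle f); [lra|]. intros w Hw. apply holo_cont; [exact Hf|unfold unit_disk; lra].
    - apply Ctends_inv; [apply locally_filter|apply Nc; lra|].
      apply Ctends_minus; [apply locally_filter|apply Ctends_circ|apply Ctends_const, locally_filter]. }
  assert (E1 : forall w, Cmod w < r -> w <> a -> q w = (/ RtoC (2 * PI) * K w)%C).
  { intros w Hw Hwa. destruct (HK w Hw) as (A & _).
    assert (Nw : (w - a)%C <> 0) by (apply Csub_neq0, Hwa).
    pose proof (is_Cint_minus _ _ _ _ _ _ (cauchy_formula f w r Hf ltac:(lra)) (cauchy_formula f a r Hf ltac:(lra))) as S.
    apply (is_Cint_cmult (/ (w - a))) in S.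
    assert (X : (/ (w - a) * (RtoC (2 * PI) * f w - RtoC (2 * PI) * f a))%C = K w).
    { apply (is_Cint_unique _ _ _ _ _ S). eapply is_Cint_ext; [|exact A].
      intros t _. cbv beta. field.
      split; [|split]; first [exact Nw|apply Nc; lra]. }
    rewrite <- X. rewrite (Ef w). field. split; [exact Nw|apply RtoC_2PI_neq0]. }
  destruct (HK a ltac:(lra)) as (_ & B & _).
  assert (B' : Cderiv (fun w => / RtoC (2 * PI) * K w)%C a (/ RtoC (2 * PI) * K' a)%C).
  { apply Cderiv_scal, B. }
  assert (E2 : q a = (/ RtoC (2 * PI) * K a)%C).
  { apply (Ccont_eq_punctured q (fun w => / RtoC (2 * PI) * K w)%C).
    - unfold Ccont. rewrite Eq. exact Hq.
    - apply (Cderiv_cont _ _ _ B').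
    - generalize (locally_Cmod_lt a r (proj1 Hr)). apply filter_imp. exact E1. }
  exists (/ RtoC (2 * PI) * K' a)%C. eapply Cderiv_ext_loc; [|exact B'].
  generalize (locally_Cmod_lt a r (proj1 Hr)). apply filter_imp. intros w Hw.
  destruct (Ceq_dec w a) as [->|N]; symmetry; [exact E2|apply E1; assumption].
Qed.

(** Weierstrass's theorem: continuity and Cauchy's formula survive approximation that is uniform on
    smaller closed discs. *)
Lemma holo_limit (fn : nat -> C -> C) (g : C -> C) :
  (forall n, holo (fn n)) ->
  (forall r e, r < 1 -> 0 < e -> exists n, forall z, Cmod z <= r -> Cmod (fn n z - g z) <= e) ->
  holo g.
Proof.
  intros Hn Hlim.
  assert (Hg : forall z, unit_disk z -> Ccont g z).
  { intros z Hz e He. destruct (unit_disk_radius z Hz) as [r Hr].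
    assert (He4 : 0 < e / 4) by lra.
    destruct (Hlim r (e / 4) ltac:(lra) He4) as [n Hc].
    pose proof (holo_cont (fn n) z (Hn n) Hz (e / 4) He4) as H1.
    generalize (filter_and _ _ H1 (locally_Cmod_lt z r (proj1 Hr))). apply filter_imp.
    intros w [A B].
    replace (g w - g z)%C with (- (fn n w - g w) + ((fn n w - fn n z) + (fn n z - g z)))%C by ring.
    eapply Rle_lt_trans; [apply Cmod_triangle|]. rewrite Cmod_opp.
    pose proof (Cmod_triangle (fn n w - fn n z) (fn n z - g z)).
    pose proof (Hc w ltac:(lra)). pose proof (Hc z ltac:(lra)). lra. }
  intros z Hz. destruct (unit_disk_radius z Hz) as [r Hr]. pose proof (Cmod_ge_0 z).
  pose proof PI_RGT_0 as HPI.
  assert (HT : forall t, Ctends (locally t) (fun t => g (circ r t)) (g (circ r t))).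
  { intros t. apply (Ctends_on_circle g); [lra|]. intros w Hw. apply Hg. unfold unit_disk; lra. }
  destruct (holo_of_cauchy_formula g z r) as (l & g' & A & _).
  - lra.
  - exact HT.
  - lra.
  - intros a Ha.
    assert (Nc : forall t, (circ r t - a)%C <> 0).
    { intros t. apply C_neq_of_Cmod. rewrite Cmod_circ; lra. }
    destruct (is_Cint_cont (fun t => g (circ r t) * (circ r t / (circ r t - a)))%C 0 (2 * PI)) as [m Hm].
    { intros t _. apply Ctends_mult; [apply locally_filter|apply HT|].
      apply Ctends_mult; [apply locally_filter|apply Ctends_circ|].
      apply Ctends_inv; [apply locally_filter|apply Nc|].
      apply Ctends_minus; [apply locally_filter|apply Ctends_circ|apply Ctends_const, locally_filter]. }
    enough (E : (m - RtoC (2 * PI) * g a)%C = 0) by (rewrite <- (Csub_eq0 _ _ E); exact Hm).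
    apply Cmod_le_eps. intros e He.
    set (k := r / (r - Cmod a)).
    assert (Hk : 0 < k) by (unfold k; apply Rdiv_lt_0_compat; lra).
    (* The approximation error enters twice: under the integral, multiplied by the kernel bound [k],
       and in the value at [a]. Together they amount to [2 PI (k + 1)] times this number, that is
       [e]. *)
    assert (Hd : 0 < e / (2 * PI * (k + 1))).
    { apply Rdiv_lt_0_compat; [lra|]. apply Rmult_lt_0_compat; lra. }
    destruct (Hlim r _ ltac:(lra) Hd) as [n Hc].
    pose proof (is_Cint_minus _ _ _ _ _ _ Hm (cauchy_formula (fn n) a r (Hn n) ltac:(lra))) as S.
    apply is_Cint_bound with (M := e / (2 * PI * (k + 1)) * k) in S; [|lra|].
    + replace (m - RtoC (2 * PI) * g a)%C
        with ((m - RtoC (2 * PI) * fn n a) + RtoC (2 * PI) * (fn n a - g a))%C by ring.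
      eapply Rle_trans; [apply Cmod_triangle|]. rewrite Cmod_mult, Cmod_R, Rabs_right by lra.
      pose proof (Hc a ltac:(lra)) as Q.
      apply Rle_trans with ((2 * PI - 0) * (e / (2 * PI * (k + 1)) * k) + 2 * PI * (e / (2 * PI * (k + 1)))).
      * apply Rplus_le_compat; [exact S|]. apply Rmult_le_compat_l; lra.
      * right. field. lra.
    + intros t _.
      replace (g (circ r t) * (circ r t / (circ r t - a)) - fn n (circ r t) * (circ r t / (circ r t - a)))%C
        with (- (fn n (circ r t) - g (circ r t)) * (circ r t / (circ r t - a)))%C by ring.
      rewrite Cmod_mult, Cmod_opp. apply Rmult_le_compat; try apply Cmod_ge_0.
      * apply Hc. rewrite Cmod_circ; lra.
      * apply cauchy_kernel_bound; lra.
  - exists (g' z). apply (locally_singleton _ _ A).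
Qed.

(** * The maximum principle *)

(* Landau's trick: Cauchy's formula for [f ^ n] bounds [f a ^ n] up to a constant. *)
Lemma maximum_principle_circle (f : C -> C) (a : C) (r M : R) :
  holo f -> Cmod a < r < 1 -> (forall z, Cmod z = r -> Cmod (f z) <= M) -> Cmod (f a) <= M.
Proof.
  intros Hf Hr HM. pose proof (Cmod_ge_0 a) as Ha. pose proof PI_RGT_0 as HPI.
  assert (HM0 : 0 <= M).
  { eapply Rle_trans; [apply Cmod_ge_0|apply (HM (circ r 0))]. apply Cmod_circ; lra. }
  set (k := r / (r - Cmod a)).
  assert (Hk : 0 < k) by (unfold k; apply Rdiv_lt_0_compat; lra).
  assert (Hn : forall n, Cmod (f a) ^ n <= k * M ^ n).
  { intros n.
    pose proof (cauchy_formula (fun w => f w ^ n)%C a r (holo_pow f n Hf) Hr) as S.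
    apply is_Cint_bound with (M := M ^ n * k) in S; [|lra|].
    - rewrite Cmod_mult, Cmod_R, Rabs_right, Cmod_pow in S by lra. nra.
    - intros t _. rewrite Cmod_mult, Cmod_pow.
      assert (Nc : (circ r t - a)%C <> 0) by (apply C_neq_of_Cmod; rewrite Cmod_circ; lra).
      apply Rmult_le_compat; [apply pow_le, Cmod_ge_0|apply Cmod_ge_0| |].
      + apply pow_incr. split; [apply Cmod_ge_0|apply HM, Cmod_circ; lra].
      + apply cauchy_kernel_bound; lra. }
  apply Rnot_lt_le. intros HL.
  destruct (Req_dec M 0) as [E|E].
  { specialize (Hn 1%nat). rewrite E in Hn, HL. simpl in Hn. lra. }
  assert (MP : 0 < M) by lra.
  assert (Q : 1 < Cmod (f a) / M) by (apply Rlt_div_r; lra).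
  destruct (Pow_x_infinity (Cmod (f a) / M)) with (b := k + 1) as [N HN].
  { rewrite Rabs_right; lra. }
  specialize (HN N (Nat.le_refl _)). specialize (Hn N).
  rewrite Rabs_right in HN by (apply Rle_ge, pow_le; lra).
  unfold Rdiv in HN. rewrite Rpow_mult_distr, pow_inv in HN.
  assert (PN : 0 < M ^ N) by (apply pow_lt, MP).
  assert (Cmod (f a) ^ N * / M ^ N <= k).
  { apply Rle_div_l; [exact PN|exact Hn]. }
  lra.
Qed.

Lemma maximum_principle_boundary (f : C -> C) :
  holo f ->
  (forall e, 0 < e -> exists r0, r0 < 1 /\ forall z, r0 < Cmod z < 1 -> Cmod (f z) <= 1 + e) ->
  forall z, unit_disk z -> Cmod (f z) <= 1.
Proof.
  intros Hf Hb z Hz. apply le_epsilon. intros e He.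
  destruct (Hb e He) as [r0 [H0 H1]]. pose proof (Rmax_l r0 (Cmod z)). pose proof (Rmax_r r0 (Cmod z)).
  assert (Rmax r0 (Cmod z) < 1) by (apply Rmax_lub_lt; auto).
  apply (maximum_principle_circle f z ((Rmax r0 (Cmod z) + 1) / 2)); [exact Hf|lra|].
  intros w Hw. apply H1. lra.
Qed.

(** * Blaschke factors *)

Definition schur (f : C -> C) : Prop := holo f /\ forall z, unit_disk z -> Cmod (f z) <= 1.

Lemma mobius_identity (a z : C) :
  Cmod (1 - Cconj a * z) ^ 2 - Cmod (a - z) ^ 2 = (1 - Cmod a ^ 2) * (1 - Cmod z ^ 2).
Proof. rewrite !Cmod2_alt. destruct a, z; simpl. ring. Qed.

Lemma mobius_denom_ge (a z : C) : unit_disk a -> unit_disk z ->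
  1 - Cmod a <= Cmod (1 - Cconj a * z) /\ 1 - Cmod z <= Cmod (1 - Cconj a * z) /\
  Cmod (1 - Cconj a * z) <= 2.
Proof.
  unfold unit_disk. intros Ha Hz.
  pose proof (Cmod_triangle_rev 1 (Cconj a * z)) as A.
  pose proof (Cmod_triangle_sub 1 (Cconj a * z)) as B.
  rewrite Cmod_mult, Cmod_conj, Cmod_1 in A, B.
  pose proof (Cmod_ge_0 a). pose proof (Cmod_ge_0 z). nra.
Qed.

Lemma mobius_denom_neq0 (a z : C) : unit_disk a -> unit_disk z -> (1 - Cconj a * z)%C <> 0.
Proof.
  intros Ha Hz. apply Cmod_gt_0. pose proof (mobius_denom_ge a z Ha Hz).
  unfold unit_disk in *. lra.
Qed.

Lemma Cconj_neq0 (a : C) : a <> 0 -> Cconj a <> 0.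
Proof. intros H. apply Cmod_gt_0. rewrite Cmod_conj. apply Cmod_gt_0, H. Qed.

Lemma RtoC_Cmod_neq0 (a : C) : a <> 0 -> RtoC (Cmod a) <> 0.
Proof. intros H K. apply RtoC_inj in K. apply Cmod_gt_0 in H. lra. Qed.

Lemma Cmod_blaschke_factor (a z : C) : unit_disk a -> unit_disk z ->
  Cmod (blaschke_factor a z) = Cmod (a - z) / Cmod (1 - Cconj a * z).
Proof.
  intros Ha Hz. unfold blaschke_factor. destruct (Ceq_dec a 0) as [->|N].
  - replace (1 - Cconj 0 * z)%C with (RtoC 1) by (apply C_ext; simpl; ring).
    replace (0 - z)%C with (- z)%C by ring. rewrite Cmod_opp, Cmod_1. field.
  - rewrite Cmod_mult, !Cmod_div, Cmod_conj, Cmod_R, Rabs_right.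
    + field. split; [|apply Rgt_not_eq, Cmod_gt_0, N].
      apply Rgt_not_eq, Cmod_gt_0, mobius_denom_neq0; assumption.
    + apply Rle_ge, Cmod_ge_0.
    + apply mobius_denom_neq0; assumption.
    + apply RtoC_Cmod_neq0, N.
Qed.

Lemma blaschke_factor_defect (a z : C) : unit_disk a -> unit_disk z ->
  1 - Cmod (blaschke_factor a z) ^ 2 =
  (1 - Cmod a ^ 2) * (1 - Cmod z ^ 2) / Cmod (1 - Cconj a * z) ^ 2.
Proof.
  intros Ha Hz. rewrite Cmod_blaschke_factor by assumption. rewrite <- mobius_identity.
  field. apply Rgt_not_eq, Cmod_gt_0, mobius_denom_neq0; assumption.
Qed.

Lemma Cmod_sq_lt1 (z : C) : unit_disk z -> 0 <= Cmod z ^ 2 < 1.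
Proof. unfold unit_disk. intros H. pose proof (Cmod_ge_0 z). nra. Qed.

Lemma blaschke_factor_le1 (a z : C) : unit_disk a -> unit_disk z ->
  Cmod (blaschke_factor a z) <= 1.
Proof.
  intros Ha Hz. pose proof (blaschke_factor_defect a z Ha Hz) as E.
  pose proof (Cmod_sq_lt1 a Ha). pose proof (Cmod_sq_lt1 z Hz).
  pose proof (proj1 (Cmod_gt_0 _) (mobius_denom_neq0 a z Ha Hz)).
  assert (0 <= (1 - Cmod a ^ 2) * (1 - Cmod z ^ 2) / Cmod (1 - Cconj a * z) ^ 2).
  { apply Rmult_le_pos; [apply Rmult_le_pos; lra|].
    left. apply Rinv_0_lt_compat, pow_lt; assumption. }
  pose proof (Cmod_ge_0 (blaschke_factor a z)). nra.
Qed.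

(** The modulus of a factor tends to [1] at the unit circle, uniformly in direction; this is what
    allows division by the factor without losing the bound [1]. *)
Lemma blaschke_factor_boundary (a z : C) : unit_disk a -> unit_disk z ->
  1 - 4 / (1 - Cmod a) * (1 - Cmod z) <= Cmod (blaschke_factor a z).
Proof.
  intros Ha Hz. pose proof (blaschke_factor_defect a z Ha Hz) as E.
  pose proof (blaschke_factor_le1 a z Ha Hz).
  pose proof (Cmod_sq_lt1 a Ha). pose proof (Cmod_sq_lt1 z Hz).
  destruct (mobius_denom_ge a z Ha Hz) as [D _]. unfold unit_disk in *.
  pose proof (Cmod_ge_0 a). pose proof (Cmod_ge_0 z).
  set (D0 := Cmod (1 - Cconj a * z)) in *.
  assert (K : (1 - Cmod a ^ 2) * (1 - Cmod z ^ 2) / D0 ^ 2 <= 4 / (1 - Cmod a) * (1 - Cmod z)).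
  { apply Rle_div_l; [apply pow_lt; lra|].
    replace (4 / (1 - Cmod a) * (1 - Cmod z) * D0 ^ 2)
      with ((1 - Cmod z) * (4 * (D0 ^ 2 / (1 - Cmod a)))) by (field; lra).
    assert (1 - Cmod a <= D0 ^ 2 / (1 - Cmod a)).
    { apply Rle_div_r; [lra|]. nra. }
    replace ((1 - Cmod a ^ 2) * (1 - Cmod z ^ 2))
      with ((1 - Cmod z) * ((1 - Cmod a) * (1 + Cmod a) * (1 + Cmod z))) by ring.
    apply Rmult_le_compat_l; [lra|].
    assert ((1 + Cmod a) * (1 + Cmod z) <= 4) by nra.
    nra. }
  pose proof (Cmod_ge_0 (blaschke_factor a z)). nra.
Qed.

(** Turns a lower bound for a product of factors at one point into a bound for the sum of the
    [1 - Cmod a]. The constant [8] is [4], from the squared denominator, times [2], from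
    [1 - x ^ 2 <= 2 (1 - x)]. *)
Lemma blaschke_factor_upper (a z : C) : unit_disk a -> unit_disk z ->
  Cmod (blaschke_factor a z) <= exp (- ((1 - Cmod z ^ 2) / 8 * (1 - Cmod a))).
Proof.
  intros Ha Hz. pose proof (blaschke_factor_defect a z Ha Hz) as E.
  pose proof (blaschke_factor_le1 a z Ha Hz).
  pose proof (Cmod_sq_lt1 z Hz). pose proof (Cmod_sq_lt1 a Ha).
  destruct (mobius_denom_ge a z Ha Hz) as [D1 [_ D2]]. unfold unit_disk in *.
  pose proof (Cmod_ge_0 a).
  set (D0 := Cmod (1 - Cconj a * z)) in *.
  assert (K : (1 - Cmod z ^ 2) / 4 * (1 - Cmod a) <= (1 - Cmod a ^ 2) * (1 - Cmod z ^ 2) / D0 ^ 2).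
  { assert (PD : D0 ^ 2 > 0) by (apply pow_lt; lra). apply (proj1 (Rle_div_r _ _ _ PD)).
    assert (D0 ^ 2 <= 4) by nra.
    assert (0 <= (1 - Cmod z ^ 2) * (1 - Cmod a)) by nra.
    nra. }
  pose proof (exp_ineq1_le (- ((1 - Cmod z ^ 2) / 8 * (1 - Cmod a)))).
  pose proof (Cmod_ge_0 (blaschke_factor a z)). nra.
Qed.

(** The normalization [Cconj a / Cmod a] brings the factor close to [1] when [a] is close to the
    circle. The bound is linear in [1 - Cmod a], so that summable defects give convergence. *)
Lemma blaschke_factor_sub1 (a z : C) : unit_disk a -> unit_disk z ->
  Cmod (blaschke_factor a z - 1) <= 2 / (1 - Cmod z) * (1 - Cmod a).
Proof.
  intros Ha Hz. pose proof (mobius_denom_ge a z Ha Hz) as D.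
  pose proof (mobius_denom_neq0 a z Ha Hz) as ND.
  pose proof (Cmod_ge_0 a) as Pa. pose proof (Cmod_ge_0 z) as Pz.
  unfold unit_disk in *. unfold blaschke_factor.
  destruct (Ceq_dec a 0) as [->|N].
  - rewrite Cmod_0. eapply Rle_trans; [apply Cmod_triangle_sub|]. rewrite Cmod_1.
    rewrite Rminus_0_r, Rmult_1_r. apply Rle_div_r; [lra|]. nra.
  - assert (Na : RtoC (Cmod a) <> 0) by (apply RtoC_Cmod_neq0, N).
    replace (Cconj a / Cmod a * ((a - z) / (1 - Cconj a * z)) - 1)%C
      with (RtoC (Cmod a - 1) * ((RtoC (Cmod a) + Cconj a * z) / (RtoC (Cmod a) * (1 - Cconj a * z))))%C.
    2:{ pose proof (Cmod2_conj a) as M. rewrite RtoC_minus. rewrite RtoC_pow in M.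
        assert (M' : (Cconj a * a)%C = (RtoC (Cmod a) * RtoC (Cmod a))%C).
        { rewrite (Cmult_comm (Cconj a)), <- M. ring. }
        transitivity (((RtoC (Cmod a) * RtoC (Cmod a)) - Cconj a * z - RtoC (Cmod a) * (1 - Cconj a * z)) / (RtoC (Cmod a) * (1 - Cconj a * z)))%C.
        - field. auto.
        - rewrite <- M'. field. auto. }
    rewrite Cmod_mult, Cmod_div, (Cmod_mult (RtoC (Cmod a)) (1 - _)) by (apply Cmult_neq_0; assumption).
    rewrite !Cmod_R, (Rabs_right (Cmod a)), (Rabs_left1 (Cmod a - 1)) by lra.
    pose proof (Cmod_triangle (RtoC (Cmod a)) (Cconj a * z)) as T.
    rewrite Cmod_mult, Cmod_conj, Cmod_R, Rabs_right in T by lra.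
    pose proof (proj1 (Cmod_gt_0 _) N) as Pa'.
    replace (2 / (1 - Cmod z) * (1 - Cmod a)) with (- (Cmod a - 1) * (2 / (1 - Cmod z))) by (field; lra).
    apply Rmult_le_compat_l; [lra|].
    apply Rle_div_l; [nra|].
    apply Rle_trans with (2 * Cmod a); [nra|].
    replace (2 / (1 - Cmod z) * (Cmod a * Cmod (1 - Cconj a * z)))
      with ((2 * Cmod a) * (Cmod (1 - Cconj a * z) / (1 - Cmod z))) by (field; lra).
    assert (1 <= Cmod (1 - Cconj a * z) / (1 - Cmod z)) by (apply Rle_div_r; lra).
    nra.
Qed.

(** The quotient is analytic by division at the zero. Since the factor has modulus near [1] close to
    the circle, the quotient is at most [1 + e] there, and the maximum principle carries the bound
    [1] inside, as in the Schwarz lemma. *)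
Lemma schur_division (g : C -> C) (a : C) :
  schur g -> unit_disk a -> g a = 0 ->
  exists g', schur g' /\ forall z, unit_disk z -> g z = (blaschke_factor a z * g' z)%C.
Proof.
  intros [Hg Hb] Ha Hga.
  destruct (holo_division g a Hg Ha) as (q & Hq & _ & Eq').
  assert (H : exists g', holo g' /\ forall z, unit_disk z -> g z = (blaschke_factor a z * g' z)%C).
  { destruct (Ceq_dec a 0) as [->|N].
    - exists q. split; [exact Hq|]. intros z Hz. rewrite (Eq' z), Hga. unfold blaschke_factor.
      destruct (Ceq_dec 0 0); [ring|congruence].
    - exists (fun z => (- (RtoC (Cmod a) / Cconj a)) * (q z * (1 - Cconj a * z)))%C. split.
      + apply (holo_mult (fun _ => (- (RtoC (Cmod a) / Cconj a))%C)); [apply holo_const|].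
        apply holo_mult; [exact Hq|].
        apply (holo_minus (fun _ => RtoC 1) (fun z => Cconj a * z)%C); [apply holo_const|].
        apply (holo_mult (fun _ => Cconj a) (fun z => z)); [apply holo_const|apply holo_id].
      + intros z Hz. rewrite (Eq' z), Hga. unfold blaschke_factor.
        destruct (Ceq_dec a 0) as [?|_]; [congruence|].
        field. split; [apply Cconj_neq0, N|]. split; [apply mobius_denom_neq0; assumption|apply RtoC_Cmod_neq0, N]. }
  destruct H as (g' & Hg' & E). exists g'. split; [|exact E]. split; [exact Hg'|].
  apply maximum_principle_boundary; [exact Hg'|].
  intros e He. unfold unit_disk in Ha. pose proof (Cmod_ge_0 a).
  set (k := 4 / (1 - Cmod a)).
  assert (Hk : 0 < k) by (unfold k; apply Rdiv_lt_0_compat; lra).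
  assert (Hd : 0 < e / (1 + e) / k).
  { apply Rdiv_lt_0_compat; [apply Rdiv_lt_0_compat; lra|exact Hk]. }
  (* Beyond this radius the factor has modulus at least [1 - e / (1 + e) = 1 / (1 + e)]. *)
  exists (1 - e / (1 + e) / k). split; [lra|].
  intros z [Z1 Z2].
  pose proof (blaschke_factor_boundary a z Ha Z2) as B. fold k in B.
  specialize (Hb z Z2). rewrite (E z Z2), Cmod_mult in Hb.
  assert (X : k * (1 - Cmod z) <= e / (1 + e)).
  { apply Rle_trans with (k * (e / (1 + e) / k)); [apply Rmult_le_compat_l; lra|right; field; lra]. }
  assert (Y : 1 / (1 + e) <= Cmod (blaschke_factor a z)).
  { replace (1 / (1 + e)) with (1 - e / (1 + e)) by (field; lra). lra. }
  pose proof (Cmod_ge_0 (g' z)).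
  assert (1 / (1 + e) * Cmod (g' z) <= 1).
  { eapply Rle_trans; [|exact Hb]. apply Rmult_le_compat_r; assumption. }
  apply Rmult_le_reg_l with (1 / (1 + e)); [apply Rdiv_lt_0_compat; lra|].
  replace (1 / (1 + e) * (1 + e)) with 1 by (field; lra). assumption.
Qed.

(** * Factoring out all zeros *)

(** [None] stands for a step that finds no zero and removes none, so that functions with finitely
    many zeros go through the same infinite recursion. *)
Definition factor_of (o : option C) (z : C) : C :=
  match o with Some w => blaschke_factor w z | None => RtoC 1 end.

Definition defect_of (o : option C) : R :=
  match o with Some w => 1 - Cmod w | None => 0 end.

(* One step of a greedy factorisation: the zero removed is, up to a factor 2, the one
   farthest from the boundary, so that no zero can be overlooked forever. *)
Definition greedy_step (g : C -> C) (p : option C * (C -> C)) : Prop :=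
  schur (snd p) /\ (forall z, unit_disk z -> g z = (factor_of (fst p) z * snd p z)%C) /\
  (forall w, fst p = Some w -> unit_disk w) /\
  (forall w, unit_disk w -> g w = 0 -> 1 - Cmod w <= 2 * defect_of (fst p)).

Lemma greedy_step_exists (g : C -> C) : schur g -> exists p, greedy_step g p.
Proof.
  intros Hg. destruct (classic (exists w, unit_disk w /\ g w = 0)) as [[w0 [W0 G0]]|N].
  - destruct (completeness (fun s => exists w, unit_disk w /\ g w = 0 /\ s = 1 - Cmod w)) as [s [S1 S2]].
    + exists 1. intros s (w & _ & _ & ->). pose proof (Cmod_ge_0 w). lra.
    + exists (1 - Cmod w0). exists w0. auto.
    + assert (Hs : 0 < s).
      { assert (1 - Cmod w0 <= s) by (apply S1; exists w0; auto). unfold unit_disk in W0. lra. }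
      assert (exists a, unit_disk a /\ g a = 0 /\ s / 2 < 1 - Cmod a) as (a & Ha & Ga & La).
      { apply NNPP. intros K. assert (s <= s / 2); [|lra].
        apply S2. intros x (w & Hw & Gw & ->). apply Rnot_lt_le. intros L. apply K. exists w. auto. }
      destruct (schur_division g a Hg Ha Ga) as (g' & Hg' & E).
      exists (Some a, g'). split; [exact Hg'|]. split; [exact E|]. split.
      * intros w K. injection K as <-. exact Ha.
      * intros w Hw Gw. simpl. assert (1 - Cmod w <= s) by (apply S1; exists w; auto). lra.
  - exists (None, g). split; [exact Hg|]. split; [intros; simpl; ring|]. split; [discriminate|].
    intros w Hw Gw. exfalso. apply N. exists w. auto.
Qed.

Lemma greedy_factorization (F : C -> C) : schur F ->
  exists (a : nat -> option C) (G : nat -> C -> C),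
    G 0%nat = F /\ (forall n, schur (G n)) /\ forall n, greedy_step (G n) (a n, G (S n)).
Proof.
  intros HF.
  pose (pick := fun g => epsilon (inhabits (None, F)) (greedy_step g)).
  pose (G := fun n => nat_rect (fun _ => C -> C) F (fun _ g => snd (pick g)) n).
  assert (Hpick : forall g, schur g -> greedy_step g (pick g)).
  { intros g Hg. unfold pick. apply epsilon_spec, greedy_step_exists, Hg. }
  assert (HG : forall n, schur (G n)).
  { induction n as [|n IH]; [exact HF|]. apply (Hpick _ IH). }
  exists (fun n => fst (pick (G n))), G. split; [reflexivity|]. split; [exact HG|].
  intros n. change (G (S n)) with (snd (pick (G n))).
  rewrite <- surjective_pairing. apply Hpick, HG.
Qed.

Lemma C_limit_of_cauchy (u : nat -> C) (T : nat -> R) :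
  is_lim_seq T 0 -> (forall n m, (n <= m)%nat -> Cmod (u m - u n) <= T n) ->
  exists l, forall n, Cmod (l - u n) <= T n.
Proof.
  intros HT Hu.
  assert (HC : forall e : posreal, exists N, forall n m, (N <= n)%nat -> (N <= m)%nat -> Cmod (u n - u m) < e).
  { intros e. assert (He : 0 < e / 2) by (pose proof (cond_pos e); lra).
    destruct (HT _ (locally_ball 0 (mkposreal _ He))) as [N HN].
    exists N. intros n m Hn Hm.
    specialize (HN N (Nat.le_refl _)). change (Rabs (T N - 0) < e / 2) in HN.
    apply Rabs_lt_between in HN.
    pose proof (Hu N n Hn). pose proof (Hu N m Hm).
    replace (u n - u m)%C with ((u n - u N) - (u m - u N))%C by ring.
    eapply Rle_lt_trans; [apply Cmod_triangle_sub|]. lra. }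
  destruct (proj2 (ex_lim_seq_cauchy_corr (fun n => Re (u n)))) as [x Hx].
  { intros e. destruct (HC e) as [N HN]. exists N. intros n m Hn Hm.
    eapply Rle_lt_trans; [apply (re_le_Cmod (u n - u m))|]. apply HN; assumption. }
  destruct (proj2 (ex_lim_seq_cauchy_corr (fun n => Im (u n)))) as [y Hy].
  { intros e. destruct (HC e) as [N HN]. exists N. intros n m Hn Hm.
    eapply Rle_lt_trans; [apply (Cmod_Im_le (u n - u m))|]. apply HN; assumption. }
  exists (x, y). intros n. apply le_epsilon. intros e He.
  assert (He2 : 0 < e / 2) by lra.
  pose proof (Hx _ (locally_ball x (mkposreal _ He2))) as A.
  pose proof (Hy _ (locally_ball y (mkposreal _ He2))) as B.
  unfold filtermap in A, B. destruct A as [N1 HN1], B as [N2 HN2].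
  set (N := (N1 + N2)%nat).
  pose proof (HN1 (N + n)%nat ltac:(lia)) as P. pose proof (HN2 (N + n)%nat ltac:(lia)) as Q.
  change (Rabs (Re (u (N + n)%nat) - x) < e / 2) in P.
  change (Rabs (Im (u (N + n)%nat) - y) < e / 2) in Q.
  pose proof (Hu n (N + n)%nat ltac:(lia)) as D.
  replace ((x, y) - u n)%C with ((u (N + n)%nat - u n) - (u (N + n)%nat - (x, y)))%C by ring.
  eapply Rle_trans; [apply Cmod_triangle_sub|].
  apply Rplus_le_compat; [exact D|].
  change (u (N + n)%nat - (x, y))%C with ((Re (u (N + n)%nat) - x, Im (u (N + n)%nat) - y) : C).
  eapply Rle_trans; [apply Cmod_pair_le|]. lra.
Qed.

Lemma factor_of_le1 (o : option C) (z : C) :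
  (forall w, o = Some w -> unit_disk w) -> unit_disk z -> Cmod (factor_of o z) <= 1.
Proof.
  intros H Hz. destruct o as [w|]; simpl.
  - apply blaschke_factor_le1; auto.
  - rewrite Cmod_1. lra.
Qed.

Lemma blaschke_partial_le1 (a : nat -> option C) (z : C) (n : nat) :
  (forall n w, a n = Some w -> unit_disk w) -> unit_disk z ->
  Cmod (blaschke_partial a z n) <= 1.
Proof.
  intros Ha Hz. induction n as [|n IH]; simpl.
  - rewrite Cmod_1. lra.
  - rewrite Cmod_mult.
    pose proof (factor_of_le1 (a n) z (Ha n) Hz) as B. unfold factor_of in B.
    set (x := Cmod (match a n with Some w => _ | None => _ end)) in *.
    assert (0 <= x) by apply Cmod_ge_0.
    pose proof (Cmod_ge_0 (blaschke_partial a z n)). nra.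
Qed.

Lemma blaschke_partial_upper (a : nat -> option C) (z : C) (n : nat) :
  (forall n w, a n = Some w -> unit_disk w) -> unit_disk z ->
  Cmod (blaschke_partial a z (S n)) <=
  exp (- ((1 - Cmod z ^ 2) / 8 * sum_n (fun k => defect_of (a k)) n)).
Proof.
  intros Ha Hz.
  assert (K : forall k, Cmod (factor_of (a k) z) <= exp (- ((1 - Cmod z ^ 2) / 8 * defect_of (a k)))).
  { intros k. unfold factor_of, defect_of. destruct (a k) as [w|] eqn:E.
    - apply blaschke_factor_upper; [eapply Ha, E|exact Hz].
    - rewrite Rmult_0_r, Ropp_0, exp_0, Cmod_1. lra. }
  assert (E : forall k, blaschke_partial a z (S k) = (blaschke_partial a z k * factor_of (a k) z)%C) by reflexivity.
  induction n as [|n IH].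
  - rewrite E, sum_O. simpl blaschke_partial. rewrite Cmod_mult, Cmod_1, Rmult_1_l. apply K.
  - rewrite E, Cmod_mult, sum_Sn. unfold plus; simpl.
    rewrite Rmult_plus_distr_l, Ropp_plus_distr, exp_plus.
    apply Rmult_le_compat; try apply Cmod_ge_0; [exact IH|apply K].
Qed.

Lemma factor_of_sub1 (o : option C) (z : C) :
  (forall w, o = Some w -> unit_disk w) -> unit_disk z ->
  Cmod (factor_of o z - 1) <= 2 / (1 - Cmod z) * defect_of o.
Proof.
  intros Ho Hz. destruct o as [w|]; simpl.
  - apply blaschke_factor_sub1; auto.
  - replace (1 - 1)%C with (RtoC 0) by ring. rewrite Cmod_0. lra.
Qed.

(** After [n] greedy steps [F] is a finite product times [G n]. Since [F z0 <> 0], the products at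
    [z0] stay away from [0], which bounds the sum of the defects; hence [G n] converges locally
    uniformly to some [g]. The moduli of [G n] increase with [n], so [g] dominates each of them, in
    particular [F = G 0]. *)
Lemma schur_zero_free_factor (F : C -> C) (z0 : C) :
  schur F -> unit_disk z0 -> F z0 <> 0 ->
  exists (a : nat -> option C) (g : C -> C),
    (forall n w, a n = Some w -> unit_disk w) /\
    ex_series (fun n => defect_of (a n)) /\
    holo g /\
    (forall z, unit_disk z -> g z <> 0 /\ Cmod (F z) <= Cmod (g z) <= 1) /\
    (forall z, unit_disk z -> Ctends eventually (fun n => blaschke_partial a z n * g z)%C (F z)).
Proof.
  intros HF Hz0 HF0.
  destruct (greedy_factorization F HF) as (a & G & G0 & HG & Hstep).
  assert (Ha : forall n w, a n = Some w -> unit_disk w) by (intros n; apply (Hstep n)).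
  assert (Hd0 : forall n, 0 <= defect_of (a n)).
  { intros n. unfold defect_of. destruct (a n) as [w|] eqn:E; [|lra].
    pose proof (Ha n w E) as K. unfold unit_disk in K. lra. }
  assert (HB : forall z n, unit_disk z -> F z = (blaschke_partial a z n * G n z)%C).
  { intros z n Hz. induction n as [|n IH].
    - rewrite G0. simpl. ring.
    - rewrite IH. destruct (Hstep n) as (_ & E & _). simpl in E. rewrite (E z Hz).
      unfold factor_of. simpl. ring. }
  set (kap := (1 - Cmod z0 ^ 2) / 8).
  assert (Hkap : 0 < kap) by (unfold kap; pose proof (Cmod_sq_lt1 z0 Hz0); lra).
  assert (PF0 : 0 < Cmod (F z0)) by (apply Cmod_gt_0, HF0).
  (* Because [Cmod (G (S n) z0) <= 1], the partial product at [z0] has modulus at least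
     [Cmod (F z0)], while it is at most [exp (- kap * sum)]. *)
  assert (Hsum : forall n, sum_n (fun k => defect_of (a k)) n <= - ln (Cmod (F z0)) / kap).
  { intros n. apply Rle_div_r; [exact Hkap|].
    pose proof (blaschke_partial_upper a z0 n Ha Hz0) as U. fold kap in U.
    pose proof (HB z0 (S n) Hz0) as E. apply (f_equal Cmod) in E. rewrite Cmod_mult in E.
    pose proof (proj2 (HG (S n)) z0 Hz0) as V.
    pose proof (Cmod_ge_0 (blaschke_partial a z0 (S n))).
    assert (Q : Cmod (F z0) <= exp (- (kap * sum_n (fun k => defect_of (a k)) n))) by nra.
    apply ln_le in Q; [|exact PF0]. rewrite ln_exp in Q. lra. }
  assert (Hser : ex_series (fun n => defect_of (a n))).
  { apply ex_finite_lim_seq_incr with (M := - ln (Cmod (F z0)) / kap).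
    - intros n. rewrite sum_Sn. unfold plus; simpl. specialize (Hd0 (S n)). lra.
    - exact Hsum. }
  (* [sum_n] includes its last index; [Sn n] sums the first [n] terms only, those of the steps that
     lead from [G 0] to [G n]. *)
  pose (Sn := fun n => nat_rect (fun _ => R) 0 (fun k s => s + defect_of (a k)) n).
  assert (ESn : forall n, Sn (S n) = sum_n (fun k => defect_of (a k)) n).
  { induction n as [|n IH].
    - rewrite sum_O. simpl. ring.
    - rewrite sum_Sn, <- IH. reflexivity. }
  destruct Hser as [S0 HS0]. assert (Hser : ex_series (fun n => defect_of (a n))) by (exists S0; exact HS0).
  assert (HSn : is_lim_seq Sn S0).
  { apply is_lim_seq_incr_1. eapply is_lim_seq_ext; [|exact HS0]. intros n. symmetry. apply ESn. }
  assert (Sinc : forall n m, (n <= m)%nat -> Sn n <= Sn m).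
  { intros n m H. induction H as [|m H IH]; [lra|]. specialize (Hd0 m). simpl. lra. }
  assert (SnS0 : forall n, Sn n <= S0).
  { intros n. apply (is_lim_seq_incr_compare Sn S0 HSn). intros k. apply Sinc. lia. }
  assert (HT : forall c : R, is_lim_seq (fun n => c * (S0 - Sn n)) 0).
  { intros c. replace (Finite 0) with (Rbar_mult c (S0 - S0)) by (simpl; f_equal; ring).
    apply is_lim_seq_scal_l. apply is_lim_seq_minus'; [apply is_lim_seq_const|exact HSn]. }
  (* Telescoping: [G m - G (S m)] is [(factor - 1) * G (S m)], and the second factor has modulus at
     most [1]. *)
  assert (HGm : forall z n m, unit_disk z -> (n <= m)%nat ->
     Cmod (G m z - G n z) <= 2 / (1 - Cmod z) * (Sn m - Sn n)).
  { intros z n m Hz H. induction H as [|m H IH].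
    - replace (G n z - G n z)%C with (RtoC 0) by ring. rewrite Cmod_0. lra.
    - destruct (Hstep m) as (_ & E & _). simpl in E.
      replace (G (S m) z - G n z)%C with ((G m z - G n z) - (factor_of (a m) z - 1) * G (S m) z)%C
        by (rewrite (E z Hz); ring).
      eapply Rle_trans; [apply Cmod_triangle_sub|]. rewrite Cmod_mult.
      pose proof (factor_of_sub1 (a m) z (Ha m) Hz). pose proof (proj2 (HG (S m)) z Hz).
      pose proof (Cmod_ge_0 (factor_of (a m) z - 1)). pose proof (Cmod_ge_0 (G (S m) z)).
      simpl. nra. }
  assert (Hlim : forall z, exists l, unit_disk z -> forall n, Cmod (l - G n z) <= 2 / (1 - Cmod z) * (S0 - Sn n)).
  { intros z. destruct (classic (unit_disk z)) as [Hz|Hz]; [|exists 0; tauto].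
    destruct (C_limit_of_cauchy (fun n => G n z) (fun n => 2 / (1 - Cmod z) * (S0 - Sn n))) as [l Hl].
    - apply HT.
    - intros n m H. eapply Rle_trans; [apply HGm; assumption|].
      apply Rmult_le_compat_l; [|specialize (SnS0 m); lra].
      left. apply Rdiv_lt_0_compat; unfold unit_disk in Hz; lra.
    - exists l. auto. }
  destruct (choice _ Hlim) as [g Hg].
  assert (Hgt : forall z, unit_disk z -> Ctends eventually (fun n => G n z) (g z)).
  { intros z Hz e He.
    destruct (HT (2 / (1 - Cmod z)) _ (locally_ball 0 (mkposreal e He))) as [N HN].
    exists N. intros n Hn. specialize (HN n Hn).
    change (Rabs (2 / (1 - Cmod z) * (S0 - Sn n) - 0) < e) in HN.
    apply Rabs_lt_between in HN. rewrite Cmod_sub_sym.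
    eapply Rle_lt_trans; [apply Hg, Hz|]. lra. }
  assert (Ginc : forall z n m, unit_disk z -> (n <= m)%nat -> Cmod (G n z) <= Cmod (G m z)).
  { intros z n m Hz H. induction H as [|m H IH]; [lra|]. eapply Rle_trans; [exact IH|].
    destruct (Hstep m) as (_ & E & _). simpl in E. rewrite (E z Hz), Cmod_mult.
    pose proof (factor_of_le1 (a m) z (Ha m) Hz). pose proof (Cmod_ge_0 (G (S m) z)). nra. }
  assert (Gle : forall z n, unit_disk z -> Cmod (G n z) <= Cmod (g z)).
  { intros z n Hz. apply le_epsilon. intros e He.
    destruct (Hgt z Hz e He) as [N HN]. specialize (HN (N + n)%nat ltac:(lia)).
    pose proof (Ginc z n (N + n)%nat Hz ltac:(lia)).
    pose proof (Cmod_triangle_rev (G (N + n)%nat z) (g z)). lra. }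
  exists a, g. split; [exact Ha|]. split; [exact Hser|]. split; [|split].
  - apply (holo_limit G); [intros n; apply HG|].
    intros r e Hr He.
    destruct (HT (2 / (1 - r)) _ (locally_ball 0 (mkposreal e He))) as [N HN].
    exists N. intros z Hz. specialize (HN N (Nat.le_refl _)).
    change (Rabs (2 / (1 - r) * (S0 - Sn N) - 0) < e) in HN. apply Rabs_lt_between in HN.
    rewrite Cmod_sub_sym. eapply Rle_trans; [apply Hg; unfold unit_disk; lra|].
    apply Rle_trans with (2 / (1 - r) * (S0 - Sn N)); [|lra].
    apply Rmult_le_compat_r; [specialize (SnS0 N); lra|].
    apply Rmult_le_compat_l; [lra|]. apply Rinv_le_contravar; lra.
  - intros z Hz. split; [|split].
    (* The defects tend to [0], so some defect is below [(1 - Cmod z) / 2]. Had [G N] a zero at [z]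
       for that [N], the greedy choice would have removed a zero of defect at least this large. So
       [G N z <> 0], and [g] dominates [G N]. *)
    + assert (Hz' : 0 < (1 - Cmod z) / 2) by (unfold unit_disk in Hz; lra).
      destruct (ex_series_lim_0 _ Hser _ (locally_ball 0 (mkposreal _ Hz'))) as [N HN].
      specialize (HN N (Nat.le_refl _)). change (Rabs (defect_of (a N) - 0) < (1 - Cmod z) / 2) in HN.
      apply Rabs_lt_between in HN.
      apply Cmod_gt_0. apply Rlt_le_trans with (2 := Gle z N Hz). apply Cmod_gt_0.
      intros K. destruct (Hstep N) as (_ & _ & _ & Q). specialize (Q z Hz K). simpl in Q. lra.
    + rewrite <- G0. apply Gle, Hz.
    + apply le_epsilon. intros e He. destruct (Hgt z Hz e He) as [N HN].
      specialize (HN N (Nat.le_refl _)). pose proof (proj2 (HG N) z Hz).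
      pose proof (Cmod_triangle_rev (g z) (G N z)). rewrite Cmod_sub_sym in HN. lra.
  - intros z Hz e He. destruct (Hgt z Hz e He) as [N HN]. exists N. intros n Hn.
    rewrite (HB z n Hz).
    replace (blaschke_partial a z n * g z - blaschke_partial a z n * G n z)%C
      with (blaschke_partial a z n * (g z - G n z))%C by ring.
    rewrite Cmod_mult, Cmod_sub_sym. specialize (HN n Hn).
    pose proof (blaschke_partial_le1 a z n Ha Hz).
    pose proof (Cmod_ge_0 (blaschke_partial a z n)). pose proof (Cmod_ge_0 (G n z - g z)). nra.
Qed.

(** * Second-order expansions and the lower Laplacian *)

Lemma Rbar_lub_spec (E : Rbar -> Prop) : Rbar_is_lub E (Rbar_lub E).
Proof. apply (proj2_sig (Rbar_ex_lub E)). Qed.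

Lemma Rbar_glb_spec (E : Rbar -> Prop) : Rbar_is_glb E (Rbar_glb E).
Proof. apply (proj2_sig (Rbar_ex_glb E)). Qed.

Lemma liminf_along_ge {T} (Fl : (T -> Prop) -> Prop) (f : T -> R) (L : R) :
  (forall e, 0 < e -> Fl (fun t => L - e <= f t)) -> Rbar_le L (liminf_along Fl f).
Proof.
  intros H. unfold liminf_along.
  set (E := fun y : Rbar => exists P, Fl P /\ y = Glb_Rbar (image_on f P)).
  destruct (Rbar_lub_spec E) as [U _].
  assert (K : forall e, 0 < e -> Rbar_le (L - e) (Rbar_lub E)).
  { intros e He. eapply Rbar_le_trans; [|apply U; exists (fun t => L - e <= f t); split; [apply H, He|reflexivity]].
    apply (Glb_Rbar_correct (image_on f (fun t => L - e <= f t))).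
    intros x (t & Ht & ->). exact Ht. }
  destruct (Rbar_lub E) as [x| |]; simpl in *.
  - apply le_epsilon. intros e He. specialize (K e He). lra.
  - exact I.
  - apply (K 1). lra.
Qed.

Lemma liminf_along_le {T} (Fl : (T -> Prop) -> Prop) {FF : ProperFilter Fl} (f : T -> R) (L : R) :
  (forall e, 0 < e -> Fl (fun t => f t <= L + e)) -> Rbar_le (liminf_along Fl f) L.
Proof.
  intros H. unfold liminf_along.
  set (E := fun y : Rbar => exists P, Fl P /\ y = Glb_Rbar (image_on f P)).
  destruct (Rbar_lub_spec E) as [_ U].
  assert (K : forall e, 0 < e -> Rbar_le (Rbar_lub E) (L + e)).
  { intros e He. apply U. intros y (P & HP & ->).
    pose proof (filter_and _ _ HP (H e He)) as K. apply filter_ex in K. destruct K as (t & Pt & Ft).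
    apply (Rbar_le_trans _ (f t)); [|exact Ft].
    destruct (Glb_Rbar_correct (image_on f P)) as [G _]. apply G. exists t. auto. }
  destruct (Rbar_lub E) as [x| |]; simpl in *.
  - apply le_epsilon. intros e He. exact (K e He).
  - apply (K 1). lra.
  - exact I.
Qed.

(** The real parts of [al w] and [be w^2] have mean zero over the circle and the square of
    [Re (ga w)] has mean [r^2 |ga|^2 / 2]; an explicit antiderivative [A] verifies this. *)
Lemma is_RInt_circle_quadratic (al be ga : C) (k c r : R) :
  is_RInt (fun t => Re (al * circ r t + be * (circ r t * circ r t)) + k * Re (ga * circ r t) ^ 2 + c)
    0 (2 * PI) (2 * PI * (k * r ^ 2 * Cmod ga ^ 2 / 2 + c)).
Proof.
  destruct al as [a b], be as [c1 d], ga as [p s].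
  rewrite Cmod2_alt. unfold circ. simpl Re. simpl Im.
  set (A := fun t => r * (a * sin t + b * cos t) + r ^ 2 * (c1 * (sin t * cos t) - d * sin t ^ 2)
     + k * r ^ 2 * (p ^ 2 * (t + sin t * cos t) / 2 + s ^ 2 * (t - sin t * cos t) / 2 - p * s * sin t ^ 2) + c * t).
  replace (2 * PI * (k * r ^ 2 * (p ^ 2 + s ^ 2) / 2 + c)) with (minus (A (2 * PI)) (A 0)).
  2:{ unfold A, minus, plus, opp; simpl. rewrite sin_2PI, cos_2PI, sin_0, cos_0. field. }
  apply (is_RInt_derive A).
  - intros t _. unfold A. auto_derive; [trivial|].
    pose proof (sin2_cos2 t) as Q. unfold Rsqr in Q.
    set (C0 := cos t) in *. set (S0 := sin t) in *.
    (* The two sides agree only modulo [sin^2 + cos^2 = 1]; the added multiple of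
       [1 - (S0 * S0 + C0 * C0)] makes them equal as rational expressions. *)
    match goal with |- _ = ?T =>
      transitivity (T + k * r ^ 2 * (p ^ 2 + s ^ 2) / 2 * (1 - (S0 * S0 + C0 * C0))) end;
      [field|rewrite Q; ring].
  - intros t _. apply (ex_derive_continuous (K := R_AbsRing) (V := R_NormedModule)). auto_derive. trivial.
Qed.

Lemma circle_point_dist z r t : 0 <= r -> Cmod (circle_point z r t - z) = r.
Proof.
  intros Hr. unfold circle_point.
  change (r * cos t, r * sin t) with (circ r t). replace (z + circ r t - z)%C with (circ r t) by ring.
  apply Cmod_circ, Hr.
Qed.

Lemma at_right_interval (P : R -> Prop) (d : R) :
  0 < d -> (forall r, 0 < r < d -> P r) -> at_right 0 P.
Proof.
  intros Hd H. exists (mkposreal d Hd). intros r Hr Hr0. apply H.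
  change (Rabs (r - 0) < d) in Hr. apply Rabs_lt_between in Hr. lra.
Qed.

Lemma circle_mean_exists (v : C -> R) (z : C) (d r : R) :
  (forall w, Cmod (w - z) < d -> continuous v w) -> 0 < r < d ->
  ex_RInt (fun t => v (circle_point z r t)) 0 (2 * PI).
Proof.
  intros Hv Hr. apply (ex_RInt_continuous (V := R_CompleteNormedModule)). intros t _.
  apply (continuous_comp (fun t => circle_point z r t) v).
  - apply (Ctends_filterlim (locally t)). unfold circle_point.
    apply Ctends_plus; [apply locally_filter|apply Ctends_const, locally_filter|apply (Ctends_circ r t)].
  - apply Hv. rewrite circle_point_dist; lra.
Qed.

(** A one-sided second-order expansion suffices: its mean over small circles exceeds [v z] by
    [k r^2 |ga|^2 / 2] up to an error [o(r^2)], and the factor [4 / r^2] turns this into the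
    bound. *)
Lemma lower_laplacian_ge (v : C -> R) (z al be ga : C) (k : R) :
  locally z (fun w => continuous v w) ->
  (forall e, 0 < e -> locally z (fun w =>
     Re (al * (w - z) + be * ((w - z) * (w - z))) + k * Re (ga * (w - z)) ^ 2 - e * Cmod (w - z) ^ 2
       <= v w - v z)) ->
  Rbar_le (2 * k * Cmod ga ^ 2) (lower_laplacian v z).
Proof.
  intros Hc H. apply liminf_along_ge. intros e He.
  assert (He4 : 0 < e / 4) by lra.
  destruct (proj1 (locally_Cmod _ _) (filter_and _ _ Hc (H _ He4))) as [d [Hd K]].
  apply at_right_interval with d; [exact Hd|]. intros r Hr. pose proof PI_RGT_0 as HPI.
  destruct (circle_mean_exists v z d r) as [I HI]; [intros w Hw; apply K, Hw|lra|].
  rewrite (is_RInt_unique _ _ _ _ HI).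
  pose proof (is_RInt_circle_quadratic al be ga k (v z - e / 4 * r ^ 2) r) as Q.
  assert (L : 2 * PI * (k * r ^ 2 * Cmod ga ^ 2 / 2 + (v z - e / 4 * r ^ 2)) <= I).
  { apply (is_RInt_le _ _ 0 (2 * PI) _ _ ltac:(lra) Q HI). intros t _.
    assert (D : Cmod (circle_point z r t - z) = r) by (apply circle_point_dist; lra).
    destruct (K (circle_point z r t) ltac:(lra)) as [_ K2]. rewrite D in K2.
    replace (circle_point z r t - z)%C with (circ r t) in K2 by (unfold circle_point; change (r * cos t, r * sin t) with (circ r t); ring). lra. }
  assert (R2 : 0 < r ^ 2) by (apply pow_lt; lra).
  replace (2 * k * Cmod ga ^ 2 - e)
    with (4 / r ^ 2 * (1 / (2 * PI) * (2 * PI * (k * r ^ 2 * Cmod ga ^ 2 / 2 + (v z - e / 4 * r ^ 2))) - v z))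
    by (field; lra).
  apply Rmult_le_compat_l; [left; apply Rdiv_lt_0_compat; lra|].
  apply Rplus_le_compat_r. apply Rmult_le_compat_l; [left; apply Rdiv_lt_0_compat; lra|exact L].
Qed.

Lemma lower_laplacian_le_0 (v : C -> R) (z al be : C) :
  locally z (fun w => continuous v w) ->
  (forall e, 0 < e -> locally z (fun w =>
     v w - v z <= Re (al * (w - z) + be * ((w - z) * (w - z))) + e * Cmod (w - z) ^ 2)) ->
  Rbar_le (lower_laplacian v z) 0.
Proof.
  intros Hc H. apply (liminf_along_le (at_right 0)). intros e He.
  assert (He4 : 0 < e / 4) by lra.
  destruct (proj1 (locally_Cmod _ _) (filter_and _ _ Hc (H _ He4))) as [d [Hd K]].
  apply at_right_interval with d; [exact Hd|]. intros r Hr. pose proof PI_RGT_0 as HPI.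
  destruct (circle_mean_exists v z d r) as [I HI]; [intros w Hw; apply K, Hw|lra|].
  rewrite (is_RInt_unique _ _ _ _ HI).
  pose proof (is_RInt_circle_quadratic al be 0 0 (v z + e / 4 * r ^ 2) r) as Q.
  assert (L : I <= 2 * PI * (0 * r ^ 2 * Cmod 0 ^ 2 / 2 + (v z + e / 4 * r ^ 2))).
  { apply (is_RInt_le _ _ 0 (2 * PI) _ _ ltac:(lra) HI Q). intros t _.
    assert (D : Cmod (circle_point z r t - z) = r) by (apply circle_point_dist; lra).
    destruct (K (circle_point z r t) ltac:(lra)) as [_ K2]. rewrite D in K2.
    replace (circle_point z r t - z)%C with (circ r t) in K2 by (unfold circle_point; change (r * cos t, r * sin t) with (circ r t); ring). lra. }
  assert (R2 : 0 < r ^ 2) by (apply pow_lt; lra).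
  replace (0 + e)
    with (4 / r ^ 2 * (1 / (2 * PI) * (2 * PI * (0 * r ^ 2 * Cmod 0 ^ 2 / 2 + (v z + e / 4 * r ^ 2))) - v z))
    by (field; lra).
  apply Rmult_le_compat_l; [left; apply Rdiv_lt_0_compat; lra|].
  apply Rplus_le_compat_r. apply Rmult_le_compat_l; [left; apply Rdiv_lt_0_compat; lra|exact L].
Qed.

(* [v] agrees to second order at [z] with the real part of a quadratic polynomial with linear
   coefficient [al]; the circle means of that polynomial about [z] all equal its value at [z]. *)
Definition hjet (v : C -> R) (z al : C) : Prop :=
  exists be : C, forall e, 0 < e -> locally z (fun w =>
    Rabs (v w - v z - Re (al * (w - z) + be * ((w - z) * (w - z)))) <= e * Cmod (w - z) ^ 2).

Lemma hjet_plus u v z al be : hjet u z al -> hjet v z be -> hjet (fun w => u w + v w) z (al + be)%C.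
Proof.
  intros [b1 H1] [b2 H2]. exists (b1 + b2)%C. intros e He.
  generalize (filter_and _ _ (H1 _ (half_pos e He)) (H2 _ (half_pos e He))). apply filter_imp.
  intros w [A B].
  replace (u w + v w - (u z + v z) - Re ((al + be) * (w - z) + (b1 + b2) * ((w - z) * (w - z))))
   with ((u w - u z - Re (al * (w - z) + b1 * ((w - z) * (w - z))))
      + (v w - v z - Re (be * (w - z) + b2 * ((w - z) * (w - z))))) by (simpl; ring).
  eapply Rle_trans; [apply Rabs_triang|]. lra.
Qed.

Lemma hjet_scal k v z al : hjet v z al -> hjet (fun w => k * v w) z (RtoC k * al)%C.
Proof.
  intros [b H]. exists (RtoC k * b)%C. intros e He.
  pose proof (Rabs_pos k).
  assert (Hd : 0 < e / (Rabs k + 1)) by (apply Rdiv_lt_0_compat; lra).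
  generalize (H _ Hd). apply filter_imp. intros w A.
  replace (k * v w - k * v z - Re (k * al * (w - z) + k * b * ((w - z) * (w - z))))
   with (k * (v w - v z - Re (al * (w - z) + b * ((w - z) * (w - z))))) by (simpl; ring).
  rewrite Rabs_mult. pose proof (pow2_ge_0 (Cmod (w - z))).
  apply Rle_trans with (Rabs k * (e / (Rabs k + 1) * Cmod (w - z) ^ 2)).
  - apply Rmult_le_compat_l; assumption.
  - apply Rle_trans with ((Rabs k + 1) * (e / (Rabs k + 1) * Cmod (w - z) ^ 2)).
    + apply Rmult_le_compat_r; [|lra]. apply Rmult_le_pos; lra.
    + right. field. lra.
Qed.

(** * Second-order expansion of the logarithm of the modulus of an analytic function *)

Lemma ln_taylor2 (t : R) : Rabs t <= 1/2 -> Rabs (ln (1 + t) - t + t ^ 2 / 2) <= 2 * Rabs t ^ 3.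
Proof.
  intros Ht.
  destruct (MVT_gen (fun s => ln (1 + s) - s + s ^ 2 / 2) 0 t (fun s => s ^ 2 / (1 + s))) as (c & Hc & E).
  - intros s Hs. assert (Rabs s <= 1/2).
    { apply Rabs_le_between in Ht. apply Rabs_le. unfold Rmin, Rmax in Hs. destruct (Rle_dec 0 t); lra. }
    apply Rabs_le_between in H. auto_derive; [lra|]. field. lra.
  - intros s Hs. assert (Rabs s <= 1/2).
    { apply Rabs_le_between in Ht. apply Rabs_le. unfold Rmin, Rmax in Hs. destruct (Rle_dec 0 t); lra. }
    apply Rabs_le_between in H. apply derivable_continuous_pt.
    exists (s ^ 2 / (1 + s)). apply is_derive_Reals. auto_derive; [lra|]. field. lra.
  - rewrite Rplus_0_r, ln_1 in E.
    replace (ln (1 + t) - t + t ^ 2 / 2) with (c ^ 2 / (1 + c) * (t - 0)) by (rewrite <- E; simpl; field).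
    rewrite Rminus_0_r, Rabs_mult.
    assert (Hct : Rabs c <= Rabs t).
    { unfold Rmin, Rmax in Hc. unfold Rabs. destruct (Rle_dec 0 t), (Rcase_abs c), (Rcase_abs t); lra. }
    assert (Hc2 : Rabs (c ^ 2 / (1 + c)) <= 2 * Rabs t ^ 2).
    { assert (Rabs c <= 1/2) by lra. apply Rabs_le_between in H.
      rewrite Rabs_right.
      - apply Rle_div_l; [lra|]. rewrite <- (pow2_abs c). pose proof (Rabs_pos c). pose proof (Rabs_pos t). nra.
      - apply Rle_ge. apply Rmult_le_pos; [apply pow2_ge_0|]. left. apply Rinv_0_lt_compat. lra. }
    pose proof (Rabs_pos t). nra.
Qed.

(** Reduction to the real logarithm: [|1 + w|^2 = 1 + t] with [t = 2 Re w + |w|^2], so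
    [|t| <= 3 |w| <= 1/2]. The real remainder gives [27 |w|^3] and the terms of order three and four
    in [t - t^2 / 2] another [2 |w|^3]. *)
Lemma ln_Cmod_taylor2 (w : C) : Cmod w <= 1/6 ->
  Rabs (ln (Cmod (1 + w)) - Re (w - w * w / 2)) <= 29 * Cmod w ^ 3.
Proof.
  intros Hw. pose proof (Cmod_ge_0 w) as P.
  set (t := 2 * Re w + Cmod w ^ 2).
  assert (HR : Rabs (Re w) <= Cmod w) by apply re_le_Cmod.
  assert (Ht : Rabs t <= 3 * Cmod w).
  { unfold t. eapply Rle_trans; [apply Rabs_triang|]. rewrite Rabs_mult, (Rabs_right 2) by lra.
    rewrite (Rabs_right (Cmod w ^ 2)) by (apply Rle_ge, pow2_ge_0). nra. }
  assert (E : Cmod (1 + w) ^ 2 = 1 + t).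
  { unfold t. rewrite !Cmod2_alt. destruct w; simpl. ring. }
  assert (Pt : 0 < 1 + t) by (apply Rabs_le_between in Ht; lra).
  assert (P1 : 0 < Cmod (1 + w)).
  { destruct (Rle_lt_or_eq_dec 0 _ (Cmod_ge_0 (1 + w))) as [L|L]; [exact L|].
    rewrite <- L in E. lra. }
  assert (EL : ln (Cmod (1 + w)) = / 2 * ln (1 + t)).
  { rewrite <- E. replace (Cmod (1 + w) ^ 2) with (Cmod (1 + w) * Cmod (1 + w)) by ring.
    rewrite ln_mult by assumption. field. }
  pose proof (ln_taylor2 t ltac:(lra)) as L.
  assert (T3 : Rabs t ^ 3 <= 27 * Cmod w ^ 3).
  { replace (27 * Cmod w ^ 3) with ((3 * Cmod w) ^ 3) by ring. apply pow_incr. split; [apply Rabs_pos|exact Ht]. }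
  assert (M : / 2 * (t - t ^ 2 / 2) - Re (w - w * w / 2) = - (Re w * Cmod w ^ 2) - Cmod w ^ 4 / 4).
  { unfold t. replace (Cmod w ^ 4) with (Cmod w ^ 2 * Cmod w ^ 2) by ring.
    rewrite Cmod2_alt. destruct w; simpl. field. }
  rewrite EL.
  replace (/ 2 * ln (1 + t) - Re (w - w * w / 2))
    with (/ 2 * (ln (1 + t) - t + t ^ 2 / 2) + (- (Re w * Cmod w ^ 2) - Cmod w ^ 4 / 4)) by (rewrite <- M; field).
  assert (B2 : Rabs (- (Re w * Cmod w ^ 2) - Cmod w ^ 4 / 4) <= 2 * Cmod w ^ 3).
  { assert (0 <= Cmod w ^ 2) by apply pow2_ge_0.
    assert (0 <= Cmod w ^ 3) by (apply pow_le, P).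
    apply Rabs_le_between in HR.
    replace (Cmod w ^ 4) with (Cmod w * Cmod w ^ 3) by ring.
    assert (Cmod w * Cmod w ^ 3 <= Cmod w ^ 3) by nra.
    assert (0 <= Cmod w * Cmod w ^ 3) by nra.
    replace (Cmod w ^ 3) with (Cmod w * Cmod w ^ 2) in * by ring.
    apply Rabs_le. nra. }
  eapply Rle_trans; [apply Rabs_triang|]. rewrite Rabs_mult, (Rabs_right (/ 2)) by lra. lra.
Qed.

(** No branch of the complex logarithm is chosen. Dividing twice by [w - z] gives
    [f w = f z * (1 + W)] with [W = c1 h + P h^2], where [h = w - z] and [P] tends to [c2]; then
    [ln |1 + W|] is expanded. The coefficient [c2 - c1^2 / 2] is the second Taylor coefficient of
    [log f]. *)
Lemma hjet_ln_Cmod (f : C -> C) (z : C) : holo f -> unit_disk z -> f z <> 0 ->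
  hjet (fun w => ln (Cmod (f w))) z (C_derive f z / f z)%C.
Proof.
  intros Hf Hz Hfz.
  destruct (holo_division f z Hf Hz) as (q & Hq & Eq' & Ef).
  destruct (holo_division q z Hq Hz) as (p & Hp & _ & Ep).
  set (c1 := (C_derive f z / f z)%C). set (c2 := (p z / f z)%C).
  exists (c2 - c1 * c1 / 2)%C. intros e He.
  set (k := Cmod c1 + Cmod c2 + 1).
  pose proof (Cmod_ge_0 c1) as P1. pose proof (Cmod_ge_0 c2) as P2.
  assert (Hk : 1 <= k) by (unfold k; lra).
  set (d := Rmin (1 / (6 * k)) (Rmin 1 (e / (4 * (29 * k ^ 3 + k ^ 2))))).
  assert (K2 : 1 <= k ^ 2) by (apply pow_R1_Rle, Hk). assert (K3 : 1 <= k ^ 3) by (apply pow_R1_Rle, Hk).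
  assert (Hd : 0 < d) by (unfold d; repeat apply Rmin_pos; try apply Rdiv_lt_0_compat; lra).
  assert (D1 : d <= 1 / (6 * k)) by apply Rmin_l.
  assert (D23 : d <= Rmin 1 (e / (4 * (29 * k ^ 3 + k ^ 2)))) by apply Rmin_r.
  assert (D2 : d <= 1) by (eapply Rle_trans; [exact D23|apply Rmin_l]).
  assert (D3 : d <= e / (4 * (29 * k ^ 3 + k ^ 2))) by (eapply Rle_trans; [exact D23|apply Rmin_r]).
  assert (HP : Ctends (locally z) (fun w => p w / f z)%C c2).
  { apply Ctends_mult; [apply locally_filter|apply (holo_cont p z Hp Hz)|apply Ctends_const, locally_filter]. }
  assert (He' : 0 < Rmin 1 (e / 2)) by (apply Rmin_pos; lra).
  generalize (filter_and _ _ (HP _ He') (locally_CmodI z d Hd)). apply filter_imp.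
  intros w [A B]. set (h := (w - z)%C) in *. set (P := (p w / f z)%C) in *.
  assert (A1 : Cmod (P - c2) < 1) by (eapply Rlt_le_trans; [exact A|apply Rmin_l]).
  assert (A2 : Cmod (P - c2) < e / 2) by (eapply Rlt_le_trans; [exact A|apply Rmin_r]).
  pose proof (Cmod_ge_0 h) as Ph.
  assert (PP : Cmod P <= Cmod c2 + 1) by (pose proof (Cmod_triangle_rev P c2); lra).
  pose proof (Cmod_ge_0 P) as PP0.
  set (W := (c1 * h + P * (h * h))%C).
  assert (EW : f w = (f z * (1 + W))%C).
  { rewrite (Ef w), (Ep w), Eq'. unfold W, P, c1, h. field. exact Hfz. }
  assert (HW : Cmod W <= k * Cmod h).
  { unfold W. eapply Rle_trans; [apply Cmod_triangle|]. rewrite !Cmod_mult. unfold k.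
    assert (Cmod P * (Cmod h * Cmod h) <= (Cmod c2 + 1) * Cmod h).
    { apply Rmult_le_compat; try assumption; nra. } lra. }
  assert (HkH : k * Cmod h <= 1 / 6).
  { apply Rle_trans with (k * (1 / (6 * k))); [apply Rmult_le_compat_l; lra|right; field; lra]. }
  pose proof (ln_Cmod_taylor2 W ltac:(lra)) as L.
  assert (Pfz : 0 < Cmod (f z)) by (apply Cmod_gt_0, Hfz).
  assert (PW : 0 < Cmod (1 + W)).
  { pose proof (Cmod_triangle_rev 1 (- W)). rewrite Cmod_opp, Cmod_1 in H.
    replace (1 - - W)%C with (1 + W)%C in H by ring. lra. }
  rewrite EW, Cmod_mult, ln_mult by assumption.
  replace (ln (Cmod (f z)) + ln (Cmod (1 + W)) - ln (Cmod (f z)) -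
      Re (c1 * h + (c2 - c1 * c1 / 2) * (h * h)))
    with ((ln (Cmod (1 + W)) - Re (W - W * W / 2)) +
      Re ((P - c2) * (h * h) - (c1 * P * (h * h * h) + P * P * (h * h * (h * h)) / 2))).
  2:{ assert (X : Re (W - W * W / 2) = Re (c1 * h + (c2 - c1 * c1 / 2) * (h * h)) +
        Re ((P - c2) * (h * h) - (c1 * P * (h * h * h) + P * P * (h * h * (h * h)) / 2))).
      { change (Re (c1 * h + (c2 - c1 * c1 / 2) * (h * h)) +
        Re ((P - c2) * (h * h) - (c1 * P * (h * h * h) + P * P * (h * h * (h * h)) / 2)))
         with (Re ((c1 * h + (c2 - c1 * c1 / 2) * (h * h)) +
        ((P - c2) * (h * h) - (c1 * P * (h * h * h) + P * P * (h * h * (h * h)) / 2)))).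
        f_equal. unfold W. field. }
      lra. }
  eapply Rle_trans; [apply Rabs_triang|].
  assert (T1 : Rabs (ln (Cmod (1 + W)) - Re (W - W * W / 2)) <= 29 * k ^ 3 * d * Cmod h ^ 2).
  { eapply Rle_trans; [exact L|].
    apply Rle_trans with (29 * (k * Cmod h) ^ 3).
    - apply Rmult_le_compat_l; [lra|]. apply pow_incr. split; [apply Cmod_ge_0|exact HW].
    - replace (29 * (k * Cmod h) ^ 3) with (29 * k ^ 3 * (Cmod h * Cmod h ^ 2)) by ring.
      replace (29 * k ^ 3 * d * Cmod h ^ 2) with (29 * k ^ 3 * (d * Cmod h ^ 2)) by ring.
      apply Rmult_le_compat_l; [lra|]. apply Rmult_le_compat_r; [apply pow2_ge_0|lra]. }
  assert (T2 : Rabs (Re ((P - c2) * (h * h) - (c1 * P * (h * h * h) + P * P * (h * h * (h * h)) / 2)))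
     <= e / 2 * Cmod h ^ 2 + 2 * k ^ 2 * d * Cmod h ^ 2).
  { eapply Rle_trans; [apply re_le_Cmod|]. eapply Rle_trans; [apply Cmod_triangle_sub|].
    apply Rplus_le_compat.
    - rewrite !Cmod_mult. replace (Cmod h ^ 2) with (Cmod h * Cmod h) by ring.
      apply Rmult_le_compat_r; [nra|lra].
    - eapply Rle_trans; [apply Cmod_triangle|].
      rewrite Cmod_div by (intros Z; apply RtoC_inj in Z; lra).
      rewrite !Cmod_mult, Cmod_R, Rabs_right by lra.
      assert (Q1 : Cmod c1 * Cmod P <= k ^ 2).
      { replace (k ^ 2) with (k * k) by ring. apply Rmult_le_compat; unfold k; lra. }
      assert (Q2 : Cmod P * Cmod P <= k ^ 2).
      { replace (k ^ 2) with (k * k) by ring. apply Rmult_le_compat; unfold k; lra. }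
      assert (H3 : Cmod h * Cmod h * Cmod h <= d * Cmod h ^ 2) by nra.
      assert (H4 : Cmod h * Cmod h * (Cmod h * Cmod h) <= d * Cmod h ^ 2) by nra.
      assert (0 <= Cmod h * Cmod h * Cmod h) by (apply Rmult_le_pos; nra).
      assert (0 <= Cmod h * Cmod h * (Cmod h * Cmod h)) by (apply Rmult_le_pos; nra).
      assert (Cmod c1 * Cmod P * (Cmod h * Cmod h * Cmod h) <= k ^ 2 * (d * Cmod h ^ 2))
        by (apply Rmult_le_compat; try assumption; nra).
      assert (Cmod P * Cmod P * (Cmod h * Cmod h * (Cmod h * Cmod h)) <= k ^ 2 * (d * Cmod h ^ 2))
        by (apply Rmult_le_compat; try assumption; nra).
      assert (0 <= k ^ 2 * (d * Cmod h ^ 2)) by (apply Rmult_le_pos; [lra|]; apply Rmult_le_pos; [lra|apply pow2_ge_0]).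
      lra. }
  assert (T3 : 2 * (29 * k ^ 3 + k ^ 2) * d <= e / 2).
  { apply Rle_trans with (2 * (29 * k ^ 3 + k ^ 2) * (e / (4 * (29 * k ^ 3 + k ^ 2)))).
    - apply Rmult_le_compat_l; lra.
    - right. field. lra. }
  assert (H2 : 0 <= Cmod h ^ 2) by apply pow2_ge_0.
  assert (0 <= k ^ 3 * d) by (apply Rmult_le_pos; lra).
  assert ((29 * k ^ 3 * d + 2 * k ^ 2 * d) * Cmod h ^ 2 <= e / 2 * Cmod h ^ 2).
  { apply Rmult_le_compat_r; [exact H2|]. lra. }
  lra.
Qed.

(** * Compactness of closed discs *)

(** Compactness in the form: a property of sets that passes to subsets and to finite unions and
    holds locally holds for the whole closed disc. Bisection of a square around the disc replaces
    finite subcovers. *)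
Lemma disc_compact (Q : (C -> Prop) -> Prop) (z0 : C) (rho : R) :
  0 < rho ->
  (forall A B, Q A -> Q B -> Q (fun w => A w \/ B w)) ->
  (forall A B : C -> Prop, (forall w, A w -> B w) -> Q B -> Q A) ->
  (forall p, Cmod (p - z0) <= rho -> exists N, locally p N /\ Q (fun w => N w /\ Cmod (w - z0) <= rho)) ->
  Q (fun w => Cmod (w - z0) <= rho).
Proof.
  intros Hrho HU HS HN. destruct z0 as [x0 y0]. set (z0 := (x0, y0) : C) in *.
  pose (P := fun x y w => Q (fun q => (x <= Re q <= x + w * 1 /\ y <= Im q <= y + w * 1) /\ Cmod (q - z0) <= rho)).
  assert (K : P (x0 - rho) (y0 - rho) (2 * rho)).
  - apply (rectangle_bisection 1 1 Rlt_0_1 Rlt_0_1 P); [lra| |].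
    + intros x y w Hw P1 P2 P3 P4. unfold P in *.
      eapply HS; [|apply HU; [apply HU; [exact P1|exact P2]|apply HU; [exact P3|exact P4]]].
      intros q [[A B] D]. cbv beta.
      destruct (Rle_dec (Re q) (x + w / 2)), (Rle_dec (Im q) (y + w / 2)).
      * left; left. split; [lra|exact D].
      * right; left. split; [lra|exact D].
      * left; right. split; [lra|exact D].
      * right; right. split; [lra|exact D].
    + intros p q _ _.
      assert (H : exists N, locally ((p, q) : C) N /\ Q (fun w => N w /\ Cmod (w - z0) <= rho)).
      { destruct (Rle_dec (Cmod ((p, q) - z0)) rho) as [L|L]; [apply HN, L|].
        (* A point outside the disc has a neighbourhood that misses it. [Q] then has to hold for the
           empty set, which is a subset of the set that the hypothesis supplies at the centre. *)
        destruct (HN z0) as (N & _ & QN).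
        { rewrite Cmod_sub_diag. lra. }
        exists (fun w => Cmod (w - (p, q)) < Cmod ((p, q) - z0) - rho). split.
        - apply locally_CmodI. lra.
        - eapply HS; [|exact QN]. intros w [A B]. exfalso.
          replace ((p, q) - z0)%C with ((w - z0) - (w - (p, q)))%C in A by ring.
          pose proof (Cmod_triangle_sub (w - z0) (w - (p, q))). lra. }
      destruct H as (N & LN & QN). apply locally_Cmod in LN. destruct LN as [d [Hd LN]].
      exists (d / 2). split; [lra|]. intros x y w Hw Hx Hy.
      unfold P. eapply HS; [|exact QN]. intros u [[A B] D]. split; [|exact D].
      apply LN. destruct u as [u v]. simpl in A, B.
      change ((u, v) - (p, q))%C with ((u - p, v - q) : C).
      eapply Rle_lt_trans; [apply Cmod_pair_le|].
      assert (Rabs (u - p) <= w) by (apply Rabs_le; lra).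
      assert (Rabs (v - q) <= w) by (apply Rabs_le; lra). lra.
  - unfold P in K. eapply HS; [|exact K]. intros w Hw. split; [|exact Hw].
    pose proof (re_le_Cmod (w - z0)) as A. pose proof (Cmod_Im_le (w - z0)) as B.
    assert (Rabs (Re w - x0) <= rho) by (eapply Rle_trans; [exact A|exact Hw]).
    assert (Rabs (Im w - y0) <= rho) by (eapply Rle_trans; [exact B|exact Hw]).
    apply Rabs_le_between in H, H0. lra.
Qed.

(** Compactness is used twice: for boundedness above and, if the supremum [M] were not attained, for
    a uniform gap below [M]. *)
Lemma usc_attains_max (V : C -> R) (z0 : C) (rho : R) :
  0 < rho ->
  (forall p, Cmod (p - z0) <= rho -> forall e, 0 < e ->
     locally p (fun w => Cmod (w - z0) <= rho -> V w < V p + e)) ->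
  exists p, Cmod (p - z0) <= rho /\ forall w, Cmod (w - z0) <= rho -> V w <= V p.
Proof.
  intros Hrho HV.
  assert (HB : exists B, forall w, Cmod (w - z0) <= rho -> V w <= B).
  { apply (disc_compact (fun A => exists B, forall w, A w -> V w <= B) z0 rho Hrho).
    - intros A B [b1 H1] [b2 H2]. exists (Rmax b1 b2). intros w [H|H].
      + eapply Rle_trans; [apply H1, H|apply Rmax_l].
      + eapply Rle_trans; [apply H2, H|apply Rmax_r].
    - intros A B H [b Hb]. exists b. auto.
    - intros p Hp. eexists. split; [apply (HV p Hp 1 Rlt_0_1)|].
      exists (V p + 1). intros w [H1 H2]. left. auto. }
  destruct HB as [B HB].
  assert (Hz0 : Cmod (z0 - z0) <= rho).
  { rewrite Cmod_sub_diag. lra. }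
  destruct (completeness (fun s => exists w, Cmod (w - z0) <= rho /\ s = V w)) as [M [M1 M2]].
  { exists B. intros s (w & Hw & ->). apply HB, Hw. }
  { exists (V z0), z0. auto. }
  apply NNPP. intros HN.
  assert (HD : exists d, 0 < d /\ forall w, Cmod (w - z0) <= rho -> V w <= M - d).
  { apply (disc_compact (fun A => exists d, 0 < d /\ forall w, A w -> V w <= M - d) z0 rho Hrho).
    - intros A A' [b1 [P1 H1]] [b2 [P2 H2]]. exists (Rmin b1 b2). split; [apply Rmin_pos; assumption|].
      pose proof (Rmin_l b1 b2). pose proof (Rmin_r b1 b2).
      intros w [H3|H3]; [specialize (H1 w H3); lra|specialize (H2 w H3); lra].
    - intros A A' H [b [Pb Hb]]. exists b. auto.
    - intros p Hp.
      assert (Lp : V p < M).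
      { apply Rnot_le_lt. intros L. apply HN. exists p. split; [exact Hp|].
        intros w Hw. eapply Rle_trans; [|exact L]. apply M1. exists w. auto. }
      assert (He : 0 < (M - V p) / 2) by lra.
      eexists. split; [apply (HV p Hp _ He)|].
      exists ((M - V p) / 2). split; [exact He|]. intros w [H1 H2]. specialize (H1 H2). lra. }
  destruct HD as [d [Hd HD]].
  assert (M <= M - d); [|lra]. apply M2. intros s (w & Hw & ->). apply HD, Hw.
Qed.

(** * SK-metrics near prescribed zeros *)

(** Only the strict sign of the Laplacian is kept, since this is what an interior maximum against a
    harmonic function contradicts. *)
Lemma SK_laplacian_pos (lam : C -> R) (z : C) :
  SK_metric unit_disk lam -> unit_disk z -> 0 < lam z ->
  ~ Rbar_le (lower_laplacian (fun w => ln (lam w)) z) 0.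
Proof.
  intros [_ H] Hz Hl K. specialize (H z Hz Hl). unfold curvature in H.
  assert (P : 0 < lam z ^ 2) by (apply pow_lt, Hl).
  assert (PI' : 0 < / lam z ^ 2) by (apply Rinv_0_lt_compat, P).
  destruct (lower_laplacian (fun w => ln (lam w)) z) as [x| |]; simpl in *.
  - unfold Rbar_div in H. simpl in H. nra.
  - exact K.
  - unfold Rbar_div in H. simpl in H. destruct (Rle_dec 0 (/ (lam z * (lam z * 1)))) as [L|L].
    + destruct (Rle_lt_or_eq_dec 0 (/ (lam z * (lam z * 1))) L) as [E|E]; simpl in H; [exact H|].
      simpl in PI'. lra.
    + simpl in PI'. lra.
Qed.

Lemma curvature_le_m4 (lam : C -> R) (z : C) :
  0 < lam z -> Rbar_le (4 * lam z ^ 2) (lower_laplacian (fun w => ln (lam w)) z) ->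
  Rbar_le (curvature lam z) (-4).
Proof.
  intros Hl K. unfold curvature.
  assert (P : 0 < lam z ^ 2) by (apply pow_lt, Hl).
  assert (PI' : 0 < / lam z ^ 2) by (apply Rinv_0_lt_compat, P).
  destruct (lower_laplacian (fun w => ln (lam w)) z) as [x| |]; simpl in *.
  - unfold Rbar_div. simpl.
    assert (4 <= x * / (lam z * (lam z * 1))); [|lra].
    exact (proj1 (Rle_div_r 4 x (lam z ^ 2) P) K).
  - unfold Rbar_div. simpl. destruct (Rle_dec 0 (/ (lam z * (lam z * 1)))) as [L|L].
    + destruct (Rle_lt_or_eq_dec 0 (/ (lam z * (lam z * 1))) L) as [E|E]; simpl; [exact I|].
      simpl in PI'. lra.
    + simpl in PI'. lra.
  - destruct K.
Qed.

Lemma limsup_along_bounded {T} (Fl : (T -> Prop) -> Prop) (f : T -> R) :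
  Rbar_lt (limsup_along Fl f) p_infty <-> exists P B, Fl P /\ forall t, P t -> f t <= B.
Proof.
  unfold limsup_along. set (E := fun y : Rbar => exists P, Fl P /\ y = Lub_Rbar (image_on f P)).
  destruct (Rbar_glb_spec E) as [G1 G2]. split.
  - intros H. apply NNPP. intros N.
    assert (K : Rbar_le p_infty (Rbar_glb E)).
    { apply G2. intros y (P & HP & ->).
      destruct (Lub_Rbar_correct (image_on f P)) as [U _].
      destruct (Lub_Rbar (image_on f P)) as [b| |]; [|exact I|].
      - exfalso. apply N. exists P, b. split; [exact HP|]. intros t Ht. apply (U (f t)). exists t. auto.
      - exfalso. apply N. exists P, 0. split; [exact HP|]. intros t Ht.
        destruct (U (f t)). exists t. auto. }
    destruct (Rbar_glb E); simpl in *; contradiction.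
  - intros (P & B & HP & HB).
    apply (Rbar_le_lt_trans _ B); [|exact I].
    eapply Rbar_le_trans; [apply G1; exists P; split; [exact HP|reflexivity]|].
    destruct (Lub_Rbar_correct (image_on f P)) as [_ U]. apply U.
    intros x (t & Ht & ->). apply HB, Ht.
Qed.

Lemma continuous_Cmod_of (f : C -> C) (z : C) : Ccont f z -> continuous (fun w => Cmod (f w)) z.
Proof. intros H. apply (Ctends_Cmod (locally z) f (f z)), H. Qed.

Lemma continuous_ln_of (f : C -> R) (z : C) :
  0 < f z -> continuous f z -> continuous (fun w => ln (f w)) z.
Proof.
  intros P H. apply (continuous_comp f ln); [exact H|].
  apply (ex_derive_continuous (K := R_AbsRing) (V := R_NormedModule)). exists (/ f z). apply is_derive_ln, P.
Qed.

Lemma continuous_exp_of (f : C -> R) (z : C) : continuous f z -> continuous (fun w => exp (f w)) z.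
Proof.
  intros H. apply (continuous_comp f exp); [exact H|].
  apply (ex_derive_continuous (K := R_AbsRing) (V := R_NormedModule)). exists (exp (f z)). apply is_derive_exp.
Qed.

Lemma continuous_eventually_gt (f : C -> R) (z : C) (e : R) :
  continuous f z -> 0 < e -> locally z (fun w => Rabs (f w - f z) < e).
Proof. intros H He. apply (H _ (locally_ball (f z) (mkposreal e He))). Qed.

Lemma continuous_eventually_pos (f : C -> R) (z : C) :
  continuous f z -> 0 < f z -> locally z (fun w => 0 < f w).
Proof.
  intros H P. generalize (continuous_eventually_gt f z (f z) H P). apply filter_imp.
  intros w K. apply Rabs_lt_between in K. lra.
Qed.

Lemma holo_sub_const (z0 : C) : holo (fun w => w - z0)%C.
Proof. apply (holo_minus (fun w => w) (fun _ => z0)); [apply holo_id|apply holo_const]. Qed.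

(* The maximum principle for [ln lam - (m - eps) ln |w - z0|], which is subharmonic off
   [z0] and tends to minus infinity at [z0]; then [eps] tends to [0]. *)
Lemma SK_zero_order_bound (lam : C -> R) (z0 : C) (m : nat) (rho L : R) :
  SK_metric unit_disk lam -> 0 < rho -> Cmod z0 + rho < 1 -> 0 < L ->
  (forall w, Cmod (w - z0) <= rho -> lam w <= L) ->
  Rbar_lt (limsup_along (locally' z0) (fun z => lam z / Cmod (z - z0)%C ^ m)) p_infty ->
  forall w, w <> z0 -> Cmod (w - z0) <= rho -> lam w <= L * (Cmod (w - z0) / rho) ^ m.
Proof.
  intros HSK Hrho Hz0 HL HlL Hsup.
  apply limsup_along_bounded in Hsup. destruct Hsup as (P & B & HP & HB).
  assert (HdD : forall w, Cmod (w - z0) <= rho -> unit_disk w).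
  { intros w Hw. unfold unit_disk. pose proof (Cmod_triangle_rev w z0). lra. }
  assert (Hs : forall w, w <> z0 -> 0 < Cmod (w - z0) / rho).
  { intros w Hw. apply Rdiv_lt_0_compat; [|exact Hrho]. apply Cmod_sub_pos, Hw. }
  pose (s := fun w => Cmod (w - z0) / rho).
  assert (main : forall e, 0 < e -> forall w, w <> z0 -> Cmod (w - z0) <= rho ->
     lam w * exp ((e - INR m) * ln (s w)) <= L).
  { intros e He.
    (* The exponential of the subharmonic function. The value [0] at [z0] keeps [V] upper
       semicontinuous there and, being below [L], cannot be a maximum that exceeds [L]. *)
    pose (V := fun w => if Ceq_dec w z0 then 0 else lam w * exp ((e - INR m) * ln (s w))).
    assert (HVc : forall p, p <> z0 -> unit_disk p -> continuous (fun w => lam w * exp ((e - INR m) * ln (s w))) p).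
    { intros p Hp Dp. apply (continuous_mult (K := R_AbsRing)).
      - apply HSK, Dp.
      - apply continuous_exp_of. apply (continuous_mult (K := R_AbsRing) (fun _ => e - INR m)).
        + apply continuous_const.
        + apply continuous_ln_of; [apply Hs, Hp|].
          apply (continuous_mult (K := R_AbsRing) (fun w => Cmod (w - z0)) (fun _ => / rho)).
          * apply (continuous_Cmod_of (fun w => w - z0)%C). apply (holo_cont _ _ (holo_sub_const z0) Dp).
          * apply continuous_const. }
    destruct (usc_attains_max V z0 rho Hrho) as (p & Hp & Hmax).
    { intros p Hp d Hd. destruct (Ceq_dec p z0) as [->|N].
      - unfold V at 2. destruct (Ceq_dec z0 z0) as [_|K]; [|congruence]. rewrite Rplus_0_l.
        set (B' := Rabs B * rho ^ m + 1).
        assert (PB : 0 < B').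
        { unfold B'. assert (0 <= Rabs B * rho ^ m); [|lra]. apply Rmult_le_pos; [apply Rabs_pos|apply pow_le; lra]. }
        assert (PdB : 0 < d / B') by (apply Rdiv_lt_0_compat; assumption).
        (* Within this distance of [z0] one has [s w ^ e < d / B'], while the order of vanishing of
           [lam] gives [V w <= B' * s w ^ e]. *)
        set (d' := rho * exp (ln (d / B') / e)).
        assert (Pd' : 0 < d') by (unfold d'; apply Rmult_lt_0_compat; [exact Hrho|apply exp_pos]).
        assert (HP' : locally z0 (fun w => w <> z0 -> P w)) by exact HP.
        generalize (filter_and _ _ HP' (locally_CmodI z0 d' Pd')). apply filter_imp.
        intros w [Pw Cw] _. unfold V. destruct (Ceq_dec w z0) as [E|N]; [exact Hd|].
        specialize (HB w (Pw N)). specialize (Hs w N). fold (s w) in Hs.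
        assert (Cm : 0 < Cmod (w - z0) ^ m).
        { apply pow_lt, Cmod_sub_pos, N. }
        assert (E1 : lam w <= Rabs B * rho ^ m * s w ^ m).
        { apply (proj1 (Rle_div_l _ _ _ Cm)) in HB.
          replace (Rabs B * rho ^ m * s w ^ m) with (Rabs B * Cmod (w - z0) ^ m).
          - eapply Rle_trans; [exact HB|]. apply Rmult_le_compat_r; [lra|apply Rle_abs].
          - rewrite Rmult_assoc, <- Rpow_mult_distr. f_equal. f_equal. unfold s. field. lra. }
        assert (E2 : s w ^ m * exp ((e - INR m) * ln (s w)) = exp (e * ln (s w))).
        { rewrite <- (exp_ln (s w)) at 1 by exact Hs.
          rewrite <- Rpower_pow by apply exp_pos. unfold Rpower. rewrite ln_exp, <- exp_plus. f_equal. ring. }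
        assert (E3 : exp (e * ln (s w)) < d / B').
        { assert (s w < exp (ln (d / B') / e)).
          { unfold s. apply Rlt_div_l; [exact Hrho|]. rewrite Rmult_comm. exact Cw. }
          apply ln_increasing in H; [|exact Hs]. rewrite ln_exp in H.
          rewrite <- (exp_ln (d / B')) by exact PdB. apply exp_increasing.
          apply (proj2 (Rlt_div_r _ _ _ He)) in H. lra. }
        eapply Rle_lt_trans; [apply Rmult_le_compat_r; [left; apply exp_pos|exact E1]|].
        rewrite Rmult_assoc, E2.
        assert (P3 : 0 < exp (e * ln (s w))) by apply exp_pos.
        apply Rle_lt_trans with (B' * exp (e * ln (s w))).
        + apply Rmult_le_compat_r; [lra|]. unfold B'. lra.
        + apply (Rlt_div_r _ _ _ PB) in E3. lra.
      - assert (PN : 0 < Cmod (p - z0)) by (apply Cmod_sub_pos, N).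
        generalize (filter_and _ _ (continuous_eventually_gt _ p d (HVc p N (HdD p Hp)) Hd) (locally_CmodI p _ PN)).
        apply filter_imp. intros w [A Cw] _. unfold V.
        destruct (Ceq_dec w z0) as [->|_].
        { rewrite Cmod_sub_sym in Cw. lra. }
        destruct (Ceq_dec p z0) as [E|_]; [congruence|]. apply Rabs_lt_between in A. lra. }
    intros w1 Hw1 Hw1r. apply Rnot_lt_le. intros Hgt.
    assert (HVp : L < V p).
    { eapply Rlt_le_trans; [|apply (Hmax w1 Hw1r)]. unfold V. destruct (Ceq_dec w1 z0); [congruence|exact Hgt]. }
    unfold V in HVp. destruct (Ceq_dec p z0) as [E|Np]; [lra|].
    (* On the bounding circle [s] is [1], so [V] equals [lam], which is at most [L] there. *)
    assert (Hpr : Cmod (p - z0) < rho).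
    { destruct Hp as [Hp|Hp]; [exact Hp|]. exfalso.
      assert (s p = 1) by (unfold s; rewrite Hp; field; lra).
      rewrite H, ln_1, Rmult_0_r, exp_0, Rmult_1_r in HVp.
      specialize (HlL p ltac:(lra)). lra. }
    assert (Dp : unit_disk p) by (apply HdD, Hp).
    assert (Plam : 0 < lam p).
    { assert (0 < exp ((e - INR m) * ln (s p))) by apply exp_pos.
      apply Rnot_le_lt. intros K. assert (lam p * exp ((e - INR m) * ln (s p)) <= 0) by nra. lra. }
    assert (Clam : continuous lam p) by (apply HSK, Dp).
    (* At the maximum point, [ln lam] minus its value at [p] lies below the increment of the
       harmonic function [(INR m - e) * ln |w - z0|], so its lower Laplacian is at most [0]. *)
    apply (SK_laplacian_pos lam p HSK Dp Plam).
    assert (Npz : (p - z0)%C <> 0) by (apply Csub_neq0, Np).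
    destruct (hjet_scal (INR m - e) _ _ _ (hjet_ln_Cmod (fun w => w - z0)%C p (holo_sub_const z0) Dp Npz)) as [be Hj].
    eapply lower_laplacian_le_0.
    - assert (LD : locally p unit_disk) by (apply unit_disk_locally, Dp).
      generalize (filter_and _ _ (continuous_eventually_pos lam p Clam Plam) LD). apply filter_imp.
      intros w [A Dw]. apply continuous_ln_of; [exact A|apply HSK, Dw].
    - intros d Hd.
      assert (PN : 0 < Cmod (p - z0)) by (apply Cmod_gt_0, Npz).
      assert (Pr : 0 < rho - Cmod (p - z0)) by lra.
      generalize (filter_and _ _ (filter_and _ _ (Hj d Hd) (continuous_eventually_pos lam p Clam Plam))
        (filter_and _ _ (locally_CmodI p _ PN) (locally_CmodI p _ Pr))). apply filter_imp.
      intros w [[J Lw] [W1 W2]].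
      assert (Nw : w <> z0) by (intros ->; rewrite Cmod_sub_sym in W1; lra).
      assert (Wr : Cmod (w - z0) <= rho).
      { replace (w - z0)%C with ((w - p) + (p - z0))%C by ring.
        eapply Rle_trans; [apply Cmod_triangle|]. lra. }
      specialize (Hmax w Wr). unfold V in Hmax.
      destruct (Ceq_dec w z0) as [?|_]; [congruence|]. destruct (Ceq_dec p z0) as [?|_]; [congruence|].
      apply ln_le in Hmax; [|apply Rmult_lt_0_compat; [exact Lw|apply exp_pos]].
      rewrite !ln_mult, !ln_exp in Hmax by (try apply exp_pos; assumption).
      assert (Es : forall q, q <> z0 -> ln (s q) = ln (Cmod (q - z0)) - ln rho).
      { intros q Hq. unfold s. apply ln_div; [|exact Hrho]. apply Cmod_sub_pos, Hq. }
      rewrite (Es w Nw), (Es p Np) in Hmax.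
      apply Rabs_le_between in J. cbv beta in J.
      match type of J with _ <= _ - Re ?X <= _ => apply Rle_trans with (Re X + d * Cmod (w - p) ^ 2); [lra|] end.
      apply Rle_refl. }
  intros w Hw Hwr.
  specialize (Hs w Hw). fold (s w) in Hs. fold (s w).
  destruct (Rle_lt_dec (lam w) 0) as [Z|Z].
  { eapply Rle_trans; [exact Z|]. apply Rmult_le_pos; [lra|]. apply pow_le. lra. }
  assert (PLs : 0 < L * s w ^ m) by (apply Rmult_lt_0_compat; [exact HL|apply pow_lt, Hs]).
  rewrite <- (exp_ln (lam w)) by exact Z. rewrite <- (exp_ln (L * s w ^ m)) by exact PLs.
  enough (K : ln (lam w) <= ln (L * s w ^ m)).
  { apply exp_le_compat, K. }
  rewrite ln_mult by (try apply pow_lt; assumption). rewrite ln_pow by exact Hs.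
  apply le_epsilon. intros e He.
  set (k := Rabs (ln (s w)) + 1).
  assert (Hk : 0 < k) by (unfold k; pose proof (Rabs_pos (ln (s w))); lra).
  assert (Hek : 0 < e / k) by (apply Rdiv_lt_0_compat; assumption).
  pose proof (main (e / k) Hek w Hw Hwr) as M.
  apply ln_le in M; [|apply Rmult_lt_0_compat; [exact Z|apply exp_pos]].
  rewrite ln_mult, ln_exp in M by (try apply exp_pos; assumption).
  assert (- (e / k * ln (s w)) <= e).
  { replace e with (e / k * k) at 2 by (field; lra). rewrite Ropp_mult_distr_r.
    apply Rmult_le_compat_l; [lra|]. unfold k. pose proof (Rle_abs (- ln (s w))). rewrite Rabs_Ropp in H. lra. }
  lra.
Qed.

(** * Strong maximum principle and the Schwarz-Pick lemma *)

Definition mobius (a z : C) : C := ((z - a) / (1 - Cconj a * z))%C.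

Lemma mobius_disk (a z : C) : unit_disk a -> unit_disk z -> unit_disk (mobius a z).
Proof.
  intros Ha Hz. unfold unit_disk, mobius.
  pose proof (mobius_denom_neq0 a z Ha Hz) as N. pose proof (proj1 (Cmod_gt_0 _) N) as P.
  rewrite Cmod_div, Cmod_sub_sym by exact N.
  apply Rlt_div_l; [exact P|]. rewrite Rmult_1_l.
  pose proof (mobius_identity a z) as E.
  pose proof (Cmod_sq_lt1 a Ha). pose proof (Cmod_sq_lt1 z Hz).
  assert (0 < (1 - Cmod a ^ 2) * (1 - Cmod z ^ 2)) by (apply Rmult_lt_0_compat; lra).
  pose proof (Cmod_ge_0 (a - z)). nra.
Qed.

Lemma Cderiv_mobius (a z : C) : unit_disk a -> unit_disk z ->
  Cderiv (mobius a) z ((1 - Cconj a * a) / ((1 - Cconj a * z) * (1 - Cconj a * z)))%C.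
Proof.
  intros Ha Hz. pose proof (mobius_denom_neq0 a z Ha Hz) as N.
  eapply Cderiv_eq.
  2:{ apply (Cderiv_mult (fun z => z - a)%C (fun z => / (1 - Cconj a * z))%C).
      - apply (Cderiv_minus (fun z => z) (fun _ => a)); [apply Cderiv_id|apply Cderiv_const].
      - apply (Cderiv_inv (fun z => 1 - Cconj a * z)%C); [exact N|].
        apply (Cderiv_minus (fun _ => RtoC 1) (fun z => Cconj a * z)%C); [apply Cderiv_const|].
        apply (Cderiv_mult (fun _ => Cconj a) (fun z => z)); [apply Cderiv_const|apply Cderiv_id]. }
  field. exact N.
Qed.

Lemma holo_mobius (a : C) : unit_disk a -> holo (mobius a).
Proof. intros Ha z Hz. eexists. apply Cderiv_mobius; assumption. Qed.

Lemma unit_disk_opp (a : C) : unit_disk a -> unit_disk (- a).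
Proof. unfold unit_disk. rewrite Cmod_opp. auto. Qed.

Lemma mobius_inverse (a z : C) : unit_disk a -> unit_disk z -> mobius (- a) (mobius a z) = z.
Proof.
  intros Ha Hz. pose proof (mobius_denom_neq0 a z Ha Hz) as N.
  pose proof (mobius_denom_neq0 (- a) (mobius a z) (unit_disk_opp a Ha) (mobius_disk a z Ha Hz)) as M.
  pose proof (mobius_denom_neq0 a a Ha Ha) as K.
  unfold mobius in *. rewrite Copp_conj in *. field. split; [exact N|].
  intros E. apply M.
  replace (1 - - Cconj a * ((z - a) / (1 - Cconj a * z)))%C
    with ((1 - Cconj a * z + Cconj a * (z - a)) / (1 - Cconj a * z))%C by (field; exact N).
  replace (1 - Cconj a * z + Cconj a * (z - a))%C with (RtoC 0); [unfold Cdiv; ring|].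
  rewrite <- E. ring.
Qed.

(* [1 - Re f >= 0] has mean value [0], and [|1 - f|^2 <= 2 (1 - Re f)]; Cauchy's formula
   then bounds [|1 - f a|] by a multiple of the mean of [d + |1 - f|^2 / d], for every [d]. *)
Lemma schur_one_at_zero (f : C -> C) : schur f -> f 0 = 1 -> forall a, unit_disk a -> f a = 1.
Proof.
  intros [Hf Hb] H0 a Ha. destruct (unit_disk_radius a Ha) as [r Hr].
  pose proof (Cmod_ge_0 a) as Pa. pose proof PI_RGT_0 as HPI.
  apply Csub_eq0, Cmod_le_eps. intros e He.
  set (k := r / (r - Cmod a)).
  assert (Hk : 0 < k) by (unfold k; apply Rdiv_lt_0_compat; lra).
  set (d := e / k). assert (Hd : 0 < d) by (unfold d; apply Rdiv_lt_0_compat; lra).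
  assert (Hh : holo (fun w => f w - 1)%C) by (apply (holo_minus f (fun _ => RtoC 1)); [exact Hf|apply holo_const]).
  pose proof (cauchy_formula _ a r Hh Hr) as S. cbv beta in S.
  destruct (mean_value f r Hf ltac:(lra)) as [M _]. rewrite H0 in M.
  assert (M' : is_RInt (fun t => k * (d + 2 / d * (1 - Re (f (circ r t))))) 0 (2 * PI) (2 * PI * (k * d))).
  { replace (2 * PI * (k * d)) with (k * ((2 * PI - 0) * d + 2 / d * ((2 * PI - 0) * 1 - 2 * PI))) by (field; lra).
    apply (is_RInt_scal (V := R_NormedModule) _ _ _ k).
    apply (is_RInt_plus (V := R_NormedModule)); [apply (is_RInt_const 0 (2 * PI) d)|].
    apply (is_RInt_scal (V := R_NormedModule) _ _ _ (2 / d)).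
    apply (is_RInt_minus (V := R_NormedModule)); [apply (is_RInt_const 0 (2 * PI) 1)|].
    replace (Re (RtoC (2 * PI) * 1)) with (2 * PI) in M by (simpl; ring). exact M. }
  apply is_Cint_bound_fun with (3 := M') in S; [|lra|].
  - rewrite Cmod_mult, Cmod_R, Rabs_right in S by lra.
    replace (k * d) with e in S by (unfold d; field; lra).
    apply Rmult_le_reg_l with (2 * PI); lra.
  - intros t _. rewrite Cmod_mult, Rmult_comm.
    assert (Nc : (circ r t - a)%C <> 0) by (apply C_neq_of_Cmod; rewrite Cmod_circ; lra).
    apply Rmult_le_compat; try apply Cmod_ge_0.
    + apply cauchy_kernel_bound; lra.
    + assert (Hc : Cmod (f (circ r t)) <= 1) by (apply Hb; unfold unit_disk; rewrite Cmod_circ; lra).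
      pose proof (Cmod_ge_0 (f (circ r t))).
      assert (Q : Cmod (f (circ r t) - 1) ^ 2 <= 2 * (1 - Re (f (circ r t)))).
      { assert (Cmod (f (circ r t)) ^ 2 <= 1) by nra.
        rewrite Cmod2_alt in *. destruct (f (circ r t)); simpl in *. nra. }
      set (x := Cmod (f (circ r t) - 1)) in *. set (y := 1 - Re (f (circ r t))) in *.
      replace (d + 2 / d * y) with ((d * d + 2 * y) / d) by (field; lra).
      apply Rle_div_r; [exact Hd|]. nra.
Qed.

(** A Möbius map moves [z1] to [0] and the unimodular factor [Cconj (g z1)] rotates the value there
    to [1]. *)
Lemma strong_maximum_principle (g : C -> C) (z1 z : C) :
  schur g -> unit_disk z1 -> Cmod (g z1) = 1 -> unit_disk z -> g z = g z1.
Proof.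
  intros [Hg Hb] Hz1 H1 Hz.
  assert (Hm : unit_disk (- z1)) by (apply unit_disk_opp, Hz1).
  assert (E1 : (Cconj (g z1) * g z1)%C = 1).
  { rewrite Cmult_comm, <- Cmod2_conj, H1. apply C_ext; simpl; ring. }
  assert (E0 : mobius (- z1) 0 = z1).
  { unfold mobius. field. }
  assert (Hs : schur (fun w => Cconj (g z1) * g (mobius (- z1) w))%C).
  { split.
    - apply (holo_mult (fun _ => Cconj (g z1))); [apply holo_const|].
      apply (holo_comp g (mobius (- z1))); [intros w Hw; apply mobius_disk; assumption|exact Hg|apply holo_mobius, Hm].
    - intros w Hw. rewrite Cmod_mult, Cmod_conj, H1, Rmult_1_l. apply Hb, mobius_disk; assumption. }
  pose proof (schur_one_at_zero _ Hs) as K. cbv beta in K. rewrite E0 in K.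
  specialize (K E1 (mobius z1 z) (mobius_disk z1 z Hz1 Hz)).
  rewrite mobius_inverse in K by assumption.
  replace (g z) with ((Cconj (g z1) * g z1) * g z)%C by (rewrite E1; ring).
  replace (Cconj (g z1) * g z1 * g z)%C with (g z1 * (Cconj (g z1) * g z))%C by ring.
  rewrite K. ring.
Qed.

Lemma Cderiv_bound (k : C -> C) (w l : C) (B : C -> R) :
  Cderiv k w l -> continuous B w -> locally w (fun z => Cmod (k z - k w) <= B z * Cmod (z - w)) ->
  Cmod l <= B w.
Proof.
  intros Hk HB H. apply le_epsilon. intros e He.
  destruct (proj1 (locally_Cmod _ _) (filter_and _ _ (filter_and _ _ H (Hk _ (half_pos e He)))
     (continuous_eventually_gt B w _ HB (half_pos e He)))) as [d [Hd K]].
  destruct (locally_punctured_C w d Hd) as [z [Z1 Z2]].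
  destruct (K z Z2) as [[K1 K2] K3]. apply Rabs_lt_between in K3.
  assert (P : 0 < Cmod (z - w)) by (apply Cmod_sub_pos, Z1).
  apply Rmult_le_reg_r with (Cmod (z - w)); [exact P|].
  rewrite <- Cmod_mult.
  replace (l * (z - w))%C with ((k z - k w) - (k z - k w - l * (z - w)))%C by ring.
  eapply Rle_trans; [apply Cmod_triangle_sub|]. nra.
Qed.

(** The map [k = mobius (f w) o f] vanishes at [w], hence is a Blaschke factor at [w] times a
    function bounded by [1]. So [|k z| <= |z - w| / |1 - conj w z|], and the derivative of [k] at
    [w] inherits the bound [1 / (1 - |w|^2)]. *)
Lemma schwarz_pick (f : C -> C) (w l : C) :
  analytic_self_map f -> unit_disk w -> Cderiv f w l ->
  Cmod l * (1 - Cmod w ^ 2) <= 1 - Cmod (f w) ^ 2.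
Proof.
  intros [Hf Hm] Hw Hl. apply analytic_on_holo in Hf.
  pose proof (Hm w Hw) as Hfw.
  pose (k := fun z => mobius (f w) (f z)).
  assert (Hk0 : k w = 0) by (unfold k, mobius, Cdiv; ring).
  assert (Hk : schur k).
  { split.
    - apply (holo_comp (mobius (f w)) f); [exact Hm|apply holo_mobius, Hfw|exact Hf].
    - intros z Hz. left. apply mobius_disk; auto. }
  destruct (schur_division k w Hk Hw Hk0) as (g & [_ Hg] & E).
  assert (D : Cderiv k w ((1 - Cconj (f w) * f w) / ((1 - Cconj (f w) * f w) * (1 - Cconj (f w) * f w)) * l)%C).
  { apply (Cderiv_comp (mobius (f w)) f); [exact Hl|]. apply Cderiv_mobius; assumption. }
  assert (En : forall v : C, (1 - Cconj v * v)%C = RtoC (1 - Cmod v ^ 2)).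
  { intros v. rewrite RtoC_minus, Cmod2_conj. ring. }
  assert (B : Cmod ((1 - Cconj (f w) * f w) / ((1 - Cconj (f w) * f w) * (1 - Cconj (f w) * f w)) * l)
      <= (fun z => / Cmod (1 - Cconj w * z)) w).
  { apply (Cderiv_bound k w _ (fun z => / Cmod (1 - Cconj w * z)) D).
    - apply (continuous_comp (fun z => Cmod (1 - Cconj w * z)) Rinv).
      + apply (continuous_Cmod_of (fun z => 1 - Cconj w * z)%C).
        apply Ctends_minus; [apply locally_filter|apply Ctends_const, locally_filter|].
        apply Ctends_mult; [apply locally_filter|apply Ctends_const, locally_filter|apply Ccont_id].
      + apply continuous_Rinv. apply Rgt_not_eq, Cmod_gt_0, mobius_denom_neq0; assumption.
    - generalize (unit_disk_locally w Hw). apply filter_imp. intros z Hz.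
      rewrite Hk0, (E z Hz). replace (blaschke_factor w z * g z - 0)%C with (blaschke_factor w z * g z)%C by ring.
      rewrite Cmod_mult, Cmod_blaschke_factor, (Cmod_sub_sym w z) by assumption.
      specialize (Hg z Hz). pose proof (Cmod_ge_0 (g z)).
      assert (0 <= Cmod (z - w) / Cmod (1 - Cconj w * z)).
      { apply Rmult_le_pos; [apply Cmod_ge_0|]. left. apply Rinv_0_lt_compat, Cmod_gt_0, mobius_denom_neq0; assumption. }
      unfold Rdiv in *. nra. }
  cbv beta in B. rewrite !En in B.
  pose proof (Cmod_sq_lt1 w Hw). pose proof (Cmod_sq_lt1 (f w) Hfw).
  set (x := 1 - Cmod (f w) ^ 2) in *. set (y := 1 - Cmod w ^ 2) in *.
  assert (Nx : RtoC x <> 0) by (intros K; apply RtoC_inj in K; unfold x in K; lra).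
  replace (RtoC x / (RtoC x * RtoC x) * l)%C with (l / RtoC x)%C in B by (field; exact Nx).
  rewrite Cmod_div, !Cmod_R, !Rabs_right in B by (try exact Nx; unfold x, y; lra).
  assert (Px : 0 < x) by (unfold x; lra). assert (Py : 0 < y) by (unfold y; lra).
  apply (Rle_div_l _ _ _ Px) in B.
  apply Rmult_le_compat_r with (r := y) in B; [|lra].
  replace (/ y * x * y) with x in B by (field; lra). exact B.
Qed.

(** * Invariance of the hyperbolic metric under automorphisms *)

(** The density of the pullback under [F] of the hyperbolic metric [|dz| / (1 - |z|^2)] of curvature
    $-4$. *)
Definition pullback (F : C -> C) (z : C) : R :=
  Cmod (C_derive F z) / (1 - Cmod (F z) ^ 2).

(** The Schwarz-Pick inequalities for [T] and for its inverse, whose derivatives multiply to [1],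
    force equality in both. No explicit form of the automorphisms is needed. *)
Lemma automorphism_pullback (T F : C -> C) (z : C) :
  disk_automorphism T -> analytic_self_map F -> unit_disk z ->
  pullback (fun z => T (F z)) z = pullback F z.
Proof.
  intros [HT (S & HS & HST)] [HF HFm] Hz.
  destruct HT as [HTa HTm]. destruct HS as [HSa HSm].
  pose proof (proj1 (analytic_on_holo T) HTa) as HTh. pose proof (proj1 (analytic_on_holo S) HSa) as HSh.
  pose proof (proj1 (analytic_on_holo F) HF) as HFh.
  pose proof (HFm z Hz) as Hv. set (v := F z) in *.
  pose proof (holo_C_derive T v HTh Hv) as DT. set (t := C_derive T v) in *.
  pose proof (holo_C_derive S (T v) HSh (HTm v Hv)) as DS. set (s := C_derive S (T v)) in *.
  pose proof (holo_C_derive F z HFh Hz) as DF.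
  assert (E : (s * t)%C = 1).
  { apply (Cderiv_unique (fun w => S (T w)) v); [apply Cderiv_comp; assumption|].
    apply Cderiv_ext_loc with (fun w => w); [|apply Cderiv_id].
    generalize (unit_disk_locally v Hv). apply filter_imp. intros w Hw. symmetry. apply HST, Hw. }
  pose proof (schwarz_pick T v t (conj HTa HTm) Hv DT) as P1.
  pose proof (schwarz_pick S (T v) s (conj HSa HSm) (HTm v Hv) DS) as P2.
  rewrite (proj1 (HST v Hv)) in P2.
  apply (f_equal Cmod) in E. rewrite Cmod_mult, Cmod_1 in E.
  unfold pullback. fold v.
  rewrite (Cderiv_C_derive _ _ _ (Cderiv_comp T F z t _ DF DT)), Cmod_mult.
  pose proof (Cmod_sq_lt1 v Hv). pose proof (Cmod_sq_lt1 (T v) (HTm v Hv)).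
  set (x := 1 - Cmod v ^ 2) in *. set (y := 1 - Cmod (T v) ^ 2) in *.
  assert (Px : 0 < x) by (unfold x; lra). assert (Py : 0 < y) by (unfold y; lra).
  pose proof (Cmod_ge_0 t). pose proof (Cmod_ge_0 s).
  assert (K : Cmod t * x = y).
  { apply Rle_antisym; [exact P1|].
    assert (Cmod t * (Cmod s * y) <= Cmod t * x) by (apply Rmult_le_compat_l; assumption).
    replace (Cmod t * (Cmod s * y)) with (Cmod s * Cmod t * y) in H3 by ring. rewrite E in H3. lra. }
  rewrite <- K. field. split; [lra|]. intros Z. rewrite Z in E. lra.
Qed.

(** Being a maximal function constrains [F] only as an analytic self-map with a prescribed
    [pullback F]; both properties survive composition with [T]. *)
Lemma maximal_function_automorphism (c : nat -> option C) (T F : C -> C) :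
  disk_automorphism T -> maximal_function c F -> maximal_function c (fun z => T (F z)).
Proof.
  intros HT (H1 & H2 & H3). split; [exact H1|]. split.
  - destruct HT as [[HTa HTm] _]. destruct H2 as [HF HFm]. split.
    + apply analytic_on_holo. apply (holo_comp T F); [exact HFm|apply analytic_on_holo, HTa|apply analytic_on_holo, HF].
    + intros z Hz. apply HTm, HFm, Hz.
  - intros z Hz. rewrite (H3 z Hz). f_equal. symmetry.
    apply (automorphism_pullback T F z HT H2 Hz).
Qed.

(** * The comparison metric *)

Lemma taylor2_peano (A A1 : R -> R) (y0 A2 : R) :
  locally y0 (fun y => is_derive A y (A1 y)) -> is_derive A1 y0 A2 ->
  forall e, 0 < e -> exists d, 0 < d /\ forall h, Rabs h < d ->
    Rabs (A (y0 + h) - A y0 - A1 y0 * h - A2 * h ^ 2 / 2) <= e * h ^ 2.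
Proof.
  intros [d1 H1] H2 e He. destruct (is_derive_small A1 y0 A2 H2 e He) as [d2 [P2 D2]].
  exists (Rmin d1 d2). split; [apply Rmin_pos; [apply cond_pos|exact P2]|].
  intros h Hh. pose proof (Rmin_l d1 d2). pose proof (Rmin_r d1 d2).
  assert (Hs : forall s, Rmin 0 h <= s <= Rmax 0 h -> Rabs s <= Rabs h).
  { intros s Hs. unfold Rmin, Rmax in Hs. unfold Rabs.
    destruct (Rle_dec 0 h), (Rcase_abs s), (Rcase_abs h); lra. }
  assert (HD : forall s, Rmin 0 h <= s <= Rmax 0 h ->
     is_derive (fun s => A (y0 + s) - A1 y0 * s - A2 * s ^ 2 / 2) s (A1 (y0 + s) - A1 y0 - A2 * s)).
  { intros s Hs'. specialize (Hs s Hs').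
    apply (is_derive_minus (V := R_NormedModule)).
    - apply (is_derive_minus (V := R_NormedModule)).
      + replace (A1 (y0 + s)) with (1 * A1 (y0 + s)) by ring.
        apply (is_derive_comp (V := R_NormedModule) A (fun s => y0 + s)).
        * apply H1. change (Rabs (y0 + s - y0) < d1). replace (y0 + s - y0) with s by ring. lra.
        * auto_derive; [trivial|ring].
      + auto_derive; [trivial|ring].
    - auto_derive; [trivial|]. field. }
  destruct (MVT_gen (fun s => A (y0 + s) - A1 y0 * s - A2 * s ^ 2 / 2) 0 h (fun s => A1 (y0 + s) - A1 y0 - A2 * s)) as (c & Hc & E).
  - intros s Hs'. apply HD. lra.
  - intros s Hs'. apply derivable_continuous_pt. eexists. apply is_derive_Reals, HD, Hs'.
  - rewrite Rplus_0_r in E.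
    replace (A (y0 + h) - A y0 - A1 y0 * h - A2 * h ^ 2 / 2)
      with ((A1 (y0 + c) - A1 y0 - A2 * c) * h) by lra.
    specialize (Hs c Hc). specialize (D2 c ltac:(lra)).
    rewrite Rabs_mult, <- (pow2_abs h). pose proof (Rabs_pos h). pose proof (Rabs_pos c).
    apply Rle_trans with (e * Rabs c * Rabs h); [apply Rmult_le_compat_r; assumption|].
    replace (e * Rabs h ^ 2) with (e * Rabs h * Rabs h) by ring.
    apply Rmult_le_compat_r; [assumption|]. apply Rmult_le_compat_l; lra.
Qed.

(** The chain rule [Laplacian (A o y) = A''(y) |grad y|^2] for harmonic [y], with [|grad y| = |ga|],
    read off from second-order jets; the harmonic summand [V] contributes nothing. *)
Lemma lower_laplacian_ge_comp (v V y : C -> R) (A A1 : R -> R) (z a0 ga : C) (A2 : R) :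
  locally z (fun w => continuous v w) ->
  locally z (fun w => v w = V w + A (y w)) ->
  hjet V z a0 -> hjet y z ga ->
  locally (y z) (fun s => is_derive A s (A1 s)) -> is_derive A1 (y z) A2 ->
  Rbar_le (A2 * Cmod ga ^ 2) (lower_laplacian v z).
Proof.
  intros Hc Hv [b0 HV] [b1 Hy] HA HA1.
  replace (A2 * Cmod ga ^ 2) with (2 * (A2 / 2) * Cmod ga ^ 2) by field.
  apply (lower_laplacian_ge v z (a0 + RtoC (A1 (y z)) * ga)%C (b0 + RtoC (A1 (y z)) * b1)%C); [exact Hc|].
  intros e He.
  set (K := Cmod ga + Cmod b1 + 1).
  pose proof (Cmod_ge_0 ga) as Pg. pose proof (Cmod_ge_0 b1) as Pb.
  assert (HK : 1 <= K) by (unfold K; lra).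
  assert (HK2 : 1 <= K ^ 2) by (apply pow_R1_Rle, HK).
  set (e1 := e / (4 * (K + 1) ^ 2)).
  assert (PK : 0 < (K + 1) ^ 2) by (apply pow_lt; lra).
  assert (He1 : 0 < e1) by (unfold e1; apply Rdiv_lt_0_compat; lra).
  destruct (taylor2_peano A A1 (y z) A2 HA HA1 e1 He1) as [d [Hd HT]].
  pose proof (Rabs_pos (A1 (y z))) as PA1. pose proof (Rabs_pos A2) as PA2.
  set (e2 := Rmin 1 (e / (4 * (Rabs (A1 (y z)) + 1)))).
  assert (He2 : 0 < e2) by (unfold e2; apply Rmin_pos; [lra|apply Rdiv_lt_0_compat; lra]).
  set (d3 := Rmin 1 (Rmin (d / (K + 1)) (e / (4 * (Rabs A2 + 1) * (K + 1) ^ 2)))).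
  assert (PD3 : 0 < 4 * (Rabs A2 + 1) * (K + 1) ^ 2) by (apply Rmult_lt_0_compat; lra).
  assert (Hd3 : 0 < d3).
  { unfold d3. repeat apply Rmin_pos; [lra|apply Rdiv_lt_0_compat; lra|apply Rdiv_lt_0_compat; lra]. }
  assert (He4 : 0 < e / 4) by lra.
  generalize (filter_and _ _ (filter_and _ _ Hv (HV (e / 4) He4)) (filter_and _ _ (Hy e2 He2) (locally_CmodI z d3 Hd3))).
  apply filter_imp. intros w [[E1 J0] [J1 Dw]].
  pose proof (locally_singleton _ _ Hv) as Ez. cbv beta in Ez.
  rewrite E1, Ez. set (h := (w - z)%C) in *. set (s := y w - y z) in *.
  pose proof (Cmod_ge_0 h) as Ph.
  assert (D1 : d3 <= 1) by apply Rmin_l.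
  assert (D23 : d3 <= Rmin (d / (K + 1)) (e / (4 * (Rabs A2 + 1) * (K + 1) ^ 2))) by apply Rmin_r.
  assert (D2 : d3 <= d / (K + 1)) by (eapply Rle_trans; [exact D23|apply Rmin_l]).
  assert (D3 : d3 <= e / (4 * (Rabs A2 + 1) * (K + 1) ^ 2)) by (eapply Rle_trans; [exact D23|apply Rmin_r]).
  assert (E21 : e2 <= 1) by apply Rmin_l.
  assert (E22 : e2 <= e / (4 * (Rabs (A1 (y z)) + 1))) by apply Rmin_r.
  assert (Hh2 : 0 <= Cmod h ^ 2) by apply pow2_ge_0.
  assert (Hhh : Cmod h ^ 2 <= Cmod h) by nra.
  set (lin := Re (ga * h)). set (quad := Re (b1 * (h * h))).
  assert (EL : Re (ga * h + b1 * (h * h)) = lin + quad) by reflexivity.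
  rewrite EL in J1.
  assert (Lin : Rabs lin <= Cmod ga * Cmod h) by (unfold lin; rewrite <- Cmod_mult; apply re_le_Cmod).
  assert (Quad : Rabs quad <= Cmod b1 * Cmod h ^ 2).
  { unfold quad. replace (Cmod b1 * Cmod h ^ 2) with (Cmod (b1 * (h * h))) by (rewrite !Cmod_mult; ring).
    apply re_le_Cmod. }
  assert (Sl : Rabs (s - lin) <= K * Cmod h ^ 2).
  { replace (s - lin) with ((s - (lin + quad)) + quad) by ring.
    eapply Rle_trans; [apply Rabs_triang|]. unfold K.
    assert (e2 * Cmod h ^ 2 <= 1 * Cmod h ^ 2) by (apply Rmult_le_compat_r; assumption).
    assert (0 <= Cmod ga * Cmod h ^ 2) by (apply Rmult_le_pos; assumption). lra. }
  assert (S1 : Rabs s <= (K + 1) * Cmod h).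
  { apply Rle_trans with (Cmod ga * Cmod h + (e2 + Cmod b1) * Cmod h ^ 2).
    - replace s with (lin + ((s - (lin + quad)) + quad)) by ring.
      eapply Rle_trans; [apply Rabs_triang|].
      pose proof (Rabs_triang (s - (lin + quad)) quad). lra.
    - assert ((e2 + Cmod b1) * Cmod h ^ 2 <= (1 + Cmod b1) * Cmod h) by (apply Rmult_le_compat; lra).
      unfold K. nra. }
  assert (Sd : Rabs s < d).
  { eapply Rle_lt_trans; [exact S1|]. rewrite Rmult_comm. apply Rlt_div_r; [lra|]. lra. }
  specialize (HT s Sd). replace (y z + s) with (y w) in HT by (unfold s; ring).
  (* The error [e] is split into four quarters: the jet of [V], the Taylor remainder of [A], the jet
     of [y] multiplied by [A1 (y z)], and the replacement of [s ^ 2] by the square of its linear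
     part. *)
  assert (Q1 : e1 * s ^ 2 <= e / 4 * Cmod h ^ 2).
  { rewrite <- (pow2_abs s).
    apply Rle_trans with (e1 * ((K + 1) * Cmod h) ^ 2).
    - apply Rmult_le_compat_l; [lra|]. apply pow_incr. split; [apply Rabs_pos|exact S1].
    - right. unfold e1. field. lra. }
  assert (Q2 : Rabs (A1 (y z) * (s - (lin + quad))) <= e / 4 * Cmod h ^ 2).
  { rewrite Rabs_mult.
    apply Rle_trans with ((Rabs (A1 (y z)) + 1) * (e / (4 * (Rabs (A1 (y z)) + 1)) * Cmod h ^ 2)).
    - apply Rmult_le_compat; try apply Rabs_pos; [lra|]. eapply Rle_trans; [exact J1|].
      apply Rmult_le_compat_r; assumption.
    - right. field. lra. }
  assert (Q3 : Rabs (A2 / 2 * (s ^ 2 - lin ^ 2)) <= e / 4 * Cmod h ^ 2).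
  { replace (A2 / 2 * (s ^ 2 - lin ^ 2)) with (A2 * ((s - lin) * ((s + lin) / 2))) by field.
    rewrite !Rabs_mult.
    assert (X : Rabs ((s + lin) / 2) <= (K + 1) * Cmod h).
    { unfold Rdiv. rewrite Rabs_mult, (Rabs_right (/ 2)) by lra.
      pose proof (Rabs_triang s lin).
      assert (Cmod ga * Cmod h <= (K + 1) * Cmod h) by (apply Rmult_le_compat_r; unfold K; lra). lra. }
    assert (Y : Rabs (s - lin) * Rabs ((s + lin) / 2) <= ((K + 1) * Cmod h ^ 2) * ((K + 1) * d3)).
    { apply Rmult_le_compat; try apply Rabs_pos; [nra|].
      eapply Rle_trans; [exact X|]. apply Rmult_le_compat_l; lra. }
    apply Rle_trans with ((Rabs A2 + 1) * (((K + 1) * Cmod h ^ 2) * ((K + 1) * (e / (4 * (Rabs A2 + 1) * (K + 1) ^ 2))))).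
    - apply Rmult_le_compat; [lra|apply Rmult_le_pos; apply Rabs_pos|lra|].
      eapply Rle_trans; [exact Y|]. apply Rmult_le_compat_l; [apply Rmult_le_pos; lra|].
      apply Rmult_le_compat_l; lra.
    - right. field. lra. }
  apply Rabs_le_between in J0, HT, Q2, Q3. fold h in J0.
  replace (Re ((a0 + A1 (y z) * ga) * h + (b0 + A1 (y z) * b1) * (h * h)))
    with (Re (a0 * h + b0 * (h * h)) + A1 (y z) * (lin + quad)) by (unfold lin, quad; simpl; ring).
  nra.
Qed.

(* In terms of [y = ln |F|]: multiplying the hyperbolic density by [exp (- th sqrt (1 - |F|))]
   pushes its curvature strictly below [-4]. *)
Definition profile (th y : R) : R := - ln (1 - exp y ^ 2) - th * sqrt (1 - exp y).

Definition profile' (th y : R) : R :=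
  2 * exp y ^ 2 / (1 - exp y ^ 2) + th * exp y / (2 * sqrt (1 - exp y)).

Lemma is_derive_profile (th y : R) : y < 0 -> is_derive (profile th) y (profile' th y).
Proof.
  intros Hy. assert (P : 0 < exp y < 1).
  { split; [apply exp_pos|]. rewrite <- exp_0. apply exp_increasing, Hy. }
  unfold profile, profile'.
  assert (0 < sqrt (1 - exp y)) by (apply sqrt_lt_R0; lra).
  auto_derive.
  - split; [nra|]. split; [lra|trivial].
  - replace (1 + - exp y) with (1 - exp y) by ring. field. split; [lra|nra].
Qed.

(** The first summand is the contribution of the hyperbolic density and accounts for curvature
    exactly $-4$; the second is the gain from the concave root. *)
Lemma is_derive_profile' (th y : R) : y < 0 ->
  is_derive (profile' th) y
    (4 * exp y ^ 2 / (1 - exp y ^ 2) ^ 2 + th * (exp y * (2 - exp y)) / (4 * (1 - exp y) * sqrt (1 - exp y))).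
Proof.
  intros Hy. assert (P : 0 < exp y < 1).
  { split; [apply exp_pos|]. rewrite <- exp_0. apply exp_increasing, Hy. }
  unfold profile'.
  assert (S : 0 < sqrt (1 - exp y)) by (apply sqrt_lt_R0; lra).
  assert (S2 : sqrt (1 - exp y) * sqrt (1 - exp y) = 1 - exp y) by (apply sqrt_sqrt; lra).
  auto_derive.
  - replace (1 + - exp y) with (1 - exp y) by ring.
    split; [nra|]. split; [lra|]. split; [lra|trivial].
  - replace (1 + - exp y) with (1 - exp y) by ring.
    set (s := sqrt (1 - exp y)) in *. set (q := exp y) in *.
    assert (E : q = 1 - s * s) by lra. rewrite E. field. split; [lra|]. nra.
Qed.

(* [th / 64 = 2 th (129 / 128 - 1)], where [129 / 128] is the ratio of consecutive bounds in the
   iteration; any ratio close enough to [1] would do. *)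
Lemma comparison_inequality (q th : R) : 0 < q < 1 -> 0 < th <= 1 ->
  exp (th / 64 * (- ln q + sqrt (1 - q))) <= 1 + th * sqrt (1 - q) / (8 * q).
Proof.
  intros Hq Hth. set (x := - ln q). set (s := sqrt (1 - q)).
  assert (Hx : 0 < x).
  { unfold x. rewrite <- (Ropp_involutive 0), Ropp_0. apply Ropp_lt_contravar.
    rewrite <- ln_1. apply ln_increasing; lra. }
  assert (Eq : q = exp (- x)) by (unfold x; rewrite Ropp_involutive, exp_ln; lra).
  assert (Hs0 : 0 < s) by (unfold s; apply sqrt_lt_R0; lra).
  assert (Hs2 : s * s = 1 - q) by (unfold s; apply sqrt_sqrt; lra).
  assert (Hs1 : s <= 1) by nra.
  assert (Hs : 1 - q <= s) by nra.
  assert (Eiq : / q = exp x) by (rewrite Eq, exp_Ropp, Rinv_inv; reflexivity).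
  assert (Hex : 1 + x <= / q) by (rewrite Eiq; apply exp_ineq1_le).
  (* From [q (1 + x) <= 1] one gets [x <= (1 - q) (1 + x)], and [1 - q <= s]. Thus [- ln q] is
     dominated by the root near [q = 1], and [p <= s (2 + x)] carries the factor [s] needed on the
     right-hand side. *)
  assert (Hxs : x <= s * (1 + x)).
  { assert (q * (1 + x) <= 1).
    { apply Rle_trans with (q * / q); [apply Rmult_le_compat_l; lra|right; field; lra]. }
    assert ((1 - q) * (1 + x) <= s * (1 + x)) by (apply Rmult_le_compat_r; lra). lra. }
  set (p := x + s). set (u := th / 64 * p).
  assert (Hp : 0 < p) by (unfold p; lra).
  assert (Hu : 0 < u) by (unfold u; apply Rmult_lt_0_compat; lra).
  assert (A : exp u - 1 <= u * exp u).
  { pose proof (exp_ineq1_le (- u)). pose proof (exp_pos u).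
    assert (exp u * exp (- u) = 1) by (rewrite <- exp_plus, Rplus_opp_r; apply exp_0).
    assert (exp u * (1 - u) <= exp u * exp (- u)) by (apply Rmult_le_compat_l; lra). lra. }
  assert (B : exp u <= exp ((x + 1) / 64)).
  { assert (u <= (x + 1) / 64).
    { unfold u. assert (th * p <= 1 * (x + 1)) by (apply Rmult_le_compat; unfold p in *; lra). lra. }
    apply exp_le_compat, H. }
  (* Here [exp x = / q] absorbs both the factor [2 + x] and the small exponential, which controls
     the range of small [q]. *)
  assert (D : (2 + x) * exp ((x + 1) / 64) <= 8 * exp x).
  { replace x with (((x + 1) / 64) + (x - (x + 1) / 64)) at 3 by ring. rewrite exp_plus.
    pose proof (exp_ineq1_le (x - (x + 1) / 64)). pose proof (exp_pos ((x + 1) / 64)). nra. }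
  assert (Hps : p <= s * (2 + x)) by (unfold p; lra).
  assert (M : p * exp u <= 8 * s / q).
  { apply Rle_trans with ((s * (2 + x)) * exp ((x + 1) / 64)).
    - apply (Rmult_le_compat p (s * (2 + x)) (exp u) (exp ((x + 1) / 64)));
        [lra|left; apply exp_pos|exact Hps|exact B].
    - replace (8 * s / q) with (s * (8 * exp x)) by (rewrite <- Eiq; field; lra).
      rewrite Rmult_assoc. apply Rmult_le_compat_l; lra. }
  fold p. change (exp u <= 1 + th * s / (8 * q)).
  assert (u * exp u <= th / 64 * (8 * s / q)).
  { unfold u at 1. rewrite Rmult_assoc. apply Rmult_le_compat_l; lra. }
  replace (th * s / (8 * q)) with (th / 64 * (8 * s / q)) by (field; lra). lra.
Qed.

(** [E] stands for [exp (2 (u - th p))]. After [s * s = 1 - q] both sides of the remaining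
    comparison carry the same power of [1 - q], and what is left is [2 / (1 + q)^2 <= 2 - q] on
    [(0, 1)]. *)
Lemma curvature_inequality (q th E : R) : 0 < q < 1 -> 0 < th <= 1 ->
  E <= 1 + th * sqrt (1 - q) / (8 * q) ->
  4 * E * q ^ 2 / (1 - q ^ 2) ^ 2 <=
  4 * q ^ 2 / (1 - q ^ 2) ^ 2 + th * (q * (2 - q)) / (4 * (1 - q) * sqrt (1 - q)).
Proof.
  intros Hq Hth HE. set (s := sqrt (1 - q)) in *.
  assert (Hs0 : 0 < s) by (unfold s; apply sqrt_lt_R0; lra).
  assert (Hs2 : s * s = 1 - q) by (unfold s; apply sqrt_sqrt; lra).
  assert (Pq : 0 < 1 - q ^ 2) by nra.
  assert (PQ : 0 < (1 - q ^ 2) ^ 2) by (apply pow_lt, Pq).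
  assert (Pf : 0 < q ^ 2 / (1 - q ^ 2) ^ 2) by (apply Rdiv_lt_0_compat; [nra|exact PQ]).
  replace (4 * E * q ^ 2 / (1 - q ^ 2) ^ 2) with (4 * (q ^ 2 / (1 - q ^ 2) ^ 2) * E) by (field; lra).
  eapply Rle_trans; [apply Rmult_le_compat_l; [lra|exact HE]|].
  replace (4 * (q ^ 2 / (1 - q ^ 2) ^ 2) * (1 + th * s / (8 * q)))
    with (4 * q ^ 2 / (1 - q ^ 2) ^ 2 + th * q * (s / (2 * (1 - q ^ 2) ^ 2))) by (field; split; lra).
  apply Rplus_le_compat_l.
  replace (th * (q * (2 - q)) / (4 * (1 - q) * s)) with (th * q * ((2 - q) / (4 * (1 - q) * s))) by (field; split; lra).
  apply Rmult_le_compat_l; [nra|].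
  replace ((1 - q ^ 2) ^ 2) with ((1 - q) * (1 - q) * (1 + q) ^ 2) by ring.
  replace (s / (2 * ((1 - q) * (1 - q) * (1 + q) ^ 2)))
    with (s * s / (2 * (1 - q) * (1 - q) * (1 + q) ^ 2 * s)) by (field; repeat split; lra).
  rewrite Hs2.
  replace ((1 - q) / (2 * (1 - q) * (1 - q) * (1 + q) ^ 2 * s))
    with ((2 / (1 + q) ^ 2) / (4 * (1 - q) * s)) by (field; repeat split; lra).
  apply Rmult_le_compat_r; [left; apply Rinv_0_lt_compat; apply Rmult_lt_0_compat; lra|].
  apply Rle_div_l; [apply pow_lt; lra|]. nra.
Qed.

(** * Maximal functions *)

Section Maximal.
Variables (c : nat -> option C) (F : C -> C).
Hypothesis hc : sequence_in unit_disk c.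
Hypothesis hF : maximal_function c F.

Let HFh : holo F.
Proof. apply analytic_on_holo, hF. Qed.

Let HFd (z : C) : unit_disk z -> unit_disk (F z).
Proof. apply hF. Qed.

Let HF' : holo (C_derive F).
Proof. apply holo_derivative, HFh. Qed.

Lemma one_minus_sq_pos (z : C) : unit_disk z -> 0 < 1 - Cmod (F z) ^ 2.
Proof. intros Hz. pose proof (Cmod_sq_lt1 (F z) (HFd z Hz)). lra. Qed.

Lemma pullback_ge0 (z : C) : unit_disk z -> 0 <= pullback F z.
Proof.
  intros Hz. unfold pullback. apply Rmult_le_pos; [apply Cmod_ge_0|].
  left. apply Rinv_0_lt_compat, one_minus_sq_pos, Hz.
Qed.

Lemma continuous_pullback (z : C) : unit_disk z -> continuous (pullback F) z.
Proof.
  intros Hz. unfold pullback. apply (continuous_mult (K := R_AbsRing)).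
  - apply continuous_Cmod_of, holo_cont; assumption.
  - apply (continuous_comp (fun w => 1 - Cmod (F w) ^ 2) Rinv).
    + apply (continuous_minus (V := R_NormedModule) (fun _ => 1)); [apply continuous_const|].
      apply (continuous_comp (fun w => Cmod (F w)) (fun x => x ^ 2)).
      * apply continuous_Cmod_of, holo_cont; assumption.
      * apply (ex_derive_continuous (K := R_AbsRing) (V := R_NormedModule)). auto_derive. trivial.
    + apply continuous_Rinv. pose proof (one_minus_sq_pos z Hz). lra.
Qed.

Lemma Phi_le_pullback (lam : C -> R) (z : C) : Phi c lam -> unit_disk z -> lam z <= pullback F z.
Proof.
  intros Hl Hz. destruct hF as (_ & _ & H). specialize (H z Hz).
  unfold lambda_max in H. destruct (Lub_Rbar_correct (fun x => exists lam, Phi c lam /\ x = lam z)) as [U _].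
  rewrite H in U. apply (U (lam z)). exists lam. auto.
Qed.

(** The maximal density is known only as a supremum, so its order of vanishing at the points of [c]
    must be deduced from the family. Each member has its own limsup constant, but all lie below the
    continuous [pullback F], hence below one [L] on one disc; [SK_zero_order_bound] then bounds them
    with constants that do not depend on [lam]. *)
Lemma pullback_zero_order (z0 : C) (m : nat) :
  (0 < m)%nat -> multiplicity c z0 m ->
  unit_disk z0 /\ exists K, locally z0 (fun w => w <> z0 -> pullback F w <= K * Cmod (w - z0) ^ m).
Proof.
  intros Hm Hmul.
  assert (Hz0 : unit_disk z0).
  { destruct Hmul as (l & _ & Hl & H). destruct l as [|n l]; [simpl in Hl; lia|].
    apply (proj1 hc n). apply H. left. reflexivity. }
  split; [exact Hz0|].
  set (L := pullback F z0 + 1).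
  assert (HL : 0 < L) by (unfold L; pose proof (pullback_ge0 z0 Hz0); lra).
  destruct (proj1 (locally_Cmod _ _) (continuous_eventually_gt _ z0 1 (continuous_pullback z0 Hz0) Rlt_0_1))
    as [d [Hd HdL]].
  unfold unit_disk in Hz0.
  set (rho := Rmin (d / 2) ((1 - Cmod z0) / 2)).
  assert (R1 : rho <= d / 2) by apply Rmin_l. assert (R2 : rho <= (1 - Cmod z0) / 2) by apply Rmin_r.
  assert (Hrho : 0 < rho) by (unfold rho; apply Rmin_pos; lra).
  clearbody rho.
  exists (L / rho ^ m). apply locally_Cmod. exists rho. split; [exact Hrho|].
  intros w Hw Nw.
  assert (Dw : forall v, Cmod (v - z0) <= rho -> unit_disk v).
  { intros v Hv. unfold unit_disk. pose proof (Cmod_triangle_rev v z0). lra. }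
  assert (Prm : 0 < rho ^ m) by (apply pow_lt, Hrho).
  replace (L / rho ^ m * Cmod (w - z0) ^ m) with (L * (Cmod (w - z0) / rho) ^ m)
    by (unfold Rdiv; rewrite Rpow_mult_distr, pow_inv; ring).
  destruct hF as (_ & _ & H). specialize (H w (Dw w ltac:(lra))).
  unfold lambda_max in H. destruct (Lub_Rbar_correct (fun x => exists lam, Phi c lam /\ x = lam w)) as [_ U].
  rewrite H in U. apply (U (Finite (L * (Cmod (w - z0) / rho) ^ m))).
  intros x (lam & Hlam & ->). simpl.
  apply (SK_zero_order_bound lam z0 m rho L); [apply Hlam|exact Hrho|lra|exact HL| | |exact Nw|lra].
  - intros v Hv. eapply Rle_trans; [apply (Phi_le_pullback lam v Hlam (Dw v Hv))|].
    specialize (HdL v ltac:(lra)). apply Rabs_lt_between in HdL. unfold L. lra.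
  - apply Hlam; assumption.
Qed.

(** A member of the family is positive somewhere, and there [F'] cannot vanish since [pullback F]
    dominates it. If [F] vanishes at that point the zero is simple, and a nearby point works. *)
Lemma noncritical_point : exists z, unit_disk z /\ F z <> 0 /\ C_derive F z <> 0.
Proof.
  destruct hF as ([lam Hlam] & _).
  destruct (proj2 (proj2 (proj1 (proj1 Hlam)))) as (z2 & Hz2 & N2).
  pose proof (proj1 (proj2 (proj1 (proj1 Hlam))) z2 Hz2) as P2.
  pose proof (Phi_le_pullback lam z2 Hlam Hz2) as L2.
  assert (N : C_derive F z2 <> 0).
  { intros K. unfold pullback in L2. rewrite K, Cmod_0 in L2. unfold Rdiv in L2. lra. }
  destruct (Ceq_dec (F z2) 0) as [E|E]; [|exists z2; auto].
  pose proof (proj1 (Cmod_gt_0 _) N) as PN.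
  pose proof (holo_C_derive F z2 HFh Hz2) as D.
  destruct (proj1 (locally_Cmod _ _) (filter_and _ _ (D _ (half_pos _ PN))
    (filter_and _ _ (unit_disk_locally z2 Hz2) (holo_cont _ _ HF' Hz2 _ PN)))) as [d [Hd K]].
  destruct (locally_punctured_C z2 d Hd) as [w [W1 W2]].
  destruct (K w W2) as [K1 [K2 K3]].
  exists w. split; [exact K2|]. split.
  - intros Z. rewrite Z, E in K1.
    replace (0 - 0 - C_derive F z2 * (w - z2))%C with (- (C_derive F z2 * (w - z2)))%C in K1 by ring.
    rewrite Cmod_opp, Cmod_mult in K1.
    assert (0 < Cmod (w - z2)) by (apply Cmod_sub_pos, W1). nra.
  - intros Z. rewrite Z in K3. replace (0 - C_derive F z2)%C with (- C_derive F z2)%C in K3 by ring.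
    rewrite Cmod_opp in K3. lra.
Qed.

(** * The comparison density attached to a zero-free factor *)

Variable g : C -> C.
Hypothesis Hg : holo g.
Hypothesis Hg0 : forall z, unit_disk z -> g z <> 0.

Definition barrier (z : C) : R := - ln (Cmod (F z)) + sqrt (1 - Cmod (F z)).

Definition comparison_density (th : R) (w : C) : R :=
  if Ceq_dec (F w) 0 then 0
  else pullback F w * exp (- ln (Cmod (g w)) - th * barrier w).

Lemma Cmod_F_lt1 (z : C) : unit_disk z -> F z <> 0 -> 0 < Cmod (F z) < 1.
Proof. intros Hz N. split; [apply Cmod_gt_0, N|apply HFd, Hz]. Qed.

Lemma comparison_density_ge0 (th : R) (w : C) : unit_disk w -> 0 <= comparison_density th w.
Proof.
  intros Hw. unfold comparison_density. destruct (Ceq_dec (F w) 0); [lra|].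
  apply Rmult_le_pos; [apply pullback_ge0, Hw|left; apply exp_pos].
Qed.

Lemma locally_neq0 (f : C -> C) (z : C) : Ccont f z -> f z <> 0 -> locally z (fun w => f w <> 0).
Proof.
  intros Hf N. generalize (Hf _ (proj1 (Cmod_gt_0 _) N)). apply filter_imp. intros w A Z.
  rewrite Z in A. replace (0 - f z)%C with (- f z)%C in A by ring. rewrite Cmod_opp in A. lra.
Qed.

(* Near a zero of [F] the term [- th barrier <= th ln |F|] dominates. *)
Lemma comparison_density_le (th : R) (w : C) : 0 <= th -> unit_disk w ->
  comparison_density th w <= pullback F w * / Cmod (g w) *
    (if Ceq_dec (F w) 0 then 0 else exp (th * ln (Cmod (F w)))).
Proof.
  intros Hth Hw. unfold comparison_density. destruct (Ceq_dec (F w) 0) as [E|N]; [lra|].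
  rewrite Rmult_assoc. apply Rmult_le_compat_l; [apply pullback_ge0, Hw|].
  rewrite <- (exp_ln (/ Cmod (g w))) by (apply Rinv_0_lt_compat, Cmod_gt_0, Hg0, Hw).
  rewrite ln_Rinv by (apply Cmod_gt_0, Hg0, Hw). rewrite <- exp_plus.
  apply exp_le_compat. unfold barrier. pose proof (sqrt_pos (1 - Cmod (F w))). nra.
Qed.

(** At a zero of [F] continuity comes from the factor [|F|^th], the exponential of [th * ln |F|],
    which tends to [0] because [th > 0]; the other factors stay bounded. *)
Lemma continuous_comparison_density (th : R) (z : C) : 0 < th -> unit_disk z ->
  continuous (comparison_density th) z.
Proof.
  intros Hth Hz.
  destruct (Ceq_dec (F z) 0) as [E|N].
  - set (K := pullback F z * / Cmod (g z) + 1).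
    assert (CB : continuous (fun w => pullback F w * / Cmod (g w)) z).
    { apply (continuous_mult (K := R_AbsRing)); [apply continuous_pullback, Hz|].
      apply (continuous_comp (fun w => Cmod (g w)) Rinv).
      - apply continuous_Cmod_of, holo_cont; assumption.
      - apply continuous_Rinv, Rgt_not_eq, Cmod_gt_0, Hg0, Hz. }
    assert (PK0 : 0 <= pullback F z * / Cmod (g z)).
    { apply Rmult_le_pos; [apply pullback_ge0, Hz|]. left. apply Rinv_0_lt_compat, Cmod_gt_0, Hg0, Hz. }
    assert (PK : 0 < K) by (unfold K; lra).
    intros P [e He].
    assert (PeK : 0 < e / K) by (apply Rdiv_lt_0_compat; [apply cond_pos|exact PK]).
    set (d := exp (ln (e / K) / th)).
    assert (Pd : 0 < d) by apply exp_pos.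
    generalize (filter_and _ _ (filter_and _ _ (continuous_eventually_gt _ z 1 CB Rlt_0_1) (unit_disk_locally z Hz))
       (holo_cont F z HFh Hz d Pd)). unfold filtermap. apply filter_imp.
    intros w [[A Dw] B]. apply He.
    assert (Z : comparison_density th z = 0).
    { unfold comparison_density. destruct (Ceq_dec (F z) 0); [reflexivity|congruence]. }
    rewrite Z. change (Rabs (comparison_density th w - 0) < e).
    rewrite Rminus_0_r, Rabs_right by (apply Rle_ge, comparison_density_ge0, Dw).
    eapply Rle_lt_trans; [apply comparison_density_le; [lra|exact Dw]|].
    destruct (Ceq_dec (F w) 0) as [E'|N']; [rewrite Rmult_0_r; apply cond_pos|].
    rewrite E in B. replace (F w - 0)%C with (F w) in B by ring.
    apply Rabs_lt_between in A.
    assert (PF : 0 < Cmod (F w)) by (apply Cmod_gt_0, N').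
    assert (X : exp (th * ln (Cmod (F w))) < e / K).
    { apply ln_increasing in B; [|exact PF]. unfold d in B. rewrite ln_exp in B.
      apply (proj2 (Rlt_div_r _ _ _ Hth)) in B.
      rewrite <- (exp_ln (e / K)) by exact PeK. apply exp_increasing. lra. }
    pose proof (exp_pos (th * ln (Cmod (F w)))).
    apply Rle_lt_trans with (K * exp (th * ln (Cmod (F w)))).
    + apply Rmult_le_compat_r; [lra|]. unfold K. lra.
    + apply (proj2 (Rlt_div_r _ _ _ PK)) in X. lra.
  - pose proof (Cmod_F_lt1 z Hz N) as PF.
    apply (continuous_ext_loc _ (fun w => pullback F w * exp (- ln (Cmod (g w)) - th * barrier w))).
    + generalize (locally_neq0 F z (holo_cont F z HFh Hz) N). apply filter_imp. intros w Nw.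
      unfold comparison_density. destruct (Ceq_dec (F w) 0); [contradiction|reflexivity].
    + assert (CF : continuous (fun w => Cmod (F w)) z) by (apply continuous_Cmod_of, holo_cont; assumption).
      apply (continuous_mult (K := R_AbsRing)); [apply continuous_pullback, Hz|].
      apply continuous_exp_of. apply (continuous_minus (V := R_NormedModule)).
      * apply (continuous_opp (V := R_NormedModule)). apply continuous_ln_of; [apply Cmod_gt_0, Hg0, Hz|].
        apply continuous_Cmod_of, holo_cont; assumption.
      * apply (continuous_mult (K := R_AbsRing) (fun _ => th)); [apply continuous_const|].
        unfold barrier. apply (continuous_plus (V := R_NormedModule)).
        -- apply (continuous_opp (V := R_NormedModule)). apply continuous_ln_of; [apply PF|exact CF].
        -- apply (continuous_comp (fun w => 1 - Cmod (F w)) sqrt).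
           ++ apply (continuous_minus (V := R_NormedModule) (fun _ => 1)); [apply continuous_const|exact CF].
           ++ apply continuous_sqrt.
Qed.

(** Separates a combination of logarithms of moduli of zero-free analytic functions, harmonic near
    [w], from a function of the harmonic [ln |F|] alone, as the Laplacian estimate for compositions
    requires. *)
Lemma ln_comparison_density (th : R) (w : C) :
  unit_disk w -> F w <> 0 -> C_derive F w <> 0 ->
  ln (comparison_density th w) =
  (ln (Cmod (C_derive F w)) + (-1 * ln (Cmod (g w)) + th * ln (Cmod (F w)))) + profile th (ln (Cmod (F w))).
Proof.
  intros Hw N N'. unfold comparison_density. destruct (Ceq_dec (F w) 0); [contradiction|].
  pose proof (Cmod_F_lt1 w Hw N) as PF. pose proof (one_minus_sq_pos w Hw) as P1.
  pose proof (proj1 (Cmod_gt_0 _) N') as PF'.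
  unfold pullback, profile, barrier.
  rewrite exp_ln by lra.
  rewrite ln_mult, ln_exp, ln_div; [ring|assumption|assumption| |apply exp_pos].
  apply Rdiv_lt_0_compat; assumption.
Qed.

Lemma comparison_density_curvature (th : R) (z : C) :
  0 < th <= 1 -> unit_disk z -> F z <> 0 -> C_derive F z <> 0 ->
  - ln (Cmod (g z)) <= th * (129 / 128) * barrier z ->
  Rbar_le (4 * comparison_density th z ^ 2) (lower_laplacian (fun w => ln (comparison_density th w)) z).
Proof.
  intros Hth Hz N N' Hu.
  pose proof (Cmod_F_lt1 z Hz N) as PF. pose proof (proj1 (Cmod_gt_0 _) N') as PF'.
  set (q := Cmod (F z)) in *.
  assert (Hy : ln q < 0) by (rewrite <- ln_1; apply ln_increasing; lra).
  assert (Hpos : forall w, unit_disk w -> F w <> 0 -> C_derive F w <> 0 -> 0 < comparison_density th w).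
  { intros w Hw Nw Nw'. unfold comparison_density. destruct (Ceq_dec (F w) 0); [contradiction|].
    apply Rmult_lt_0_compat; [|apply exp_pos]. apply Rdiv_lt_0_compat; [apply Cmod_gt_0, Nw'|apply one_minus_sq_pos, Hw]. }
  assert (Hloc : locally z (fun w => unit_disk w /\ F w <> 0 /\ C_derive F w <> 0)).
  { apply filter_and; [apply unit_disk_locally, Hz|]. apply filter_and.
    - apply locally_neq0; [apply holo_cont; assumption|exact N].
    - apply locally_neq0; [apply holo_cont; assumption|exact N']. }
  eapply Rbar_le_trans.
  2:{ eapply (lower_laplacian_ge_comp (fun w => ln (comparison_density th w))
       (fun w => ln (Cmod (C_derive F w)) + (-1 * ln (Cmod (g w)) + th * ln (Cmod (F w))))
       (fun w => ln (Cmod (F w))) (profile th) (profile' th) z).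
    - generalize Hloc. apply filter_imp. intros w (Dw & Nw & Nw').
      apply continuous_ln_of; [apply Hpos; assumption|apply continuous_comparison_density; [lra|exact Dw]].
    - generalize Hloc. apply filter_imp. intros w (Dw & Nw & Nw'). apply ln_comparison_density; assumption.
    - apply hjet_plus; [apply hjet_ln_Cmod; assumption|].
      apply hjet_plus; apply hjet_scal; apply hjet_ln_Cmod; auto.
    - apply hjet_ln_Cmod; assumption.
    - fold q. assert (Pn : 0 < - ln q) by lra. exists (mkposreal _ Pn). intros s Hs.
      change (Rabs (s - ln q) < - ln q) in Hs. apply Rabs_lt_between in Hs. apply is_derive_profile. lra.
    - fold q. apply is_derive_profile', Hy. }
  fold q. rewrite exp_ln by lra. rewrite Cmod_div by exact N. fold q. simpl Rbar_le.
  set (D := Cmod (C_derive F z)) in *.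
  assert (Ec : comparison_density th z ^ 2 =
     D ^ 2 / (1 - q ^ 2) ^ 2 * exp (2 * (- ln (Cmod (g z)) - th * barrier z))).
  { unfold comparison_density. destruct (Ceq_dec (F z) 0); [contradiction|].
    replace (2 * (- ln (Cmod (g z)) - th * barrier z))
      with ((- ln (Cmod (g z)) - th * barrier z) + (- ln (Cmod (g z)) - th * barrier z)) by ring.
    rewrite exp_plus. unfold pullback. fold D q. field.
    pose proof (one_minus_sq_pos z Hz). fold q in H. lra. }
  (* The hypothesis bounds the exponent by [2 * th * (129 / 128 - 1) * barrier z = th / 64 * barrier
     z]. *)
  assert (HE : exp (2 * (- ln (Cmod (g z)) - th * barrier z)) <= 1 + th * sqrt (1 - q) / (8 * q)).
  { eapply Rle_trans; [|apply comparison_inequality; assumption].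
    apply exp_le_compat. unfold barrier in *. fold q in Hu. fold q. lra. }
  pose proof (curvature_inequality q th _ PF Hth HE) as K.
  pose proof (one_minus_sq_pos z Hz) as P1. fold q in P1.
  change (4 * comparison_density th z ^ 2 <=
    (4 * q ^ 2 / (1 - q ^ 2) ^ 2 + th * (q * (2 - q)) / (4 * (1 - q) * sqrt (1 - q))) * (D / q) ^ 2).
  rewrite Ec.
  replace (4 * (D ^ 2 / (1 - q ^ 2) ^ 2 * exp (2 * (- ln (Cmod (g z)) - th * barrier z))))
    with ((4 * exp (2 * (- ln (Cmod (g z)) - th * barrier z)) * q ^ 2 / (1 - q ^ 2) ^ 2) * (D / q) ^ 2)
    by (field; lra).
  apply Rmult_le_compat_r; [apply pow2_ge_0|exact K].
Qed.

Lemma comparison_density_Phi (th : R) :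
  0 < th <= 1 ->
  (forall z, unit_disk z -> F z <> 0 -> C_derive F z <> 0 ->
     - ln (Cmod (g z)) <= th * (129 / 128) * barrier z) ->
  Phi c (comparison_density th).
Proof.
  intros Hth Hu. split; [split; [split; [|split]|]|].
  - intros z Hz. apply continuous_comparison_density; [lra|exact Hz].
  - intros z Hz. apply comparison_density_ge0, Hz.
  - destruct noncritical_point as (z & Hz & N & N'). exists z. split; [exact Hz|].
    unfold comparison_density. destruct (Ceq_dec (F z) 0); [contradiction|].
    apply Rmult_integral_contrapositive_currified; [|apply Rgt_not_eq, exp_pos].
    apply Rgt_not_eq. apply Rdiv_lt_0_compat; [apply Cmod_gt_0, N'|apply one_minus_sq_pos, Hz].
  - intros z Hz Hp.
    (* The curvature condition concerns only points where the density is positive, which excludes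
       the zeros of [F] and of its derivative. *)
    assert (N : F z <> 0).
    { intros E. unfold comparison_density in Hp. destruct (Ceq_dec (F z) 0); [lra|contradiction]. }
    assert (N' : C_derive F z <> 0).
    { intros E. unfold comparison_density in Hp. destruct (Ceq_dec (F z) 0); [lra|].
      unfold pullback in Hp. rewrite E, Cmod_0 in Hp. unfold Rdiv in Hp. lra. }
    apply curvature_le_m4; [exact Hp|]. apply comparison_density_curvature; auto.
  (* The density is at most [pullback F w / |g w|], since [|F|^th <= 1], and [1 / |g|] is bounded
     near [z0]; so the order of vanishing of [pullback F] is inherited, whether or not [F] vanishes
     at [z0]. *)
  - intros z0 m Hm Hmul. destruct (pullback_zero_order z0 m Hm Hmul) as (Hz0 & K & HK).
    apply limsup_along_bounded.
    pose proof (Hg0 z0 Hz0) as Ng. pose proof (proj1 (Cmod_gt_0 _) Ng) as Pg.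
    exists (fun w => comparison_density th w / Cmod (w - z0) ^ m <= Rabs K * (2 / Cmod (g z0))), (Rabs K * (2 / Cmod (g z0))).
    split; [|auto].
    generalize (filter_and _ _ HK (filter_and _ _ (unit_disk_locally z0 Hz0) (holo_cont g z0 Hg Hz0 _ (half_pos _ Pg)))).
    unfold locally', within. apply filter_imp. intros w [A [Dw B]] Nw. specialize (A Nw).
    assert (Pm : 0 < Cmod (w - z0) ^ m).
    { apply pow_lt, Cmod_sub_pos, Nw. }
    apply Rle_div_l; [exact Pm|].
    assert (Pgw : Cmod (g z0) / 2 < Cmod (g w)).
    { pose proof (Cmod_triangle_rev (g z0) (g w)). rewrite Cmod_sub_sym in B. lra. }
    assert (G2 : / Cmod (g w) <= 2 / Cmod (g z0)).
    { replace (2 / Cmod (g z0)) with (/ (Cmod (g z0) / 2)) by (field; lra). apply Rinv_le_contravar; lra. }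
    assert (G0 : 0 < / Cmod (g w)) by (apply Rinv_0_lt_compat; lra).
    pose proof (pullback_ge0 w Dw) as L0.
    eapply Rle_trans; [apply comparison_density_le; [lra|exact Dw]|].
    apply Rle_trans with (pullback F w * / Cmod (g w)).
    + rewrite <- Rmult_1_r. apply Rmult_le_compat_l; [apply Rmult_le_pos; lra|].
      destruct (Ceq_dec (F w) 0) as [E|N]; [lra|]. rewrite <- exp_0. apply exp_le_compat.
      pose proof (Cmod_F_lt1 w Dw N) as PF.
      assert (ln (Cmod (F w)) <= 0) by (rewrite <- ln_1; apply ln_le; lra). nra.
    + replace (Rabs K * (2 / Cmod (g z0)) * Cmod (w - z0) ^ m)
        with ((Rabs K * Cmod (w - z0) ^ m) * (2 / Cmod (g z0))) by ring.
      apply Rmult_le_compat; [exact L0|lra| |exact G2].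
      eapply Rle_trans; [exact A|]. apply Rmult_le_compat_r; [lra|apply Rle_abs].
Qed.

Lemma barrier_bound_improves (th : R) :
  0 < th <= 1 ->
  (forall z, unit_disk z -> F z <> 0 -> C_derive F z <> 0 ->
     - ln (Cmod (g z)) <= th * (129 / 128) * barrier z) ->
  forall z, unit_disk z -> F z <> 0 -> C_derive F z <> 0 -> - ln (Cmod (g z)) <= th * barrier z.
Proof.
  intros Hth Hu z Hz N N'.
  pose proof (Phi_le_pullback _ z (comparison_density_Phi th Hth Hu) Hz) as K.
  unfold comparison_density in K. destruct (Ceq_dec (F z) 0); [contradiction|].
  assert (P : 0 < pullback F z).
  { apply Rdiv_lt_0_compat; [apply Cmod_gt_0, N'|apply one_minus_sq_pos, Hz]. }
  assert (E : exp (- ln (Cmod (g z)) - th * barrier z) <= 1).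
  { apply Rmult_le_reg_l with (pullback F z); [exact P|]. lra. }
  apply ln_le in E; [|apply exp_pos]. rewrite ln_exp, ln_1 in E. lra.
Qed.

Hypothesis HgF : forall z, unit_disk z -> Cmod (F z) <= Cmod (g z) <= 1.

Lemma barrier_bound (n : nat) :
  forall z, unit_disk z -> F z <> 0 -> C_derive F z <> 0 ->
  - ln (Cmod (g z)) <= (128 / 129) ^ n * barrier z.
Proof.
  induction n as [|n IH].
  - intros z Hz N _. rewrite pow_O, Rmult_1_l. unfold barrier.
    pose proof (sqrt_pos (1 - Cmod (F z))).
    pose proof (ln_le _ _ (proj1 (Cmod_F_lt1 z Hz N)) (proj1 (HgF z Hz))). lra.
  - apply barrier_bound_improves.
    (* The improvement is applied with [th = (128 / 129) ^ S n], for which the bound already known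
       is the required [th * (129 / 128)] times the barrier. *)
    + split; [apply pow_lt; lra|]. rewrite <- (pow1 (S n)). apply pow_incr. lra.
    + intros z Hz N N'. replace ((128 / 129) ^ S n * (129 / 128)) with ((128 / 129) ^ n) by (simpl; field).
      apply IH; assumption.
Qed.

Lemma zero_free_factor_constant : exists eta, Cmod eta = 1 /\ forall z, unit_disk z -> g z = eta.
Proof.
  destruct noncritical_point as (z1 & Hz1 & N & N').
  assert (B0 : 0 <= barrier z1).
  { unfold barrier. pose proof (sqrt_pos (1 - Cmod (F z1))). pose proof (Cmod_F_lt1 z1 Hz1 N) as PF.
    assert (ln (Cmod (F z1)) <= 0) by (rewrite <- ln_1; apply ln_le; lra). lra. }
  assert (U : - ln (Cmod (g z1)) <= 0).
  { apply le_epsilon. intros e He. rewrite Rplus_0_l.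
    assert (Hk : 0 < e / (barrier z1 + 1)) by (apply Rdiv_lt_0_compat; lra).
    destruct (pow_lt_1_zero (128 / 129) ltac:(rewrite Rabs_right; lra) _ Hk) as [n Hn].
    specialize (Hn n (Nat.le_refl _)). rewrite Rabs_right in Hn by (apply Rle_ge, pow_le; lra).
    eapply Rle_trans; [apply (barrier_bound n z1 Hz1 N N')|].
    apply Rle_trans with (e / (barrier z1 + 1) * (barrier z1 + 1)).
    - apply Rmult_le_compat; [apply pow_le; lra|exact B0|lra|lra].
    - right. field. lra. }
  assert (E : Cmod (g z1) = 1).
  { apply Rle_antisym; [apply HgF, Hz1|]. apply Rnot_lt_le. intros L.
    assert (Pg : 0 < Cmod (g z1)) by (apply Cmod_gt_0, Hg0, Hz1).
    apply ln_increasing in L; [|exact Pg]. rewrite ln_1 in L. lra. }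
  exists (g z1). split; [exact E|]. intros z Hz.
  apply strong_maximum_principle; [|exact Hz1|exact E|exact Hz].
  split; [exact Hg|intros w Hw; apply HgF, Hw].
Qed.

End Maximal.

Lemma maximal_function_blaschke (c : nat -> option C) (F : C -> C) :
  sequence_in unit_disk c -> maximal_function c F -> blaschke_product F.
Proof.
  intros hc hF.
  destruct (noncritical_point c F hF) as (z1 & Hz1 & N & _).
  assert (HS : schur F).
  { destruct hF as (_ & [HFa HFm] & _). split; [apply analytic_on_holo, HFa|]. intros z Hz. left. apply HFm, Hz. }
  destruct (schur_zero_free_factor F z1 HS Hz1 N) as (a & g & Ha & Hser & Hg & Hgb & Hlim).
  destruct (zero_free_factor_constant c F hc hF g Hg (fun z Hz => proj1 (Hgb z Hz)) (fun z Hz => proj2 (Hgb z Hz)))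
    as (eta & He & Heta).
  exists eta, a. split; [exact He|]. split; [exact Ha|]. split; [exact Hser|].
  intros z Hz. apply (Ctends_filterlim eventually).
  apply (Ctends_ext_loc eventually (fun n => blaschke_partial a z n * g z)%C); [|apply Hlim, Hz].
  apply filter_forall. intros n. rewrite (Heta z Hz). ring.
Qed.

Theorem theorem1p2 (c : nat -> option C) (F : C -> C)
  (hc : sequence_in unit_disk c) (hF : maximal_function c F) :
  indestructible_blaschke_product F.
Proof.
  split; [exact (maximal_function_blaschke c F hc hF)|].
  intros T HT. apply (maximal_function_blaschke c); [exact hc|].
  apply maximal_function_automorphism; assumption.
Qed.
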